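(* Let $\Xi$ be a hyperuniform point process on $\mathbb{R}^2$ of type I, II or III. For $L>0$ let $\Xi_L=L^{-1/2}\,\Xi$ be its dilation by a factor $L^{-1/2}$. Fix any nonempty open bounded convex set $\Omega\subset\mathbb{R}^2$ and let $N=\#(\Xi_L\cap\Omega)$. Then there are constants $C>0$ and $L_0\geq 1$ such that for all $L\ge L_0$ $$\mathbb{E}\,W_2\left(\frac1N\sum_{x\in\Xi_L\cap\Omega}\delta_x,\ \frac1{\operatorname{Vol}(\Omega)}\operatorname{Vol}|_\Omega\right)\le\frac{C}{\sqrt L}.$$
   Context: A (simple) point process is a random subset of $\mathbb{R}^2$ without accumulation points. It is homogeneous if its first intensity with respect to Lebesgue measure is a constant $c_1>0$, i.e. $\mathbb{E}\sum_{x\in\Xi}f(x)=c_1\int f$ for measurable $f\ge 0$. A homogeneous point process $\Xi$ on $\mathbb{R}^2$ is hyperuniform if its law is invariant under translations and $\lim_{r\to\infty}\operatorname{Var}(\Xi(B_r))/\operatorname{Vol}(B_r)=0$, where $\Xi(B_r)$ is the number of points in the ball $B_r$ of radius $r$ centred at the origin. With $\widehat f(\xi)=\int f(x)e^{-2\pi i x\cdot\xi}dx$, the spectral measure of $\Xi$ is the non-negative measure $\mathcal{S}$ with $\operatorname{Var}\left(\sum_{x\in\Xi}f(x)\right)=\int_{\mathbb{R}^2}|\widehat f(\xi)|^2d\mathcal{S}(\xi)$. When $\mathcal{S}$ is absolutely continuous its density $s$ is called the structure factor; $s$ is taken to be bounded and uniformly continuous. The types are defined (for processes with a structure factor) by the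 behaviour of $s$ near the origin: type I: $s(w)=c|w|^\alpha+o(|w|^\alpha)$ as $w\to0$ for some $\alpha>1$; type II: $s(w)=c|w|+o(|w|)$ as $w\to0$; type III: $s(w)=c|w|^\alpha+o(|w|^\alpha)$ as $w\to0$ for some $0<\alpha<1$; here $c$ is a constant. $\operatorname{Vol}$ is Lebesgue measure. For finite positive measures $\mu,\nu$ of equal total mass, $W_2(\mu,\nu)=\left(\inf_\pi\int|x-y|^2d\pi(x,y)\right)^{1/2}$, the infimum being over positive measures $\pi$ on the product with marginals $\mu,\nu$. Convention: on the event $N=0$, where the empirical measure is undefined, the $W_2$ term is given the value $\operatorname{diam}(\Omega)$. *)

(* Defs.v *)
From HB Require Import structures.
From mathcomp Require Import all_boot all_order all_algebra finmap complex.
From mathcomp Require Import all_classical all_reals all_analysis.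
From mathcomp Require Import measurable_realfun.

Set Implicit Arguments.
Unset Strict Implicit.
Unset Printing Implicit Defensive.

Import Order.TTheory GRing.Theory Num.Theory.
Import numFieldNormedType.Exports.

Local Open Scope classical_set_scope.
Local Open Scope ring_scope.

Notation plane R := (R * R)%type (only parsing).

(* The library states lebesgue_measure for the sigma-algebra generated by the
   half-open intervals, under a display of its own; leb is the same measure for
   the canonical (convertible) measurable structure of R. *)
Definition leb {R : realType} : set R -> \bar R := @lebesgue_measure R.

Section leb_measure.
Variable R : realType.

Let leb0 : leb set0 = 0%E :> \bar R.
Proof. exact: (measure0 (@lebesgue_measure R)). Qed.

Let leb_ge0 (A : set R) : (0 <= leb A)%E.
Proof. exact: (measure_ge0 (@lebesgue_measure R)). Qed.

Let leb_sigma_additive : semi_sigma_additive (@leb R).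
Proof. exact: (@measure_semi_sigma_additive _ _ _ (@lebesgue_measure R)). Qed.

HB.instance Definition _ := isMeasure.Build _ R R (@leb R)
  leb0 leb_ge0 leb_sigma_additive.

Let leb_sigma_finite : sigma_finite setT (@leb R).
Proof. exact: (sigma_finiteT (@lebesgue_measure R)). Qed.

HB.instance Definition _ :=
  @Measure_isSigmaFinite.Build _ R R (@leb R) leb_sigma_finite.

End leb_measure.

Notation leb2 := (leb \x leb)%E.

Section plane_geometry.
Context {R : realType}.

Definition dotp (x y : plane R) : R := x.1 * y.1 + x.2 * y.2.

(* The library norm on a product is the sup norm, hence a separate Euclidean
   one; both induce the same topology, uniformity and bounded sets. *)
Definition enorm (x : plane R) : R := Num.sqrt (dotp x x).

Definition edisc (r : R) : set (plane R) := [set x | enorm x < r].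

Definition ediam (A : set (plane R)) : R :=
  sup [set enorm (p.1 - p.2) | p in A `*` A].

(* \hat f(xi) = \int f(x) exp(- 2 i pi x.xi) dx *)
Definition fourier (f : plane R -> R) (xi : plane R) : R[i] :=
  Complex (\int[leb2]_x (f x * cos (2 * pi * dotp x xi)))
          (- \int[leb2]_x (f x * sin (2 * pi * dotp x xi))).

Definition normsq (z : R[i]) : R := complex.Re z ^+ 2 + complex.Im z ^+ 2.

End plane_geometry.

(* Configurations carry the sigma-algebra generated by the counts of points in
   Borel sets. *)
Definition count_events (R : realType) : set (set (set (plane R))) :=
  [set E | exists (B : set (plane R)) (k : \bar R), measurable B /\
     E = [set A | counting (A `&` B) = k]].

Definition config (R : realType) := g_sigma_algebraType (@count_events R).

Section point_processes.
Context {d : measure_display} {T : measurableType d} {R : realType}.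
Variables (P : probability T R) (Xi : T -> set (plane R)).

Definition point_process : Prop :=
  measurable_fun [set: T] (Xi : T -> config R) /\
  forall t, limit_point (Xi t) = set0.

Definition law : set (config R) -> \bar R :=
  pushforward P (Xi : T -> config R).

Definition homogeneous : Prop :=
  exists c1 : R, 0 < c1 /\
    forall f : plane R -> \bar R, measurable_fun setT f ->
      (forall x, 0 <= f x)%E ->
      (\int[P]_t (\esum_(x in Xi t) f x) = c1%:E * \int[leb2]_x f x)%E.

End point_processes.

Definition translate (R : realType) (v : plane R) (A : set (plane R)) :
  set (plane R) := [set x + v | x in A].

Definition dilate (R : realType) (a : R) (A : set (plane R)) :
  set (plane R) := [set a *: x | x in A].

Section hyperuniformity.
Context {d : measure_display} {T : measurableType d} {R : realType}.
Variables (P : probability T R) (Xi : T -> set (plane R)).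

Definition translation_invariant : Prop :=
  forall (v : plane R) (E : set (config R)), measurable E ->
    law P (fun t => translate v (Xi t)) E = law P Xi E.

Definition hyperuniform : Prop :=
  [/\ point_process Xi, homogeneous P Xi, translation_invariant &
      ('V_P[fun t => fine (counting (Xi t `&` edisc r))] *
         ((fine (leb2 (edisc r : set (plane R))))^-1)%:E)%E
        @[r --> +oo] --> 0%E].

(* Bounded measurable functions with bounded support: the linear statistic
   \sum_(x in Xi) f x is then a finite sum. *)
Definition test_function (f : plane R -> R) : Prop :=
  [/\ measurable_fun setT f, bounded_fun f & bounded_set [set x | f x != 0]].

Definition spectral_measure (S : {measure set (plane R) -> \bar R}) : Prop :=
  forall f, test_function f ->
    ('V_P[fun t => (\sum_(x \in Xi t) f x)%R] =
     \int[S]_xi (normsq (fourier f xi))%:E)%E.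

Definition structure_factor (s : plane R -> R) : Prop :=
  [/\ (forall w, 0 <= s w), bounded_fun (s : plane R -> R^o), unif_continuous s &
      exists2 S : {measure set (plane R) -> \bar R},
        spectral_measure S &
        forall A, measurable A -> (S A = \int[leb2]_(w in A) (s w)%:E)%E].

(* s(w) = c |w|^alpha + o(|w|^alpha) as w -> 0 *)
Definition origin_behaviour (s : plane R -> R) (c alpha : R) : Prop :=
  (s : plane R -> R^o) = (fun w => c * enorm w `^ alpha)
    +o_ (nbhs (0 : plane R)) (fun w => enorm w `^ alpha : R^o).

Definition type_I : Prop :=
  exists s c alpha,
    [/\ structure_factor s, 1 < alpha & origin_behaviour s c alpha].

Definition type_II : Prop :=
  exists s c, structure_factor s /\ origin_behaviour s c 1.

Definition type_III : Prop :=
  exists s c alpha,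
    [/\ structure_factor s, 0 < alpha, alpha < 1 & origin_behaviour s c alpha].

End hyperuniformity.

Section wasserstein.
Context {R : realType}.

(* mu and nu are bare set functions; the marginal conditions force them to be
   measures as soon as a coupling exists (otherwise W2 mu nu = +oo). *)
Definition coupling (mu nu : set (plane R) -> \bar R)
    (p : {measure set (plane R * plane R) -> \bar R}) : Prop :=
  (forall B, measurable B -> p (B `*` setT) = mu B) /\
  (forall B, measurable B -> p (setT `*` B) = nu B).

Definition W2 (mu nu : set (plane R) -> \bar R) : \bar R :=
  (ereal_inf [set \int[p]_z (enorm (z.1 - z.2) ^+ 2)%:E | p in coupling mu nu]
    `^ 2^-1)%E.

(* Meaningful for finite A only (fset_set of an infinite set is empty); used on
   a locally finite set intersected with a bounded one. *)
Definition npoints (A : set (plane R)) : nat := #|` fset_set A|.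

Definition empirical (A : set (plane R)) : set (plane R) -> \bar R :=
  fun B => ((npoints A)%:R^-1%:E * \sum_(x \in A) (\d_x B : \bar R))%E.

Definition uniform_on (Om : set (plane R)) : set (plane R) -> \bar R :=
  fun B => ((fine (leb2 Om))^-1%:E * leb2 (B `&` Om))%E.

(* The empirical measure is undefined when A misses Om; the value is then
   diam Om by convention. *)
Definition W2_to_uniform (Om A : set (plane R)) : \bar R :=
  if npoints (A `&` Om) == 0%N then (ediam Om)%:E
  else W2 (empirical (A `&` Om)) (uniform_on Om).

End wasserstein.

(* Main.v *)
(* A coupling is built from a flow on a grid.  Cut a square containing the domain
   into about L cells of the size of the mean spacing, and let f be the excess of
   points over the mean number of points in each cell.  Haar-type averaging over
   dyadic blocks writes f as the divergence of a flow whose squared norm is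
   bounded by a weighted sum over all dyadic blocks of the squared block sums of
   f.  The boundedness of s bounds the variance of a count in A by C Vol(A)
   (Bessel's inequality); its decay at the origin, together with the Fourier tail
   of a square, improves this to C Vol(A)^(1 - epsilon) for squares.  With weights
   which are summable from both ends of the range of scales, the expected squared
   norm of the flow is of order L: the small gain in the exponent pays for the
   small and medium blocks, and the few blocks which meet the boundary of the
   convex domain are counted by area.
   The flow lives on the whole square; inversion in the boundary of the domain,
   which is Lipschitz and boundedly many to one, folds it onto the cells inside.
   Following the flow for unit time by a Markov chain with short jumps couples the
   two masses at a quadratic cost h^2 (1 + sum J^2 / nu), where h is the size of a
   cell.  The event that the domain contains too few points is handled by
   Chebyshev's inequality. *)
From HB Require Import structures.
Require Import Defs.
From mathcomp Require Import all_boot all_order all_algebra finmap complex.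
From mathcomp Require Import all_classical all_reals all_analysis.
From mathcomp Require Import measurable_realfun.
From mathcomp Require Import zify ring lra.

Import Order.TTheory GRing.Theory Num.Theory.
Import numFieldNormedType.Exports.

Local Open Scope classical_set_scope.
Local Open Scope ring_scope.

(** * Transport of finite measures along a flow *)

(** For independent points a block of [2 ^ m] by [2 ^ m] cells has count variance of order [4 ^ m];
    all K scales then contribute equally and a factor of order log L survives. Any power gain in the
    variance makes the sum over scales geometric, which is why the three types can be treated alike.
    Two obstacles shape the rest. The cost of a flow has the reference mass of a cell in the
    denominator, and a cell meeting the domain in a sliver has almost none; so the flow is carried
    into cells contained in the domain, by a map with fibres of bounded size, which a radial
    projection to the boundary would not have. The target mass has no lower bound at all, since a
    cell may contain no point; so the flow is followed only to the midpoint, where half of the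
    reference mass is still present, and the second half of the way is handled by iteration. The
    excess of points is measured against the actual number of points in the domain, not its mean,
    because a flow without flux through the border of the square needs total excess zero. *)

Section finite_transport.
Context {R : realType} {B : finType}.
Implicit Types (mu nu : B -> R) (pi : B -> B -> R) (u : B -> R) (p : B -> R * R).

Definition fcoupling mu nu pi :=
  [/\ forall x y, 0 <= pi x y, forall x, \sum_y pi x y = mu x &
      forall y, \sum_x pi x y = nu y].

Definition sqcost u pi := \sum_x \sum_y pi x y * (u x - u y) ^+ 2.

Definition fcost p pi := sqcost (fst \o p) pi + sqcost (snd \o p) pi.

(** The two transitions are independent given the middle point: [pi1 x y * pi2 y z / mu y] is the
    law of the triple. *)
Definition glue mu pi1 pi2 : B -> B -> R :=
  fun x z => \sum_y pi1 x y * pi2 y z / mu y.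

Lemma glue_coupling mu1 mu2 mu3 pi1 pi2 : (forall b, 0 < mu2 b) ->
  fcoupling mu1 mu2 pi1 -> fcoupling mu2 mu3 pi2 ->
  fcoupling mu1 mu3 (glue mu2 pi1 pi2).
Proof.
move=> mu0 [p0 pl pr] [q0 ql qr]; split.
- move=> x z; apply: sumr_ge0 => y _.
  by rewrite divr_ge0 ?mulr_ge0 // ltW.
- move=> x; rewrite exchange_big /= -pl; apply: eq_bigr => y _.
  under eq_bigr do rewrite mulrAC.
  by rewrite -mulr_sumr ql divfK ?gt_eqF.
- move=> z; rewrite exchange_big /= -qr; apply: eq_bigr => y _.
  under eq_bigr do rewrite -mulrA.
  by rewrite -mulr_suml pr mulrCA divff ?gt_eqF ?mulr1.
Qed.

Lemma glue_costE u mu2 pi1 pi2 :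
  sqcost u (glue mu2 pi1 pi2) =
  \sum_y \sum_x \sum_z pi1 x y * pi2 y z / mu2 y * (u x - u z) ^+ 2.
Proof.
rewrite /sqcost /glue [RHS]exchange_big; apply: eq_bigr => x _.
rewrite [RHS]exchange_big; apply: eq_bigr => z _.
by rewrite mulr_suml; apply: eq_bigr.
Qed.

(** Young's inequality with parameter [theta], integrated against the law of the triple. *)
Lemma glue_cost_split u mu1 mu2 mu3 pi1 pi2 (theta : R) : 0 < theta ->
  (forall b, 0 < mu2 b) -> fcoupling mu1 mu2 pi1 -> fcoupling mu2 mu3 pi2 ->
  sqcost u (glue mu2 pi1 pi2) <=
  (1 + theta) * sqcost u pi1 + (1 + theta^-1) * sqcost u pi2.
Proof.
move=> th0 mu0 [p0 pl pr] [q0 ql qr]; rewrite glue_costE.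
have -> : sqcost u pi1 =
    \sum_y \sum_x \sum_z pi1 x y * pi2 y z / mu2 y * (u x - u y) ^+ 2.
  rewrite /sqcost exchange_big; apply: eq_bigr => y _.
  apply: eq_bigr => x _; rewrite -mulr_suml; congr (_ * _).
  under eq_bigr do rewrite mulrAC.
  by rewrite -mulr_sumr ql divfK ?gt_eqF.
have -> : sqcost u pi2 =
    \sum_y \sum_x \sum_z pi1 x y * pi2 y z / mu2 y * (u y - u z) ^+ 2.
  rewrite /sqcost; apply: eq_bigr => y _.
  rewrite exchange_big; apply: eq_bigr => z _; rewrite -mulr_suml.
  congr (_ * _); under eq_bigr do rewrite -mulrA.
  by rewrite -mulr_suml pr mulrCA divff ?gt_eqF ?mulr1.
rewrite !mulr_sumr -big_split /=; apply: ler_sum => y _.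
rewrite !mulr_sumr -big_split /=; apply: ler_sum => x _.
rewrite !mulr_sumr -big_split /=; apply: ler_sum => z _.
rewrite !(mulrCA _ (_ / _)) -mulrDr ler_wpM2l ?divr_ge0 ?mulr_ge0 ?(ltW (mu0 _))//.
set a := u x - u y; set b := u y - u z.
have -> : u x - u z = a + b by rewrite /a /b; ring.
have -> : (1 + theta) * a ^+ 2 + (1 + theta^-1) * b ^+ 2 =
  (a + b) ^+ 2 + theta^-1 * (theta * a - b) ^+ 2.
  by field; rewrite gt_eqF.
by rewrite lerDl mulr_ge0 ?sqr_ge0 // invr_ge0 ltW.
Qed.

(** Given the middle point, the cross term sees only the mean displacement of the second transition.
    So the large factor [theta^-1] falls on the squared mean, while the fluctuation keeps the factor
    1. With [glue_cost_split] instead, the bound for a chain of many short jumps would grow with the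
    number of steps. *)
Lemma glue_cost_drift u mu1 mu2 mu3 pi1 pi2 (theta : R) : 0 < theta ->
  (forall b, 0 < mu2 b) -> fcoupling mu1 mu2 pi1 -> fcoupling mu2 mu3 pi2 ->
  sqcost u (glue mu2 pi1 pi2) <=
  (1 + theta) * sqcost u pi1 + sqcost u pi2 +
  theta^-1 * \sum_y (\sum_z pi2 y z * (u y - u z)) ^+ 2 / mu2 y.
Proof.
move=> th0 mu0 [p0 pl pr] [q0 ql qr]; rewrite glue_costE.
pose d y := \sum_z pi2 y z * (u y - u z).
have -> : sqcost u pi1 = \sum_y \sum_x pi1 x y * (u x - u y) ^+ 2.
  by rewrite /sqcost exchange_big.
rewrite mulr_sumr -big_split /= mulr_sumr -big_split /=.
apply: ler_sum => y _; rewrite -/(d y).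
have -> : \sum_x \sum_z pi1 x y * pi2 y z / mu2 y * (u x - u z) ^+ 2 =
  \sum_x (pi1 x y * (u x - u y) ^+ 2 + 2 * pi1 x y / mu2 y * (u x - u y) * d y)
  + \sum_z pi2 y z * (u y - u z) ^+ 2.
  have -> : \sum_z pi2 y z * (u y - u z) ^+ 2 =
    \sum_x pi1 x y / mu2 y * \sum_z pi2 y z * (u y - u z) ^+ 2.
    by rewrite -mulr_suml -mulr_suml pr divff ?gt_eqF ?mul1r.
  rewrite -big_split; apply: eq_bigr => x _ /=.
  have -> : pi1 x y * (u x - u y) ^+ 2 =
    \sum_z pi2 y z * (pi1 x y / mu2 y * (u x - u y) ^+ 2).
    rewrite -mulr_suml ql mulrA; congr (_ * _).
    by rewrite mulrCA divff ?gt_eqF ?mulr1.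
  rewrite /d !mulr_sumr -!big_split; apply: eq_bigr => z _ /=; ring.
have -> : \sum_z pi2 y z * (u y - u z) ^+ 2 = \sum_z pi2 y z * (u y - u z) ^+ 2 by [].
rewrite [leRHS]addrAC lerD2r mulr_sumr.
have -> : theta^-1 * (d y ^+ 2 / mu2 y) =
  \sum_x pi1 x y * (theta^-1 * (d y / mu2 y) ^+ 2).
  by rewrite -mulr_suml pr; field; rewrite !gt_eqF.
rewrite -big_split /=; apply: ler_sum => x _.
set a := u x - u y; set b := d y / mu2 y.
have -> : pi1 x y * a ^+ 2 + 2 * pi1 x y / mu2 y * a * d y =
  pi1 x y * (a ^+ 2 + 2 * a * b) by rewrite /b; ring.
rewrite [(1 + theta) * _]mulrCA -mulrDr ler_wpM2l //.
have -> : (1 + theta) * a ^+ 2 + theta^-1 * b ^+ 2 =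
  a ^+ 2 + 2 * a * b + theta^-1 * (theta * a - b) ^+ 2.
  by field; rewrite gt_eqF.
by rewrite lerDl mulr_ge0 ?sqr_ge0 // invr_ge0 ltW.
Qed.

Definition diag mu : B -> B -> R := fun x y => (x == y)%:R * mu x.

Lemma sum_diag_l mu x : \sum_y diag mu x y = mu x.
Proof.
rewrite /diag (bigD1 x) //= eqxx mul1r big1 ?addr0 // => y yx.
by rewrite eq_sym (negbTE yx) mul0r.
Qed.

Lemma sum_diag_r mu y : \sum_x diag mu x y = mu y.
Proof.
by rewrite /diag (bigD1 y) //= eqxx mul1r big1 ?addr0 // => x /negbTE ->; rewrite mul0r.
Qed.

Lemma sum_diag_mul mu (g : B -> B -> R) x : (forall b, g b b = 0) ->
  \sum_y diag mu x y * g x y = 0.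
Proof.
move=> g0; apply: big1 => y _; rewrite /diag; case: eqVneq => [->|_].
  by rewrite g0 mulr0.
by rewrite !mul0r.
Qed.

Section flow.
Variables (nu v : B -> R) (K : B -> B -> R).
Hypothesis nu0 : forall b, 0 < nu b.
Hypothesis v0 : forall b, 0 <= v b.
Hypothesis K0 : forall b c, 0 <= K b c.
Hypothesis divK : forall b, v b - nu b = \sum_c K c b - \sum_c K b c.

Definition drift u := \sum_b (\sum_c K b c * (u b - u c)) ^+ 2 / nu b.

Let interp (t : R) b := nu b + t * (v b - nu b).

(* One step of the Markov chain whose jump rates are the flow K: the squared
   displacement splits into a martingale part, paid by the cost of the jumps,
   and a part paid by the drift. *)
Lemma flow_half_coupling u1 u2 : exists pi,
  fcoupling nu (fun b => (nu b + v b) / 2) pi /\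
  forall u, u = u1 \/ u = u2 -> sqcost u pi <= 2 * (drift u + sqcost u K).
Proof.
(* The number of steps is so large that one step of length [1 / (2 * M)] sends at most [nu b / 2]
   out of b, an amount which [mu_half] shows to be present. *)
have [M M0 MK] : exists2 M : nat, (0 < M)%N & forall b, \sum_c K b c <= M%:R * nu b.
  pose S := \sum_b (\sum_c K b c) / nu b.
  have S0 b : 0 <= (\sum_c K b c) / nu b.
    by rewrite divr_ge0 ?(ltW (nu0 b))// sumr_ge0.
  exists (Num.bound S).+1 => // b.
  rewrite -ler_pdivrMr //; apply: (@le_trans _ _ S).
    by rewrite /S [leRHS](bigD1 b) //= lerDl sumr_ge0.
  rewrite ltW // (lt_le_trans (archi_boundP _)) ?sumr_ge0 //.
  by rewrite ler_nat.
have M0r : 0 < M%:R :> R by rewrite ltr0n.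
pose mu i := interp (i%:R / (2 * M%:R)).
(* Only [0 <= v] is known, so half of [nu] is kept up to time 1/2, and possibly nothing at time
   1. *)
have mu_half i b : (i <= M)%N -> nu b / 2 <= mu i b.
  move=> iM; rewrite /mu /interp.
  have : i%:R / (2 * M%:R) <= 2^-1 :> R.
    by rewrite ler_pdivrMr ?mulr_gt0// mulrA mulVf// mul1r ler_nat.
  have : 0 <= i%:R / (2 * M%:R) :> R by rewrite divr_ge0// mulr_ge0// ltW.
  set t := _ / _ => t0 t1; have := nu0 b; have := v0 b; nra.
suff H i : (i <= M)%N -> exists2 pi, fcoupling nu (mu i) pi &
    forall u, u = u1 \/ u = u2 ->
    sqcost u pi <= 2 * (drift u + sqcost u K) * (i%:R / M%:R).
  have [pi cpi Hpi] := H M (leqnn M); exists pi; split; last first.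
    by move=> u hu; have := Hpi _ hu; rewrite divff ?gt_eqF // mulr1.
  have -> : (fun b => (nu b + v b) / 2) = mu M.
    by apply/funext => b; rewrite /mu /interp; field; rewrite gt_eqF.
  exact: cpi.
elim: i => [|i IH] iM.
  exists (diag nu).
    split=> [x y|x|y]; rewrite ?sum_diag_l ?sum_diag_r //.
    - by rewrite /diag mulr_ge0 // ltW.
    - by rewrite /mu /interp mul0r mul0r addr0.
  move=> u _; rewrite mul0r mulr0 /sqcost big1 // => x _.
  by rewrite (sum_diag_mul nu (fun x y => (u x - u y) ^+ 2)) // => b; rewrite subrr expr0n.
have [pi cpi Hpi] := IH (ltnW iM).
have iM' : (i <= M)%N := ltnW iM.
have mu0 b : 0 < mu i b by apply: lt_le_trans (mu_half _ _ iM'); rewrite divr_gt0.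
(* During one step [K b c / (2 * M)] jumps from b to c and the remaining mass stays. *)
pose sg b c := K b c / (2 * M%:R) +
  diag (fun b => mu i b - (\sum_c K b c) / (2 * M%:R)) b c.
have csg : fcoupling (mu i) (mu i.+1) sg.
  split=> [x y|x|y].
  - apply: addr_ge0; first by rewrite divr_ge0 ?mulr_ge0 ?(ltW M0r).
    rewrite /diag; case: (x == y); last by rewrite mul0r.
    rewrite mul1r subr_ge0; apply: le_trans (mu_half _ _ iM').
    rewrite ler_pdivrMr ?mulr_gt0// mulrA divfK //.
    by rewrite mulrC.
  - by rewrite /sg big_split sum_diag_l /= -mulr_suml addrC subrK.
  - rewrite /sg big_split sum_diag_r /= -mulr_suml.
    have := divK y; rewrite /mu /interp => dy.
    have -> : \sum_x K x y = (v y - nu y) + \sum_c K y c by rewrite dy; ring.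
    rewrite -(addn1 i) natrD.
    by field; rewrite gt_eqF.
exists (glue (mu i) pi sg); first exact: glue_coupling mu0 cpi csg.
move=> u hu.
(* The drift of a step is of order [M^-1], so its square times [theta^-1 = 2 * M] is again of order
   [M^-1], and so is the relative growth [theta] of the old cost: M steps add up to a constant. *)
have th0 : 0 < (2 * M%:R)^-1 :> R by rewrite invr_gt0 mulr_gt0.
apply: (le_trans (glue_cost_drift _ _ _ _ _ _ _ th0 mu0 cpi csg)).
have -> : sqcost u sg = sqcost u K / (2 * M%:R).
  rewrite /sqcost mulr_suml; apply: eq_bigr => x _.
  under eq_bigr do rewrite /sg mulrDl.
  rewrite big_split /= (sum_diag_mul _ (fun x y => (u x - u y) ^+ 2)); last first.
    by move=> b; rewrite subrr expr0n.
  by rewrite addr0 mulr_suml; apply: eq_bigr => y _; rewrite mulrAC.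
have -> : \sum_y (\sum_z sg y z * (u y - u z)) ^+ 2 / mu i y =
  (2 * M%:R) ^- 2 * \sum_y (\sum_z K y z * (u y - u z)) ^+ 2 / mu i y.
  rewrite mulr_sumr; apply: eq_bigr => y _.
  rewrite mulrA -exprVn -exprMn; congr (_ ^+ 2 / _).
  under eq_bigr do rewrite /sg mulrDl.
  rewrite big_split /= (sum_diag_mul _ (fun x y => (u x - u y))); last first.
    by move=> b; rewrite subrr.
  by rewrite addr0 mulr_sumr; apply: eq_bigr => z _; rewrite mulrA; congr (_ * _); exact: mulrC.
have Ddrift : \sum_y (\sum_z K y z * (u y - u z)) ^+ 2 / mu i y <= 2 * drift u.
  rewrite /drift mulr_sumr; apply: ler_sum => y _.
  rewrite mulrCA ler_wpM2l ?sqr_ge0 //.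
  rewrite -[2]invrK -invfM lef_pV2 ?posrE ?mulr_gt0 //.
  by rewrite mulrC mu_half.
have drift0 : 0 <= drift u.
  by apply: sumr_ge0 => y _; rewrite divr_ge0 ?sqr_ge0 // ltW.
have S0 : 0 <= sqcost u K.
  by apply: sumr_ge0 => x _; apply: sumr_ge0 => y _; rewrite mulr_ge0 ?sqr_ge0.
have := Hpi _ hu; set a := sqcost u pi; set D := drift u in Ddrift drift0 *.
set S := sqcost u K in S0 * => aH.
rewrite invrK.
have aH' : a / (2 * M%:R) <= (D + S) / M%:R.
  rewrite invfM mulrA ler_wpM2r ?invr_ge0 ?(ltW M0r) //.
  rewrite ler_pdivrMr // mulrC; apply: (le_trans aH).
  rewrite ler_piMr ?mulr_ge0 ?addr_ge0 //.
  by rewrite ler_pdivrMr // mul1r ler_nat.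
have -> : i.+1%:R / M%:R = i%:R / M%:R + M%:R^-1 :> R.
  by rewrite -(addn1 i) natrD mulrDl mul1r.
set W := \sum_y _ in Ddrift *.
have h1 : 2 * M%:R * ((2 * M%:R) ^- 2 * W) <= D / M%:R.
  have -> : 2 * M%:R * ((2 * M%:R) ^- 2 * W) = W / 2 / M%:R :> R by field; rewrite gt_eqF.
  by rewrite ler_wpM2r ?invr_ge0 ?(ltW M0r) // ler_pdivrMr // mulrC.
have h2 : S / (2 * M%:R) <= S / M%:R.
  rewrite invfM ler_wpM2l// -{2}[M%:R^-1]mul1r ler_wpM2r// ?invr_ge0 ?(ltW M0r)//.
  lra.
have -> : (1 + (2 * M%:R)^-1) * a = a + a / (2 * M%:R) by ring.
have -> : 2 * (D + S) * (i%:R / M%:R + M%:R^-1) =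
  2 * (D + S) * (i%:R / M%:R) + (D + S) / M%:R + D / M%:R + S / M%:R by ring.
lra.
Qed.


(* The second half of the way, from (nu + v) / 2 to v, costs at most half of
   any coupling of nu and v, so that a cost w improves to 3 A + 3 w / 4. *)
Lemma flow_coupling p (eps : R) : \sum_b nu b = 1 -> 0 < eps ->
  exists pi, fcoupling nu v pi /\
  fcost p pi <= 24 * ((drift (fst \o p) + sqcost (fst \o p) K) +
                      (drift (snd \o p) + sqcost (snd \o p) K)) + eps.
Proof.
move=> nu1 eps0.
have v1 : \sum_b v b = 1.
  rewrite -nu1; apply/eqP; rewrite -subr_eq0 -sumrB.
  under eq_bigr do rewrite divK.
  by rewrite sumrB exchange_big subrr.
have [pih [cpih Hpih]] := flow_half_coupling (fst \o p) (snd \o p).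
set X := (drift (fst \o p) + _ + _).
have Hh : fcost p pih <= 2 * X.
  rewrite /fcost /X mulrDr lerD //; apply: Hpih; by [left|right].
(* The factor 24 is the fixed point of [c = 6 + 3 * c / 4]. The geometric remainder starts from the
   product coupling and is absorbed by [eps]. *)
suff H n : exists2 pi, fcoupling nu v pi &
    fcost p pi <= 24 * X +
      (3/4) ^+ n * fcost p (fun b c => nu b * v c).
  set w := fcost p _ in H.
  have w0 : 0 <= w.
    by rewrite /w /fcost /sqcost addr_ge0//; apply: sumr_ge0 => b _;
      apply: sumr_ge0 => c _; rewrite mulr_ge0 ?sqr_ge0 // mulr_ge0 ?(ltW (nu0 _)).
  have q0 : 0 <= 3 / 4 :> R by lra.
  have : (fun n => (3/4) ^+ n : R^o) @ \oo --> (0 : R^o).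
    by apply: cvg_expr; rewrite ger0_norm; lra.
  move=> /cvgrPdist_lt /(_ (eps / (w + 1))) [].
    by rewrite divr_gt0// ltr_wpDl.
  move=> n _ /(_ n (leqnn n)) /=; rewrite sub0r normrN ger0_norm ?exprn_ge0//.
  rewrite ltr_pdivlMr ?ltr_wpDl// => hn.
  have [pi cpi Hpi] := H n; exists pi; split => //.
  apply: (le_trans Hpi); rewrite lerD2l; apply: le_trans (ltW hn).
  rewrite ler_wpM2l ?exprn_ge0//; lra.
have X0 : 0 <= X.
  rewrite /X /drift /sqcost; do 2! apply: addr_ge0;
    apply: sumr_ge0 => b _; rewrite ?divr_ge0 ?sqr_ge0 ?(ltW (nu0 b))//;
    by apply: sumr_ge0 => c _; rewrite mulr_ge0 ?sqr_ge0.
elim: n => [|n [pi cpi Hpi]].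
  exists (fun b c => nu b * v c); last by rewrite expr0 mul1r lerDr mulr_ge0.
  split=> [b c|b|c]; first by rewrite mulr_ge0 ?(ltW (nu0 _)).
  - by rewrite -mulr_sumr v1 mulr1.
  - by rewrite -mulr_suml nu1 mul1r.
(* The part [nu / 2] of the midpoint moves by [pi]; the part [v / 2] is already in place. *)
pose pi2 b c := 2^-1 * pi b c + 2^-1 * diag v b c.
have [p0 pl pr] := cpi.
have cpi2 : fcoupling (fun b => (nu b + v b) / 2) v pi2.
  split=> [b c|b|c].
  - apply: addr_ge0; rewrite mulr_ge0 ?invr_ge0// /diag.
    by case: (b == c); rewrite ?mul1r ?mul0r.
  - rewrite /pi2 big_split /= -!mulr_sumr pl sum_diag_l; lra.
  - rewrite /pi2 big_split /= -!mulr_sumr pr sum_diag_r; lra.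
have m0 b : 0 < (nu b + v b) / 2 by have := nu0 b; have := v0 b; lra.
have cost2 u : sqcost u pi2 = sqcost u pi / 2.
  rewrite /sqcost mulr_suml; apply: eq_bigr => b _.
  under eq_bigr do rewrite /pi2 mulrDl -(mulrA _ (pi _ _)) -(mulrA _ (diag _ _ _)).
  rewrite big_split /= -!mulr_sumr.
    rewrite (sum_diag_mul _ (fun x y => (u x - u y) ^+ 2)); last first.
    by move=> c; rewrite subrr expr0n.
  by rewrite mulr0 addr0 mulrC.
exists (glue (fun b => (nu b + v b) / 2) pih pi2).
  exact: glue_coupling m0 cpih cpi2.
have H u := glue_cost_split u _ _ _ _ _ 2 (ltr0Sn _ _) m0 cpih cpi2.
have := lerD (H (fst \o p)) (H (snd \o p)); rewrite !cost2.
move: Hh Hpi; rewrite /fcost exprS.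
set w := (3/4) ^+ n * _ => h1 h2 h3.
have -> : 3 / 4 * (3 / 4) ^+ n * (sqcost (fst \o p) (fun b c : B => nu b * v c) +
  sqcost (snd \o p) (fun b c : B => nu b * v c)) = 3/4 * w by rewrite /w mulrA.
lra.
Qed.

(** Since jumps have length at most [h], drift and jump cost are both [h ^+ 2] times a quantity that
    depends on the outflow alone. The sup norm bounds the two coordinates separately. *)
Lemma flow_coupling_short p (h : R) : \sum_b nu b = 1 -> 0 < h ->
  (forall b c, K b c != 0 -> `|p b - p c| <= h) ->
  exists pi, fcoupling nu v pi /\
  fcost p pi <= 150 * h ^+ 2 * (1 + \sum_b (\sum_c K b c) ^+ 2 / nu b).
Proof.
move=> nu1 h0 Kh.
have h20 : 0 < h ^+ 2 by rewrite exprn_gt0.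
have [pi [cpi Hpi]] := flow_coupling p _ nu1 h20.
exists pi; split=> //; apply: (le_trans Hpi).
set Q := \sum_b _.
suff H u : (forall b c, K b c != 0 -> `|u b - u c| <= h) ->
    drift u + sqcost u K <= h ^+ 2 * (3/2 * Q + 1 / 2).
  have h1 : drift (fst \o p) + sqcost (fst \o p) K <= h ^+ 2 * (3/2 * Q + 1 / 2).
    apply: H => b c /Kh; apply: le_trans.
    by rewrite [leRHS]prod_normE /= le_max lexx.
  have h2 : drift (snd \o p) + sqcost (snd \o p) K <= h ^+ 2 * (3/2 * Q + 1 / 2).
    apply: H => b c /Kh; apply: le_trans.
    by rewrite [leRHS]prod_normE /= le_max lexx orbT.
  have Q0 : 0 <= Q by apply: sumr_ge0 => b _; rewrite divr_ge0 ?sqr_ge0 // ltW.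
  nra.
move=> uh.
have uh' b c : K b c * `|u b - u c| <= K b c * h.
  have [->|/uh hbc] := eqVneq (K b c) 0; first by rewrite !mul0r.
  by rewrite ler_wpM2l.
have hD : drift u <= h ^+ 2 * Q.
  rewrite /drift /Q mulr_sumr; apply: ler_sum => b _.
  rewrite mulrA ler_wpM2r ?invr_ge0 ?(ltW (nu0 _)) // -exprMn.
  rewrite -real_normK ?num_real // lerXn2r ?nnegrE ?mulr_ge0 ?(ltW h0)//.
    by rewrite sumr_ge0.
  rewrite mulr_sumr; apply: (le_trans (ler_norm_sum _ _ _)); apply: ler_sum => c _.
  by rewrite normrM (ger0_norm (K0 _ _)) mulrC [leRHS]mulrC mulrC.
have hS : sqcost u K <= h ^+ 2 * (Q / 2 + 1 / 2).
  apply: (@le_trans _ _ (\sum_b h ^+ 2 * \sum_c K b c)).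
    apply: ler_sum => b _; rewrite mulr_sumr; apply: ler_sum => c _.
    have [->|/uh hbc] := eqVneq (K b c) 0; first by rewrite mul0r mulr0.
    rewrite mulrC ler_wpM2r // -real_normK ?num_real //.
    by rewrite lerXn2r ?nnegrE ?(ltW h0).
  rewrite -mulr_sumr ler_wpM2l ?(ltW h20)//.
  (* The jump cost is linear in the outflow; [2 * k <= k ^+ 2 / nu b + nu b], together with the
     total mass 1 of [nu], makes it quadratic. *)
  have -> : Q / 2 + 1 / 2 =
      \sum_b ((\sum_c K b c) ^+ 2 / nu b / 2 + nu b / 2).
    by rewrite big_split /= -!mulr_suml nu1.
  apply: ler_sum => b _; set k := \sum_c _.
  have -> : k ^+ 2 / nu b / 2 + nu b / 2 = k + (k - nu b) ^+ 2 / nu b / 2.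
    by field; rewrite gt_eqF.
  by rewrite lerDl divr_ge0 // divr_ge0 ?sqr_ge0 // ltW.
lra.
Qed.

End flow.

End finite_transport.

(** * Flows on dyadic grids *)

Lemma sum_nat_blocks {V : nmodType} (q s : nat) (h : nat -> V) :
  \sum_(i < q * s) h i = \sum_(a < q) \sum_(r < s) h (a * s + r)%N.
Proof.
elim: q => [|q IH]; first by rewrite mul0n !big_ord0.
rewrite big_ord_recr /= -IH -!(big_mkord xpredT) mulSn addnC.
rewrite (@big_cat_nat _ _ _ (q * s)) ?leq_addr //=; congr (_ + _).
rewrite -{1}[(q * s)%N]add0n big_addn addKn big_mkord.
by rewrite -(big_mkord xpredT (fun r => h (q * s + r)%N)) big_mkord;
  apply: eq_bigr => i _; rewrite addnC.
Qed.

(** Cauchy-Schwarz with weights, by induction; in [grid_flow] it adds up the flows of the different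
    scales. *)
Lemma sum_sqr_weighted_le {R : realFieldType} (s : nat) (w h : nat -> R) :
  (forall i, 0 < w i) ->
  (\sum_(r < s) h r) ^+ 2 <= (\sum_(r < s) w r) * \sum_(r < s) h r ^+ 2 / w r.
Proof.
move=> w0; case: s => [|s]; first by rewrite !big_ord0 mulr0 expr0n.
elim: s => [|s IH].
  by rewrite !big_ord1 mulrC divfK ?gt_eqF.
rewrite big_ord_recr /= [X in X * _]big_ord_recr [X in _ * X]big_ord_recr /=.
have W0 : 0 < \sum_(r < s.+1) w r.
  by rewrite big_ord_recr /= ltr_wpDl // sumr_ge0 // => i _; rewrite ltW.
move: IH W0; set a := \sum_(r < _) h r; set W := \sum_(r < _) w r.
set Q := \sum_(r < _) _; set c := h s.+1; set t := w s.+1 => IH W0.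
have t0 : 0 < t := w0 _.
have QW : W^-1 * a ^+ 2 <= Q by rewrite ler_pdivrMl.
have : 2 * a * c <= t / W * a ^+ 2 + W / t * c ^+ 2.
  rewrite -subr_ge0; have -> : t / W * a ^+ 2 + W / t * c ^+ 2 - 2 * a * c =
    (t * W)^-1 * (t * a - W * c) ^+ 2 by field; rewrite !gt_eqF.
  by rewrite mulr_ge0 ?sqr_ge0 // invr_ge0 mulr_ge0 ?ltW.
have : t / W * a ^+ 2 <= t * Q by rewrite -mulrA ler_wpM2l // ltW.
have -> : (W + t) * (Q + c ^+ 2 / t) = W * Q + W / t * c ^+ 2 + t * Q + c ^+ 2.
  by field; rewrite gt_eqF.
lra.
Qed.

Lemma sum_sqr_le {R : realFieldType} (s : nat) (h : nat -> R) :
  (\sum_(r < s) h r) ^+ 2 <= s%:R * \sum_(r < s) h r ^+ 2.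
Proof.
have := sum_sqr_weighted_le s (fun=> 1) h (fun=> ltr01).
rewrite /= sumr_const card_ord => /le_trans; apply.
by under eq_bigr do rewrite divr1.
Qed.

Section block_averages.
Context {R : realFieldType}.
Implicit Types (g : nat -> R) (s q : nat).

Definition bavg s g (i : nat) : R :=
  s%:R^-1 * \sum_(r < s) g (i %/ s * s + r)%N.

Definition psum g (i : nat) : R := \sum_(i' < i) g i'.

Lemma psumS g i : psum g i.+1 - psum g i = g i.
Proof. by rewrite /psum big_ord_recr /= addrAC subrr add0r. Qed.

Lemma bavg_block s g a r : (r < s)%N ->
  bavg s g (a * s + r)%N = s%:R^-1 * \sum_(r' < s) g (a * s + r')%N.
Proof.
move=> rs; have s0 : (0 < s)%N by apply: leq_ltn_trans rs.
by rewrite /bavg divnMDl // divn_small // addn0.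
Qed.

Lemma sum_bavg_block s g a : (0 < s)%N ->
  \sum_(r < s) bavg s g (a * s + r)%N = \sum_(r < s) g (a * s + r)%N.
Proof.
move=> s0; under eq_bigr do rewrite bavg_block//.
by rewrite sumr_const card_ord -[LHS]mulr_natl mulrA divff ?mul1r // pnatr_eq0 -lt0n.
Qed.

(** [g] minus its block average has sum zero over each full block, so the primitive starts afresh in
    every block: the flow it defines never crosses a block boundary. *)
Lemma psum_block s g a r : (0 < s)%N -> (r <= s)%N ->
  psum (fun i => g i - bavg s g i) (a * s + r)%N =
  \sum_(r' < r) (g (a * s + r')%N - bavg s g (a * s)%N).
Proof.
move=> s0 rs; rewrite /psum.
have -> : \sum_(i' < a * s + r) (g i' - bavg s g i') =
    \sum_(i' < a * s) (g i' - bavg s g i') +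
    \sum_(r' < r) (g (a * s + r')%N - bavg s g (a * s + r')%N).
  by rewrite big_split_ord.
rewrite (sum_nat_blocks a s (fun i => g i - bavg s g i)) [X in X + _]big1 ?add0r; last first.
  by move=> b _; rewrite sumrB sum_bavg_block // subrr.
apply: eq_bigr => r' _; congr (_ - _); rewrite bavg_block //.
  by rewrite -[X in _ = bavg _ _ X]addn0 bavg_block.
exact: leq_trans rs.
Qed.

Lemma psum_bavg_end s g q : (0 < s)%N ->
  psum (fun i => g i - bavg s g i) (q * s)%N = 0.
Proof. by move=> s0; rewrite -[(q * s)%N]addn0 psum_block // big_ord0. Qed.

Lemma sum_sqr_bavg_le s g q : (0 < s)%N ->
  \sum_(i < q * s) bavg s g i ^+ 2 <= \sum_(i < q * s) g i ^+ 2.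
Proof.
move=> s0; rewrite (sum_nat_blocks q s (fun i => bavg s g i ^+ 2)).
rewrite (sum_nat_blocks q s (fun i => g i ^+ 2)); apply: ler_sum => a _.
under eq_bigr do rewrite bavg_block //.
have s0' : 0 < s%:R :> R by rewrite ltr0n.
rewrite sumr_const card_ord -[leLHS]mulr_natl.
set S := \sum_(r' < s) _.
have -> : s%:R * (s%:R^-1 * S) ^+ 2 = s%:R^-1 * S ^+ 2 by field; rewrite gt_eqF.
by rewrite ler_pdivrMl // (sum_sqr_le s (fun r => g (a * s + r)%N)).
Qed.

(** A Poincare inequality inside each block: removing the mean does not increase the norm. One
    factor [s] comes from Cauchy-Schwarz, the other from the number of positions in the block. *)
Lemma sum_sqr_psum_le s g q : (0 < s)%N ->
  \sum_(i < q * s) psum (fun i => g i - bavg s g i) i ^+ 2 <=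
  s%:R ^+ 2 * \sum_(i < q * s) g i ^+ 2.
Proof.
move=> s0.
rewrite (sum_nat_blocks q s (fun i => psum (fun i => g i - bavg s g i) i ^+ 2)).
rewrite (sum_nat_blocks q s (fun i => g i ^+ 2)) mulr_sumr; apply: ler_sum => a _.
set A := bavg s g (a * s)%N.
have HA : \sum_(r < s) (g (a * s + r)%N - A) ^+ 2 <= \sum_(r < s) g (a * s + r)%N ^+ 2.
  have s0' : 0 < s%:R :> R by rewrite ltr0n.
  have EA : \sum_(r < s) g (a * s + r)%N = s%:R * A.
    rewrite /A -[(a * s)%N in RHS]addn0 bavg_block // mulrA divff ?gt_eqF//.
    by rewrite mul1r.
  have -> : \sum_(r < s) (g (a * s + r)%N - A) ^+ 2 =
      \sum_(r < s) g (a * s + r)%N ^+ 2 - 2 * A * \sum_(r < s) g (a * s + r)%N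
      + s%:R * A ^+ 2.
    have -> : s%:R * A ^+ 2 = \sum_(r < s) A ^+ 2.
      by rewrite sumr_const card_ord mulr_natl.
    rewrite mulr_sumr -sumrB -big_split /=.
    by apply: eq_bigr => r _; ring.
  rewrite EA; have := sqr_ge0 A; nra.
apply: (@le_trans _ _ (\sum_(r < s) s%:R * \sum_(r < s) (g (a * s + r)%N - A) ^+ 2)).
  apply: ler_sum => r _; rewrite psum_block ?(ltnW (ltn_ord r)) // -/A.
  apply: (le_trans (sum_sqr_le r (fun r' => g (a * s + r')%N - A))).
  rewrite ler_pM ?sumr_ge0// ?ler_nat ?(ltnW (ltn_ord r)) //.
    by move=> *; rewrite sqr_ge0.
  rewrite -!(big_mkord xpredT (fun i => (g (a * s + i)%N - A) ^+ 2)).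
  rewrite [leRHS](@big_cat_nat _ _ _ r) ?(ltnW (ltn_ord r)) //= lerDl.
  by apply: sumr_ge0 => *; rewrite sqr_ge0.
rewrite sumr_const card_ord -[leLHS]mulr_natl mulrA -expr2 ler_wpM2l // exprn_ge0 //.
Qed.

Lemma bavgM s t g : (0 < s)%N -> (0 < t)%N -> bavg (t * s) (bavg s g) =1 bavg (t * s) g.
Proof.
move=> s0 t0 i; rewrite /bavg; congr (_ * _).
set a := (i %/ (t * s))%N.
rewrite (sum_nat_blocks _ _ (fun r => s%:R^-1 * \sum_(r0 < s)
  g ((a * (t * s) + r) %/ s * s + r0)%N)).
rewrite (sum_nat_blocks _ _ (fun r => g (a * (t * s) + r)%N)).
apply: eq_bigr => b _.
have := sum_bavg_block s g (a * t + b)%N s0; rewrite /bavg mulnDl -!mulnA => H.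
under eq_bigr do rewrite addnA.
by rewrite H; apply: eq_bigr => r _; rewrite addnA.
Qed.

Lemma bavg1 g : bavg 1 g =1 g.
Proof. by move=> i; rewrite /bavg big_ord1 divn1 muln1 addn0 invr1 mul1r. Qed.

End block_averages.

Section grid_flow.
Context {R : realFieldType}.
Variables (K : nat) (f : nat -> nat -> R).

Definition block_sum (m a b : nat) : R :=
  \sum_(r < 2 ^ m) \sum_(r' < 2 ^ m) f (a * 2 ^ m + r)%N (b * 2 ^ m + r')%N.

Let avgx m (h : nat -> nat -> R) : nat -> nat -> R :=
  fun i j => bavg (2 ^ m) (h^~ j) i.
Let avgy m (h : nat -> nat -> R) : nat -> nat -> R :=
  fun i j => bavg (2 ^ m) (h i) j.
(** [F m] averages over squares of side [2 ^ m], [G m] over rectangles twice as long in the first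
    index. So [F m - G m] is mean free along blocks of length [2 ^ m.+1] of the first index, and
    [G m - F m.+1] along such blocks of the second. *)
Let F m := avgx m (avgy m f).
Let G m := avgx m.+1 (F m).

Let avgxy m k h : avgx m (avgy k h) = avgy k (avgx m h).
Proof.
apply/funext => i; apply/funext => j; rewrite /avgx /avgy /bavg.
by rewrite -!mulr_sumr mulrCA exchange_big.
Qed.

Let two_gt0 m : (0 < 2 ^ m)%N. Proof. by rewrite expn_gt0. Qed.

Let avgxS m h : avgx m.+1 (avgx m h) = avgx m.+1 h.
Proof. by apply/funext => i; apply/funext => j; rewrite /avgx expnS bavgM. Qed.

Let avgyS m h : avgy m.+1 (avgy m h) = avgy m.+1 h.
Proof. by apply/funext => i; apply/funext => j; rewrite /avgy expnS bavgM. Qed.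

Let FS m : avgy m.+1 (G m) = F m.+1.
Proof. by rewrite /G /F avgxS -avgxy avgyS. Qed.

Let F_block m a b r r' : (r < 2 ^ m)%N -> (r' < 2 ^ m)%N ->
  F m (a * 2 ^ m + r)%N (b * 2 ^ m + r')%N = (2 ^ m)%:R ^- 2 * block_sum m a b.
Proof.
move=> hr hr'; rewrite /F /avgx bavg_block // /avgy.
under eq_bigr do rewrite bavg_block //.
by rewrite -mulr_sumr mulrA -exprVn.
Qed.

Let grid_sqr (h : nat -> nat -> R) :=
  \sum_(i < 2 ^ K) \sum_(j < 2 ^ K) h i j ^+ 2.

Let KE m : (m <= K)%N -> (2 ^ K)%N = (2 ^ (K - m) * 2 ^ m)%N.
Proof. by move=> mK; rewrite -expnD subnK. Qed.

Let F_sqr m : (m <= K)%N -> grid_sqr (F m) = (2 ^ m)%:R ^- 2 *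
  \sum_(a < 2 ^ (K - m)) \sum_(b < 2 ^ (K - m)) block_sum m a b ^+ 2.
Proof.
move=> mK; rewrite /grid_sqr (KE _ mK).
rewrite (sum_nat_blocks _ _ (fun i => \sum_(j < 2 ^ (K - m) * 2 ^ m) F m i j ^+ 2)).
rewrite mulr_sumr; apply: eq_bigr => a _.
under eq_bigr => r _.
  rewrite (sum_nat_blocks _ _ (fun j => F m (a * 2 ^ m + r)%N j ^+ 2)).
  under eq_bigr => b _.
    under eq_bigr => r' _ do rewrite F_block //.
    rewrite sumr_const card_ord -[_ *+ _]mulr_natl.
  over.
over.
rewrite sumr_const card_ord -[LHS]mulr_natl mulr_sumr mulr_sumr.
apply: eq_bigr => b _; have := two_gt0 m; rewrite -(ltr0n R) => h.
by field; rewrite gt_eqF.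
Qed.

Let psum2_le (h : nat -> nat -> R) m : (m <= K)%N ->
  \sum_(j < 2 ^ K) \sum_(i < 2 ^ K)
    psum (fun i => h i j - bavg (2 ^ m) (h^~ j) i) i ^+ 2 <=
  (2 ^ m)%:R ^+ 2 * \sum_(j < 2 ^ K) \sum_(i < 2 ^ K) h i j ^+ 2.
Proof.
move=> mK; rewrite mulr_sumr; apply: ler_sum => -[j /= _] _; rewrite (KE _ mK).
by apply: (sum_sqr_psum_le _ (h^~ j)).
Qed.

Let JH m i j := psum (fun i => F m i j - G m i j) i.
Let JV m i j := psum (fun j => G m i j - F m.+1 i j) j.

(** The Poincare factor of blocks of length [2 ^ m.+1] against the normalisation of averages over
    squares of side [2 ^ m]. *)
Let C4 m (x : R) : (2 ^ m.+1)%:R ^+ 2 * ((2 ^ m)%:R ^- 2 * x) = 4 * x.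
Proof.
have := two_gt0 m; rewrite -(ltr0n R) => h; rewrite expnS natrM.
by field; rewrite gt_eqF.
Qed.

Let JH_sqr m : (m < K)%N -> grid_sqr (JH m) <=
  4 * \sum_(a < 2 ^ (K - m)) \sum_(b < 2 ^ (K - m)) block_sum m a b ^+ 2.
Proof.
move=> mK; rewrite /grid_sqr exchange_big /=.
apply: (le_trans (psum2_le (F m) _ mK)).
by rewrite exchange_big /= -/(grid_sqr (F m)) F_sqr ?(ltnW mK) // C4.
Qed.

Let JV_sqr m : (m < K)%N -> grid_sqr (JV m) <=
  4 * \sum_(a < 2 ^ (K - m)) \sum_(b < 2 ^ (K - m)) block_sum m a b ^+ 2.
Proof.
move=> mK; rewrite /grid_sqr.
have := psum2_le (fun j i => G m i j) m.+1 mK.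
rewrite -/(avgy m.+1 (G m)).
have -> : \sum_(j < 2 ^ K) \sum_(i < 2 ^ K)
    psum (fun i => G m j i - bavg (2 ^ m.+1) (fun i => G m j i) i) i ^+ 2 =
  \sum_(i < 2 ^ K) \sum_(j < 2 ^ K) JV m i j ^+ 2.
  apply: eq_bigr => i _; apply: eq_bigr => j _; congr (_ ^+ 2).
  by rewrite /JV -FS.
move=> /le_trans; apply; rewrite -(C4 m) -F_sqr ?(ltnW mK)//.
rewrite ler_wpM2l ?sqr_ge0//; rewrite /grid_sqr exchange_big [leRHS]exchange_big /=.
apply: ler_sum => -[j /= _] _; rewrite (KE _ mK).
by apply: (sum_sqr_bavg_le _ (fun i => F m i j)).
Qed.

Let F0 : F 0 = f.
Proof.
by apply/funext => i; apply/funext => j; rewrite /F /avgx /avgy !expn0 !bavg1.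
Qed.

Let FK i j : \sum_(i < 2 ^ K) \sum_(j < 2 ^ K) f i j = 0 ->
  (i < 2 ^ K)%N -> (j < 2 ^ K)%N -> F K i j = 0.
Proof.
move=> f0 iK jK; have := F_block K 0 0 i j iK jK; rewrite mul0n !add0n => ->.
rewrite /block_sum; under eq_bigr do under eq_bigr do rewrite !mul0n !add0n.
by rewrite f0 mulr0.
Qed.

(* Averaging over 2^m-blocks, m = 0 .. K, first along rows and then along
   columns, decomposes f into differences which are mean free on blocks and are
   integrated inside each block. *)
Lemma grid_flow (w : nat -> R) : (forall m, 0 < w m) ->
  \sum_(i < 2 ^ K) \sum_(j < 2 ^ K) f i j = 0 ->
  exists Jh Jv : nat -> nat -> R, [/\
    forall i j, (i < 2 ^ K)%N -> (j < 2 ^ K)%N ->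
      f i j = (Jh i.+1 j - Jh i j) + (Jv i j.+1 - Jv i j),
    forall j, Jh 0%N j = 0 /\ Jh (2 ^ K)%N j = 0,
    forall i, Jv i 0%N = 0 /\ Jv i (2 ^ K)%N = 0 &
    \sum_(i < 2 ^ K) \sum_(j < 2 ^ K) (Jh i j ^+ 2 + Jv i j ^+ 2) <=
    8 * (\sum_(m < K) w m) * \sum_(m < K) (w m)^-1 *
    \sum_(a < 2 ^ (K - m)) \sum_(b < 2 ^ (K - m)) block_sum m a b ^+ 2].
Proof.
move=> w0 f0.
exists (fun i j => \sum_(m < K) JH m i j), (fun i j => \sum_(m < K) JV m i j).
split.
- move=> i j iK jK; rewrite -!sumrB -big_split /=.
  (* The averages telescope from [F 0 = f] to [F K], which vanishes because [f] has total zero. *)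
  transitivity (- \sum_(m < K) (F m.+1 i j - F m i j)).
    rewrite -(big_mkord xpredT (fun m => F m.+1 i j - F m i j)).
    by rewrite (@telescope_sumr _ 0 K (fun m => F m i j)) // FK // F0 sub0r opprK.
  rewrite -sumrN; apply: eq_bigr => m _.
  by rewrite !psumS; ring.
- move=> j; split; apply: big1 => m _; first by rewrite /JH /psum big_ord0.
  by rewrite /JH (KE m.+1) // psum_bavg_end.
- move=> i; split; apply: big1 => m _; first by rewrite /JV /psum big_ord0.
  by rewrite /JV -FS (KE m.+1) // psum_bavg_end.
have W0 : 0 <= \sum_(m < K) w m by apply: sumr_ge0 => m _; rewrite ltW.
have H (J : nat -> nat -> nat -> R) : (forall m, (m < K)%N -> grid_sqr (J m) <=
  4 * \sum_(a < 2 ^ (K - m)) \sum_(b < 2 ^ (K - m)) block_sum m a b ^+ 2) ->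
  \sum_(i < 2 ^ K) \sum_(j < 2 ^ K) (\sum_(m < K) J m i j) ^+ 2 <=
    4 * (\sum_(m < K) w m) * \sum_(m < K) (w m)^-1 *
    \sum_(a < 2 ^ (K - m)) \sum_(b < 2 ^ (K - m)) block_sum m a b ^+ 2.
  move=> HJ.
  apply: (@le_trans _ _ ((\sum_(m < K) w m) * \sum_(m < K) (w m)^-1 * grid_sqr (J m))).
    have -> : \sum_(m < K) (w m)^-1 * grid_sqr (J m) =
        \sum_(i < 2 ^ K) \sum_(j < 2 ^ K) \sum_(m < K) J m i j ^+ 2 / w m.
      under [RHS]eq_bigr do rewrite exchange_big.
      rewrite exchange_big; apply: eq_bigr => m _; rewrite /grid_sqr mulr_sumr.
      apply: eq_bigr => i _; rewrite mulr_sumr; apply: eq_bigr => j _.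
      by rewrite mulrC.
    rewrite mulr_sumr; apply: ler_sum => i _; rewrite mulr_sumr.
    by apply: ler_sum => j _; exact: (sum_sqr_weighted_le K w (fun m => J m i j)).
  rewrite -mulrA [leRHS]mulrCA ler_wpM2l // mulr_sumr; apply: ler_sum => m _.
  by rewrite mulrCA ler_wpM2l ?invr_ge0 ?(ltW (w0 _)) // HJ.
under eq_bigr do rewrite big_split /=.
rewrite big_split /=.
have := lerD (H _ JH_sqr) (H _ JV_sqr); move=> /le_trans; apply.
by rewrite -!mulrDl; set x := 8; have -> : 4 + 4 = x :> R by rewrite /x; lra.
Qed.

End grid_flow.

(** * Lebesgue measure of the plane *)

(* The library measure structure on pushforward carries the measurability proof
   in a way that inference cannot recover. *)
Definition pushm {d d'} {T1 : measurableType d} {T2 : measurableType d'}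
    {R : realType} (m : {measure set T1 -> \bar R}) (f : T1 -> T2)
    of measurable_fun setT f : set T2 -> \bar R := pushforward m f.

Arguments pushm {d d' T1 T2 R} m {f}.

Section pushm_measure.
Context {d d'} {T1 : measurableType d} {T2 : measurableType d'} {R : realType}.
Variables (m : {measure set T1 -> \bar R}) (f : T1 -> T2).
Hypothesis mf : measurable_fun setT f.

Let pushm0 : pushm m mf set0 = 0%E.
Proof. by rewrite /pushm /pushforward preimage_set0 measure0. Qed.

Let pushm_ge0 A : (0 <= pushm m mf A)%E. Proof. exact: measure_ge0. Qed.

Let pushm_sigma_additive : semi_sigma_additive (pushm m mf).
Proof.
move=> F mF tF mUF; rewrite /pushm /pushforward preimage_bigcup.
apply: measure_semi_sigma_additive.
- by move=> n; rewrite -[X in measurable X]setTI; exact: mf.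
- apply/trivIsetP => /= i j _ _ ij; rewrite -preimage_setI.
  by move/trivIsetP : tF => /(_ _ _ _ _ ij) ->//; rewrite preimage_set0.
- by rewrite -preimage_bigcup -[X in measurable X]setTI; exact: mf.
Qed.

HB.instance Definition _ := isMeasure.Build _ _ _
  (pushm m mf) pushm0 pushm_ge0 pushm_sigma_additive.

End pushm_measure.

Section plane_measure.
Context {R : realType}.
Implicit Types (A B : set (R * R)) (t a b : R).

Lemma leb_co a b : a <= b -> leb `[a, b[%classic = (b - a)%:E.
Proof.
by move=> ab; rewrite /leb lebesgue_measure_itv /= lte_fin; case: ltgtP ab => // -> _;
  rewrite subrr.
Qed.

Lemma leb_cc a b : a <= b -> leb `[a, b]%classic = (b - a)%:E.
Proof.
by move=> ab; rewrite /leb lebesgue_measure_itv /= lte_fin; case: ltgtP ab => // -> _;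
  rewrite subrr.
Qed.

Lemma leb2X (A B : set R) : measurable A -> measurable B ->
  leb2 (A `*` B) = (leb A * leb B)%E.
Proof. exact: product_measure1E. Qed.

(** By uniqueness of Lebesgue measure, half-open intervals are enough. *)
Lemma leb_affine (a t : R) (A : set R) : 0 < t -> measurable A ->
  leb A = (t%:E * leb ((fun x => (a + t * x)%R) @^-1` A))%E.
Proof.
move=> t0 mA.
have mphi : measurable_fun setT (fun x : R => a + t * x : R).
  apply: measurable_funD; first exact: measurable_cst.
  by apply: measurable_funM => //; exact: measurable_cst.
pose phi := fun x : R => a + t * x.
have mphi' : @measurable_fun _ _ (measurableTypeR R) (measurableTypeR R) setT phi.
  exact: mphi.
pose m := mscale (NngNum (ltW t0)) (pushm (@lebesgue_measure R) mphi').
have -> : (t%:E * leb ((fun x => (a + t * x)%R) @^-1` A))%E = m A by [].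
rewrite /leb; apply: (@lebesgue_measure_unique R m) => // _ [[c d] _ <-].
rewrite lebesgue_measure_itv /=.
rewrite /m /mscale /pushm /= /pushforward -/phi.
have -> : phi @^-1` `]c, d] = `](c - a) / t, (d - a) / t]%classic.
  apply/seteqP; split=> x /=; rewrite /phi !in_itv /= ltr_pdivrMr // ler_pdivlMr //;
    by rewrite [t * x]mulrC ltrBlDl lerBrDl.
rewrite /leb lebesgue_measure_itv /= !lte_fin ltr_pM2r ?invr_gt0 //.
rewrite ltrD2r; case: ifPn => _; last by rewrite mule0.
by rewrite -EFinM -EFinB; congr EFin; field; rewrite gt_eqF.
Qed.

Lemma measurable_affine2 (a : R * R) t :
  measurable_fun setT (fun x : R * R => (a + t *: x)%R).
Proof.
apply/measurable_fun_pairP => /=; split => /=;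
  (apply: measurable_funD; first exact: measurable_cst);
  by apply: measurable_funM => //; exact: measurable_cst.
Qed.

Lemma leb2_affine (a : R * R) t A : 0 < t -> measurable A ->
  leb2 A = ((t ^+ 2)%:E * leb2 ((fun x => (a + t *: x)%R) @^-1` A))%E.
Proof.
move=> t0 mA.
pose phi := fun x : R * R => a + t *: x.
have t20 : 0 <= t ^+ 2 by rewrite exprn_ge0 // ltW.
pose m := mscale (NngNum t20) (pushm leb2 (measurable_affine2 a t)).
have -> : ((t ^+ 2)%:E * leb2 ((fun x => (a + t *: x)%R) @^-1` A))%E = m A by [].
apply: (@product_measure_unique _ _ _ _ _ (@leb R) (@leb R) m) => // B C mB mC.
transitivity ((t ^+ 2)%:E * leb2 (((fun x => (a.1 + t * x)%R) @^-1` B) `*`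
  ((fun x => (a.2 + t * x)%R) @^-1` C)))%E; first by [].
have mpre (D : set R) c : measurable D -> measurable ((fun x => c + t * x) @^-1` D).
  move=> mD; rewrite -[X in measurable X]setTI.
  have : measurable_fun setT (fun x : R => (c + t * x)%R : R).
    apply: measurable_funD; first exact: measurable_cst.
    by apply: measurable_funM => //; exact: measurable_cst.
  by apply.
rewrite leb2X; [|exact: mpre..].
transitivity (leb B * leb C)%E; last by [].
rewrite (leb_affine a.1 _ _ t0 mB) (leb_affine a.2 _ _ t0 mC).
by rewrite muleACA -EFinM expr2.
Qed.

(** The measurable structure of the plane is the product one, so an open set is written as a
    countable union of boxes with rational centres and radii [n.+1%:R^-1]. *)
Lemma open_measurable2 A : open A -> measurable A.
Proof.
move=> oA.
pose box (p q : rat) (n : nat) : set (R * R) :=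
  ball (ratr p : R) n.+1%:R^-1 `*` ball (ratr q : R) n.+1%:R^-1.
have -> : A = \bigcup_p \bigcup_q \bigcup_n
    (if `[< box p q n `<=` A >] then box p q n else set0).
  apply/seteqP; split=> [x Ax|x]; last first.
    by move=> [p _ [q _ [n _]]]; case: asboolP => // h /h.
  have /nbhs_ballP [e /= e0 eA] : nbhs x A by exact: open_nbhs_nbhs.
  pose n := Num.bound (2 / e).
  have n1 : n.+1%:R^-1 < e / 2.
    rewrite -[e / 2]invrK ltf_pV2 ?posrE ?invr_gt0 ?divr_gt0 //.
    rewrite invf_div (lt_le_trans (archi_boundP _)) ?ler_nat // divr_ge0 //.
    exact: ltW.
  have n0 : 0 < n.+1%:R^-1 :> R by rewrite invr_gt0.
  have dense (y : R) : exists p : rat, ball (ratr p : R) n.+1%:R^-1 y.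
    have /rat_in_itvoo [p] : y - n.+1%:R^-1 < y + n.+1%:R^-1.
      by rewrite ltrBlDr -addrA ltrDl addr_gt0.
    rewrite in_itv /= => /andP[h1 h2]; exists p.
    by rewrite /ball /= ltr_norml ltrBrDr addrC h1 ltrBlDl h2.
  have [p hp] := dense x.1; have [q hq] := dense x.2.
  exists p => //; exists q => //; exists n => //.
  case: asboolP => [_|]; first by split.
  case=> y [/= y1 y2]; apply: eA; split.
    apply: (@ball_splitr _ _ (ratr p : R)); [apply: le_ball hp|apply: le_ball y1];
    exact: ltW.
  apply: (@ball_splitr _ _ (ratr q : R)); [apply: le_ball hq|apply: le_ball y2];
    exact: ltW.
apply: bigcupT_measurable_rat => p; apply: bigcupT_measurable_rat => q.
apply: bigcupT_measurable => n; case: ifP => // _.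
by apply: measurableX; exact: measurable_ball.
Qed.

Lemma measurable_rect (a b c d : R) : measurable (`[a, b[ `*` `[c, d[ : set (R * R)).
Proof. by apply: measurableX; exact: measurable_itv. Qed.

Lemma leb2_rect a b c d : a <= b -> c <= d ->
  leb2 (`[a, b[ `*` `[c, d[ : set (R * R)) = ((b - a) * (d - c))%:E.
Proof.
by move=> ab cd; rewrite leb2X ?leb_co //; exact: measurable_itv.
Qed.

Lemma bounded_rect A : bounded_set A -> exists2 M : R, 0 < M &
  A `<=` `[- M, M[ `*` `[- M, M[.
Proof.
move=> [M0 [_ HM]]; pose M := `|M0| + 1.
have M1 : M0 < M by rewrite (le_lt_trans (ler_norm _)) // ltrDl.
have M00 : 0 < M by rewrite ltr_wpDl.
exists (M + 1) => [|x Ax]; first by rewrite addr_gt0.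
have := HM M M1 x Ax; rewrite /= [ `|x|]prod_normE /= ge_max => /andP[].
rewrite !ler_norml !in_itv /= => /andP[h1 h2] /andP[h3 h4].
by split; apply/andP; split; lra.
Qed.

Lemma rect_bounded a b c d : bounded_set (`[a, b[ `*` `[c, d[ : set (R * R)).
Proof.
exists (`|a| + `|b| + (`|c| + `|d|)); split; first exact: num_real.
move=> M HM [x y] [/=]; rewrite !in_itv /= => /andP[h1 h2] /andP[h3 h4].
have := ler_norm (- a); have := ler_norm b; have := ler_norm (- c); have := ler_norm d.
rewrite !normrN => *; rewrite [leLHS]prod_normE /= ge_max !ler_norml.
have := normr_ge0 a; have := normr_ge0 b; have := normr_ge0 c; have := normr_ge0 d.
by move=> *; apply/andP; split; apply/andP; split; lra.
Qed.

Lemma leb2_fin A : measurable A -> bounded_set A -> leb2 A \is a fin_num.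
Proof.
move=> mA /bounded_rect[M M0 AM].
rewrite ge0_fin_numE // (@le_lt_trans _ _ (leb2 (`[- M, M[ `*` `[- M, M[ : set (R * R))))//.
  by apply: le_measure => //; rewrite inE //; exact: measurable_rect.
have MM : - M <= M by lra.
by rewrite leb2_rect ?ltry.
Qed.

End plane_measure.

(** * Tent functions *)

(* The product measure under a name of its own: canonical inference does not see
   that product_measure1 of two sigma-finite measures is sigma-finite. *)
Definition sprod {d1 d2} {T1 : measurableType d1} {T2 : measurableType d2}
    {R : realType} (m1 : {sigma_finite_measure set T1 -> \bar R})
    (m2 : {sigma_finite_measure set T2 -> \bar R}) : set (T1 * T2) -> \bar R :=
  (m1 \x m2)%E.

Section sprod_measure.
Context {d1 d2} {T1 : measurableType d1} {T2 : measurableType d2} {R : realType}.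
Variables (m1 : {sigma_finite_measure set T1 -> \bar R})
          (m2 : {sigma_finite_measure set T2 -> \bar R}).

Local Notation m12 := (product_measure1 m1 m2 : {measure set (T1 * T2) -> \bar R}).

Let sprod0 : sprod m1 m2 set0 = 0%E.
Proof. exact: (measure0 m12). Qed.

Let sprod_ge0 A : (0 <= sprod m1 m2 A)%E.
Proof. exact: (measure_ge0 m12). Qed.

Let sprod_sigma_additive : semi_sigma_additive (sprod m1 m2).
Proof. exact: (@measure_semi_sigma_additive _ _ _ m12). Qed.

HB.instance Definition _ := isMeasure.Build _ (T1 * T2)%type R (sprod m1 m2)
  sprod0 sprod_ge0 sprod_sigma_additive.

Let sprod_sigma_finite : sigma_finite setT (sprod m1 m2).
Proof.
have /sigma_finiteP[F [FT ndF fF]] := sigma_finiteT m1.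
have /sigma_finiteP[G [GT ndG fG]] := sigma_finiteT m2.
exists (fun n => F n `*` G n) => [|n].
  apply/seteqP; split => // -[x y] _.
  have [i _ Fx] : (\bigcup_i F i) x by rewrite -FT.
  have [j _ Gy] : (\bigcup_i G i) y by rewrite -GT.
  exists (maxn i j) => //; split.
    by have /subsetPset := ndF _ _ (leq_maxl i j); apply.
  by have /subsetPset := ndG _ _ (leq_maxr i j); apply.
have [mF fFn] := fF n; have [mG fGn] := fG n; split; first exact: measurableX.
rewrite /sprod product_measure1E //; apply: lte_mul_pinfty => //.
by rewrite ge0_fin_numE.
Qed.

HB.instance Definition _ :=
  @Measure_isSigmaFinite.Build _ (T1 * T2)%type R (sprod m1 m2) sprod_sigma_finite.

End sprod_measure.

Notation pleb := (sprod leb leb).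

Section leb_integral.
Context {R : realType}.

Let mid : @measurable_fun _ _ (measurableTypeR R) R setT idfun.
Proof. by move=> _ A mA; rewrite setTI. Qed.

(** Pushing forward along the identity passes between the two measurable structures on the line; the
    fundamental theorem of calculus is then available for [leb]. *)
Lemma leb_integralE (D : set R) (f : R -> \bar R) : measurable D ->
  measurable_fun D f ->
  (\int[leb]_(x in D) f x = \int[@lebesgue_measure R]_(x in D) f x)%E.
Proof.
move=> mD mf.
have H (g : R -> \bar R) : measurable_fun D g -> (forall x, (0 <= g x)%E) ->
    (\int[leb]_(x in D) g x = \int[@lebesgue_measure R]_(x in D) g x)%E.
  move=> mg g0.
  have := @ge0_integral_pushforward _ _ (measurableTypeR R) R R idfun mid
    (@lebesgue_measure R) D g mD mg (fun x _ => g0 x).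
  move=> <-; rewrite (@eq_measure_integral _ R R D (pushm (@lebesgue_measure R) mid)) //.
rewrite [LHS]integralE [RHS]integralE !H //.
- exact: measurable_funeneg.
- exact: measurable_funepos.
Qed.

End leb_integral.

Section product_integrals.
Context {d1 d2} {T1 : measurableType d1} {T2 : measurableType d2} {R : realType}.
Variables (m1 : {sigma_finite_measure set T1 -> \bar R})
          (m2 : {sigma_finite_measure set T2 -> \bar R}).
Variables (u : T1 -> R) (v : T2 -> R).
Hypothesis iu : m1.-integrable setT (EFin \o u).
Hypothesis iv : m2.-integrable setT (EFin \o v).

Let mu : measurable_fun setT u.
Proof. by apply/measurable_EFinP; exact: measurable_int iu. Qed.

Let mv : measurable_fun setT v.
Proof. by apply/measurable_EFinP; exact: measurable_int iv. Qed.

Lemma measurable_prod_fun : measurable_fun setT (fun z : T1 * T2 => u z.1 * v z.2).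
Proof. by apply: measurable_funM; exact: measurableT_comp. Qed.

Lemma integrable_prod_fun :
  (m1 \x m2)%E.-integrable setT (fun z : T1 * T2 => (u z.1 * v z.2)%:E).
Proof.
apply/integrableP; split; first by apply/measurable_EFinP; exact: measurable_prod_fun.
rewrite fubini_tonelli1 //; last first.
  apply/measurable_EFinP; apply: measurableT_comp => //; exact: measurable_prod_fun.
rewrite /fubini_F /=.
under eq_integral => x _.
  under eq_integral do rewrite normrM EFinM.
  rewrite ge0_integralZl //; last exact/measurable_EFinP/measurableT_comp.
  over.
have /integrableP[_ hu] := iu; have /integrableP[_ hv] := iv.
rewrite ge0_integralZr //; last 2 first.
- exact/measurable_EFinP/measurableT_comp.
- exact: integral_ge0.
by apply: lte_mul_pinfty => //; [exact: integral_ge0|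
  rewrite ge0_fin_numE ?integral_ge0].
Qed.

Lemma integral_prod_fun :
  (\int[m1 \x m2]_z (u z.1 * v z.2)%:E =
   \int[m1]_x (u x)%:E * \int[m2]_y (v y)%:E)%E.
Proof.
rewrite -integral12_prod_meas1; last exact: integrable_prod_fun.
rewrite /fubini_F /=.
under eq_integral => x _.
  under eq_integral do rewrite EFinM.
  rewrite integralZl //.
  over.
have fv := integrable_fin_num measurableT iv.
by rewrite -(fineK fv) integralZr.
Qed.

End product_integrals.

Section tent.
Context {R : realType}.
Implicit Types (M a b t : R).

(** The Fourier transform of this triangle is the nonnegative Fejer kernel; the tent serves as a
    frequency cutoff whose kernel can be bounded without cancellation. *)
Definition tent M t : R := Num.max 0 (1 - `|t| / M).

Lemma continuous_tent M : continuous (tent M).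
Proof.
move=> t; apply: (@continuous_max _ _ (cst 0) (fun t => 1 - `|t| / M)).
  exact: cst_continuous.
apply: cvgB; first exact: cvg_cst.
by apply: cvgM; [exact: norm_continuous|exact: cvg_cst].
Qed.

Lemma measurable_tent M : measurable_fun setT (tent M).
Proof. by apply: continuous_measurable_fun; exact: continuous_tent. Qed.

Lemma tent_ge0 M t : 0 <= tent M t.
Proof. by rewrite /tent le_max lexx. Qed.

Lemma tent_le1 M t : 0 < M -> tent M t <= 1.
Proof. by move=> M0; rewrite /tent ge_max ler01 gerBl divr_ge0 // ltW. Qed.

Lemma tent_out M t : 0 < M -> M < `|t| -> tent M t = 0.
Proof.
move=> M0 Mt; apply/max_idPl; rewrite subr_le0 ler_pdivlMr // mul1r; exact: ltW.
Qed.

Lemma tent_in M t : 0 < M -> 0 <= t -> t <= M -> tent M t = 1 - t / M.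
Proof.
move=> M0 t0 tM; rewrite /tent ger0_norm //; apply/max_idPr.
by rewrite subr_ge0 ler_pdivrMr // mul1r.
Qed.

Lemma tentN M t : tent M (- t) = tent M t.
Proof. by rewrite /tent normrN. Qed.

Lemma tent_half M t : 0 < M -> `|t| <= M / 2 -> 2^-1 <= tent M t.
Proof.
move=> M0 h; rewrite /tent le_max; apply/orP; right.
have : `|t| / M <= 2^-1 by rewrite ler_pdivrMr // mulrC.
lra.
Qed.

Let lin b : R -> R := b \*: id.

Lemma integral_half_tent_cos M b : 0 < M -> b != 0 ->
  (\int[leb]_(t in `[0%R, M]) (tent M t * cos (b * t))%:E)%E =
  ((1 - cos (b * M)) / (b ^+ 2 * M))%:E.
Proof.
move=> M0 b0.
have cf : continuous (fun t => tent M t * cos (b * t)).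
  move=> t; apply: cvgM; first exact: continuous_tent.
  apply: (@continuous_comp _ _ _ (fun t => b * t) cos); last exact: continuous_cos.
  exact: mulrl_continuous.
(* The antiderivative obtained by integrating [(1 - t / M) * cos (b * t)] by parts. *)
pose F : R -> R := (cst 1 - M^-1 \*: id) * (b^-1 \*: (sin \o lin b))
  - ((b ^+ 2 * M)^-1 \*: (cos \o lin b)).
have dF t : is_derive t (1 : R) F ((1 - t / M) * cos (b * t)).
  apply: is_derive_eq; rewrite /GRing.scale /= /lin /= /GRing.scale /=.
  have -> : (cst 1 - M^-1 \*: id : R -> R) t = 1 - M^-1 * t by [].
  by field; rewrite b0 gt_eqF.
have -> : ((1 - cos (b * M)) / (b ^+ 2 * M))%:E = ((F M)%:E - (F 0)%:E)%E.
  rewrite -EFinB; congr EFin; rewrite /F /lin /= /GRing.scale /= /cst.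
  have E x : F x = (1 - M^-1 * x) * (b^-1 * sin (b * x)) - (b ^+ 2 * M)^-1 * cos (b * x).
    by [].
  rewrite -/F !E !mulr0 sin0 cos0.
  by field; rewrite b0 gt_eqF.
rewrite leb_integralE //; last first.
  apply/measurable_EFinP; apply: measurable_funTS; apply: continuous_measurable_fun.
  exact: cf.
apply: (@continuous_FTC2 R _ F) => //.
- exact/continuous_subspaceT.
- have cF : continuous F.
    by move=> t; apply/differentiable_continuous/derivable1_diffP; case: (dF t).
  split.
  + by move=> t _; case: (dF t).
  + exact/cvg_at_right_filter/cF.
  + exact/cvg_at_left_filter/cF.
- move=> t; rewrite in_itv /= => /andP[t0 tM]; rewrite derive1E.
  by rewrite (@derive_val _ _ _ _ _ _ _ (dF t)) tent_in // ltW.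
Qed.

(** Reflection of the negative half-line: the cosine part doubles, the sine part cancels. *)
Lemma integral_tent_split M (g : R -> R) : 0 < M -> continuous g ->
  (\int[leb]_t (tent M t * g t)%:E =
   \int[leb]_(t in `[0%R, M]) (tent M t * g (- t))%:E +
   \int[leb]_(t in `[0%R, M]) (tent M t * g t)%:E)%E.
Proof.
move=> M0 cg.
have cI : continuous (fun t => tent M t * g t).
  by move=> t; apply: cvgM; [exact: continuous_tent|exact: cg].
have mI : measurable_fun setT (fun t => (tent M t * g t)%:E).
  by apply/measurable_EFinP; apply: continuous_measurable_fun; exact: cI.
have cg' : continuous (g \o -%R).
  by move=> t; apply: continuous_comp; [exact: oppr_continuous|exact: cg].
have mI' : measurable_fun setT (fun t => (tent M t * (g \o -%R) t)%:E).
  apply/measurable_EFinP; apply: continuous_measurable_fun => t.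
  by apply: cvgM; [exact: continuous_tent|exact: cg'].
have -> : (\int[leb]_t (tent M t * g t)%:E =
  \int[leb]_(t in `[(- M)%R, M]) (tent M t * g t)%:E)%E.
  rewrite [RHS]integral_mkcond; apply: eq_integral => t _.
  rewrite patchE; case: ifPn => // /negP tM; rewrite tent_out ?mul0r //.
  rewrite ltNge; apply/negP => tM'; apply: tM.
  by rewrite inE /= in_itv /= -ler_norml.
have Msplit : `[- M, M]%classic = `[- M, 0%R[ `|` `[0%R, M] :> set R.
  rewrite -itv_bndbnd_setU ?bnd_simp //; last exact: ltW.
  by rewrite oppr_le0 ltW.
rewrite Msplit integral_setU //; last 2 first.
- exact: measurable_funTS.
- apply/disj_setPS => t [] /=; rewrite !in_itv /= => /andP[_ t0] /andP[t0' _].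
  by move: t0; rewrite ltNge t0'.
congr (_ + _)%E.
rewrite !leb_integralE //; last 2 first.
- exact: measurable_funTS.
- exact: measurable_funTS.
rewrite integral_itv_bndo_bndc; last exact: measurable_funTS.
have := @integration_by_substitution_oppr R (fun t => tent M t * g t) 0 M (ltW M0).
rewrite oppr0 => ->; last exact/continuous_subspaceT.
by apply: eq_integral => t _; rewrite /= tentN.
Qed.

Lemma integral_tent_cos M b : 0 < M -> b != 0 ->
  (\int[leb]_t (tent M t * cos (b * t))%:E)%E =
  (2 * (1 - cos (b * M)) / (b ^+ 2 * M))%:E.
Proof.
move=> M0 b0; rewrite (integral_tent_split _ (fun t => cos (b * t))) //; last first.
  move=> t; apply: (@continuous_comp _ _ _ (fun t => b * t) cos);
    [exact: mulrl_continuous|exact: continuous_cos].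
under eq_integral do rewrite mulrN cosN.
by rewrite integral_half_tent_cos // -EFinD; congr EFin; lra.
Qed.

Lemma integral_tent_sin M b : 0 < M ->
  (\int[leb]_t (tent M t * sin (b * t))%:E)%E = 0%E.
Proof.
move=> M0.
have cs : continuous (fun t => sin (b * t)).
  move=> t; apply: (@continuous_comp _ _ _ (fun t => b * t) sin);
    [exact: mulrl_continuous|exact: continuous_sin].
rewrite (integral_tent_split _ (fun t => sin (b * t))) //.
have mI : measurable_fun setT (fun t => tent M t * sin (b * t)).
  apply: continuous_measurable_fun => t.
  by apply: cvgM; [exact: continuous_tent|exact: cs].
have leb0M : (leb (`[0%R, M]%classic : set R) < +oo)%E by rewrite leb_cc ?ltry // ltW.
have iI : leb.-integrable `[0%R, M] (fun t => (tent M t * sin (b * t))%:E).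
  apply: measurable_bounded_integrable => //.
  - exact: measurable_funTS.
  exists 1; split => // x x1 t _; apply: le_trans (ltW x1).
  rewrite normrM mulr_ile1 //; last by rewrite ler_norml sin_geN1 sin_le1.
  by rewrite ger0_norm ?tent_ge0 ?tent_le1.
under eq_integral do rewrite mulrN sinN mulrN EFinN.
rewrite integralN /=; last first.
  exact: integrable_add_def.
by rewrite addeC subee //; exact: integrable_fin_num.
Qed.

End tent.

(** * Inverse squares capped near the origin *)

Section capped_inverse_square.
Context {R : realType}.
Implicit Types (c r t : R).

(** A common majorant for the Fejer kernel and for the squared transform of an interval: both are
    bounded near the origin and decay like [t ^- 2]. With [c = 0] only the tail remains. *)
Definition capsq c r t : R := if `|t| < r then c else t ^- 2.

Lemma measurable_inv_sqr : measurable_fun setT (fun t : R => t ^- 2).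
Proof.
have <- : ~` [set (0 : R)] `|` [set 0] = setT by exact: setvU.
apply/measurable_funU; [exact: measurableC|by []|split].
  apply: open_continuous_measurable_fun.
    by apply/closed_openC/accessible_closed_set1/hausdorff_accessible/Rhausdorff.
  move=> t; rewrite inE => /eqP t0; apply: cvgV.
    by rewrite expf_eq0 negb_and t0 orbT.
  exact: exprn_continuous.
exact: measurable_fun_set1.
Qed.

Lemma measurable_capsq c r : measurable_fun setT (capsq c r).
Proof.
apply: measurable_fun_ifT => //.
- by apply: measurable_fun_ltr => //; exact: measurableT_comp.
- exact: measurable_inv_sqr.
Qed.

Lemma capsq_ge0 c r t : 0 <= c -> 0 <= capsq c r t.
Proof. by move=> c0; rewrite /capsq; case: ifP => // _; rewrite invr_ge0 sqr_ge0. Qed.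

Lemma capsqN c r t : capsq c r (- t) = capsq c r t.
Proof. by rewrite /capsq normrN sqrrN. Qed.

Lemma within_continuous_inv_sqr (D : set R) : ~ D 0 ->
  {within D, continuous (fun t : R => t ^- 2)}.
Proof.
move=> D0; apply: continuous_in_subspaceT => t; rewrite inE => Dt.
have t0 : t != 0 by apply: contra_notN D0 => /eqP <-.
by apply: cvgV; [rewrite expf_eq0 negb_and t0 orbT|exact: exprn_continuous].
Qed.

Lemma integral_inv_sqr_y r : 0 < r ->
  (\int[@lebesgue_measure R]_(t in `[r, +oo[) (t ^- 2)%:E)%E = (r^-1)%:E.
Proof.
move=> r0.
have dF t : r < t -> is_derive t (1 : R) (fun t : R => - t^-1) (t ^- 2).
  move=> rt; have t0 : t != 0 by rewrite gt_eqF // (lt_trans r0).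
  have dV : is_derive t (1 : R) (fun t : R => t^-1) (- t ^- 2).
    split; first by apply: (@derivableV _ _ id) => //; exact: derivable_id.
    by rewrite (@deriveV _ _ id) // derive_id /GRing.scale /= mulr1.
  have : is_derive t (1 : R) (- (fun t : R => t^-1)) (- - t ^- 2).
    exact: is_deriveN.
  by rewrite opprK.
rewrite (@ge0_continuous_FTC2y R _ (fun t => - t^-1) _ 0).
- by rewrite -EFinB sub0r opprK.
- by move=> t _; rewrite invr_ge0 sqr_ge0.
- apply: within_continuous_inv_sqr => /=; rewrite in_itv /= andbT; apply/negP.
  by rewrite -ltNge.
- rewrite -oppr0; apply: cvgN; apply/(@gtr0_cvgV0 _ _ _ _ id); last exact: cvg_id.
  by near=> t; near: t; exact: nbhs_pinfty_gt.
- by move=> t rt; case: (dF _ rt).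
- apply: cvg_at_right_filter; apply: cvgN; apply: cvgV; last exact: cvg_id.
  by rewrite gt_eqF.
- move=> t; rewrite in_itv /= andbT => rt; rewrite derive1E.
  by rewrite (@derive_val _ _ _ _ _ _ _ (dF _ rt)).
Unshelve. all: by end_near. Qed.

Lemma integral_inv_sqr_Ny r : 0 < r ->
  (\int[@lebesgue_measure R]_(t in `]-oo, (- r)%R]) (t ^- 2)%:E)%E = (r^-1)%:E.
Proof.
move=> r0; rewrite (@ge0_integration_by_substitutionNy R (fun t => t ^- 2)).
- rewrite -integral_inv_sqr_y //; apply: eq_integral => t _.
  by rewrite /= sqrrN.
- apply: within_continuous_inv_sqr => /=; rewrite in_itv /=; apply/negP.
  by rewrite -ltNge oppr_lt0.
- by move=> t _; rewrite invr_ge0 sqr_ge0.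
Qed.

Lemma integral_capsq c r : 0 <= c -> 0 < r ->
  (\int[leb]_t (capsq c r t)%:E)%E = (2 * r * c + 2 / r)%:E.
Proof.
move=> c0 r0.
have mI : measurable_fun setT (fun t => (capsq c r t)%:E).
  by apply/measurable_EFinP; exact: measurable_capsq.
have -> : [set: R] = `]-oo, - r] `|` (`]- r, r[ `|` `[r, +oo[).
  apply/seteqP; split => // t _ /=; rewrite !in_itv /= andbT.
  have [tr|tr] := leP t (- r); first by left.
  by right; have [tr'|tr'] := ltP t r; [left|right].
rewrite ge0_integral_setU //; last 4 first.
- by apply: measurableU.
- exact: measurable_funTS.
- by move=> t _; rewrite lee_fin capsq_ge0.
- apply/disj_setPS => t [] /=; rewrite !in_itv /= andbT => h [/andP[h' _]|h'].
    by move: h'; rewrite ltNge h.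
  by have := le_trans h' h; rewrite leNgt gtrN.
rewrite ge0_integral_setU //; last 3 first.
- exact: measurable_funTS.
- by move=> t _; rewrite lee_fin capsq_ge0.
- apply/disj_setPS => t [] /=; rewrite !in_itv /= andbT => /andP[_ h] h'.
  by move: h; rewrite ltNge h'.
rewrite !leb_integralE //; do ?exact: measurable_funTS.
have -> : (\int[@lebesgue_measure R]_(t in `]-oo, (- r)%R]) (capsq c r t)%:E)%E = (r^-1)%:E.
  rewrite -integral_inv_sqr_Ny //; apply: eq_integral => t.
  rewrite inE /= in_itv /= => h; rewrite /capsq ltNge.
  have -> // : r <= `|t|.
  by rewrite -normrN (le_trans _ (ler_norm _)) // lerNr.
have -> : (\int[@lebesgue_measure R]_(t in `](- r)%R, r[) (capsq c r t)%:E)%E = (2 * r * c)%:E.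
  transitivity (\int[@lebesgue_measure R]_(t in `](- r)%R, r[) (cst c%:E) t)%E.
    apply: eq_integral => t; rewrite inE /= in_itv /= => h.
    by rewrite /capsq ltr_norml h.
  rewrite integral_cst //= lebesgue_measure_itv /= lte_fin gtrN //.
  by rewrite -EFinD -EFinM; congr EFin; ring.
have -> : (\int[@lebesgue_measure R]_(t in `[r, +oo[) (capsq c r t)%:E)%E = (r^-1)%:E.
  rewrite -integral_inv_sqr_y //; apply: eq_integral => t.
  rewrite inE /= in_itv /= andbT => h; rewrite /capsq ltNge.
  by rewrite (le_trans h) ?ler_norm.
by rewrite -!EFinD; congr EFin; field; rewrite gt_eqF.
Qed.

Lemma ge0_integral_shift (f : R -> \bar R) (x : R) : measurable_fun setT f ->
  (forall t, 0 <= f t)%E -> (\int[leb]_y f (y - x)%R = \int[leb]_t f t)%E.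
Proof.
move=> mf f0.
have mphi : measurable_fun setT (fun y : R => y - x).
  by apply: measurable_funB => //; exact: measurable_cst.
have := @ge0_integral_pushforward _ _ R R R _ mphi leb setT f measurableT mf
  (fun y _ => f0 y).
rewrite preimage_setT => <-.
rewrite (@eq_measure_integral _ _ _ setT leb (pushm leb mphi)) // => A mA _.
rewrite /pushm /pushforward.
apply/esym; transitivity (leb A); first by [].
rewrite [LHS](leb_affine (- x) 1 A ltr01 mA) mul1e.
by have -> : (fun t : R => - x + 1 * t) = (fun y => y - x);
  first by apply/funext => t; rewrite mul1r addrC.
Qed.

End capped_inverse_square.

(** * The Bessel inequality for indicators *)

Lemma integrable_indic_lty {d} {T : measurableType d} {R : realType}
    (mu : {measure set T -> \bar R}) (A : set T) :
  measurable A -> (mu A < +oo)%E -> mu.-integrable setT (EFin \o \1_A).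
Proof.
move=> mA Aoo; apply/integrableP; split; first exact/measurable_EFinP.
under eq_integral do rewrite /= ger0_norm //.
by rewrite integral_indic // setIT.
Qed.

Section tent_kernel.
Context {R : realType}.
Implicit Types (M a t : R).

Definition tkern M a : R := fine (\int[leb]_t (tent M t * cos (2 * pi * a * t))%:E)%E.

Lemma integrable_tent_mul M (g : R -> R) : 0 < M -> measurable_fun setT g ->
  (forall t, `|g t| <= 1) -> leb.-integrable setT (fun t => (tent M t * g t)%:E).
Proof.
move=> M0 mg g1.
have leb0M : (leb (`[(- M)%R, M]%classic : set R) < +oo)%E.
  by rewrite leb_cc ?ltry //; lra.
have iD : leb.-integrable setT (EFin \o \1_(`[- M, M] : set R)).
  by apply: integrable_indic_lty => //.
apply: (le_integrable measurableT _ _ iD).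
  by apply/measurable_EFinP/measurable_funM => //; exact: measurable_tent.
move=> t _; rewrite lee_fin normrM ger0_norm ?tent_ge0 //.
rewrite indicE; have [tM|tM] := boolP (t \in _).
  by rewrite normr1 mulr_ile1 ?tent_ge0 ?tent_le1.
rewrite tent_out ?mul0r // ltNge; apply: contra tM => tM.
by rewrite inE /= in_itv /= -ler_norml.
Qed.

Let measurable_trig (g : R -> R) b : continuous g -> measurable_fun setT (fun t : R => g (b * t)).
Proof.
move=> cg; apply: continuous_measurable_fun => t.
by apply: (@continuous_comp _ _ _ (fun t => b * t) g); [exact: mulrl_continuous|exact: cg].
Qed.

Lemma integrable_tent_cos M b : 0 < M ->
  leb.-integrable setT (fun t => (tent M t * cos (b * t))%:E).
Proof.
move=> M0; apply: integrable_tent_mul => //.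
  by apply: measurable_trig; exact: continuous_cos.
by move=> t; rewrite ler_norml cos_geN1 cos_le1.
Qed.

Lemma integrable_tent_sin M b : 0 < M ->
  leb.-integrable setT (fun t => (tent M t * sin (b * t))%:E).
Proof.
move=> M0; apply: integrable_tent_mul => //.
  by apply: measurable_trig; exact: continuous_sin.
by move=> t; rewrite ler_norml sin_geN1 sin_le1.
Qed.

Lemma tkernE M a : 0 < M ->
  (\int[leb]_t (tent M t * cos (2 * pi * a * t))%:E)%E = (tkern M a)%:E.
Proof. by move=> M0; rewrite fineK // integrable_fin_num // integrable_tent_cos. Qed.

Lemma tkern_ge0 M a : 0 < M -> 0 <= tkern M a.
Proof.
move=> M0; rewrite /tkern; have [->|a0] := eqVneq a 0.
  rewrite fine_ge0 // integral_ge0 // => t _; rewrite mulr0 mul0r cos0 mulr1 lee_fin.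
  exact: tent_ge0.
rewrite integral_tent_cos //=; last by rewrite !mulf_neq0 // gt_eqF // pi_gt0.
apply: divr_ge0; first by rewrite mulr_ge0 // subr_ge0 cos_le1.
by rewrite mulr_ge0 ?sqr_ge0 // ltW.
Qed.

(** Near the origin the kernel is at most the length [2 * M] of the support; away from it the closed
    form is used, with [2 <= pi] absorbing the numerical factor. *)
Lemma tkern_le M a : 0 < M -> tkern M a <= M^-1 * capsq (2 * M ^+ 2) M^-1 a.
Proof.
move=> M0; rewrite /capsq; case: ifPn => [_|aM].
  rewrite -lee_fin -tkernE //.
  have leb0M : leb (`[(- M)%R, M]%classic : set R) = (2 * M)%:E.
    by rewrite leb_cc; [congr EFin; ring|lra].
  have -> : (M^-1 * (2 * M ^+ 2))%:E = (\int[leb]_t (\1_(`[- M, M] : set R) t)%:E)%E.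
    rewrite integral_indic // setIT.
    transitivity (leb (`[(- M)%R, M]%classic : set R)); last by [].
    by rewrite leb0M; congr EFin; field; rewrite gt_eqF.
  apply: le_integral => //.
  - exact: integrable_tent_cos.
  - apply: integrable_indic_lty => //.
    by apply: (@le_lt_trans _ _ (2 * M)%:E); rewrite ?ltry // -leb0M.
  move=> t _; rewrite lee_fin indicE; have [tM|tM] := boolP (t \in _).
    by apply: (le_trans (ler_piMr _ _)); rewrite ?tent_ge0 ?cos_le1 ?tent_le1.
  rewrite tent_out ?mul0r // ltNge; apply: contra tM => tM.
  by rewrite inE /= in_itv /= -ler_norml.
have a0 : a != 0.
  by apply: contraNneq aM => ->; rewrite normr0 invr_gt0.
rewrite /tkern integral_tent_cos //=; last by rewrite !mulf_neq0 // gt_eqF // pi_gt0.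
have p2 : 2 <= pi :> R := pi_ge2 _.
set c := cos _; have c1 : -1 <= c by exact: cos_geN1.
have -> : 2 * (1 - c) / ((2 * pi * a) ^+ 2 * M) =
   ((1 - c) / (2 * pi ^+ 2)) * (M^-1 * a ^- 2).
  have : pi != 0 :> R by rewrite gt_eqF // pi_gt0.
  move: (pi) => p p0; by field; rewrite a0 p0 gt_eqF.
rewrite ler_piMl //.
  by rewrite mulr_ge0 ?invr_ge0 ?sqr_ge0 ?(ltW M0).
have p0 : 0 < pi :> R := pi_gt0 _.
have d0 : 0 < 2 * pi ^+ 2 :> R by rewrite mulr_gt0 // exprn_gt0.
by rewrite ler_pdivrMr // mul1r; nra.
Qed.

(** The mass of the majorant is independent of M, which makes the Bessel bound uniform in the
    frequency cutoff. *)
Lemma integral_tkern_le M x : 0 < M ->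
  (\int[leb]_y (M^-1 * capsq (2 * M ^+ 2) M^-1 (y - x))%:E)%E = 6%:E.
Proof.
move=> M0; have c0 : 0 <= 2 * M ^+ 2 by rewrite mulr_ge0 // exprn_ge0 // ltW.
rewrite (ge0_integral_shift (fun t => (M^-1 * capsq (2 * M ^+ 2) M^-1 t)%:E)).
- under eq_integral do rewrite EFinM.
  rewrite ge0_integralZl_EFin //.
  + rewrite integral_capsq ?invr_gt0 // -EFinM; congr EFin.
    by field; rewrite gt_eqF.
  + by move=> t _; rewrite lee_fin capsq_ge0.
  + by apply/measurable_EFinP; exact: measurable_capsq.
  + by rewrite invr_ge0 ltW.
- apply/measurable_EFinP/measurable_funM; first exact: measurable_cst.
  exact: measurable_capsq.
- by move=> t; rewrite lee_fin mulr_ge0 ?capsq_ge0 // invr_ge0 ltW.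
Qed.

Lemma integral_tent2_cos M (z : R * R) : 0 < M ->
  (\int[pleb]_xi (tent M xi.1 * tent M xi.2 * cos (2 * pi * dotp z xi))%:E)%E =
  (tkern M z.1 * tkern M z.2)%:E.
Proof.
move=> M0.
pose c (a t : R) := tent M t * cos (2 * pi * a * t).
pose s (a t : R) := tent M t * sin (2 * pi * a * t).
transitivity (\int[pleb]_xi ((c z.1 xi.1 * c z.2 xi.2)%:E -
    (s z.1 xi.1 * s z.2 xi.2)%:E))%E.
  apply: eq_integral => xi _; rewrite -EFinB; congr EFin.
  rewrite /dotp mulrDr cosD /c /s !mulrA; ring.
rewrite integralB //; last 2 first.
- exact: integrable_prod_fun (integrable_tent_cos _ _ M0) (integrable_tent_cos _ _ M0).
- exact: integrable_prod_fun (integrable_tent_sin _ _ M0) (integrable_tent_sin _ _ M0).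
rewrite (integral_prod_fun leb leb _ _ (integrable_tent_cos _ _ M0) (integrable_tent_cos _ _ M0)).
rewrite (integral_prod_fun leb leb _ _ (integrable_tent_sin _ _ M0) (integrable_tent_sin _ _ M0)).
by rewrite !integral_tent_sin // mule0 sube0 !tkernE.
Qed.

End tent_kernel.

Lemma measurable_dotp {R : realType} {d} {T : measurableType d} (f g : T -> R * R) :
  measurable_fun setT f -> measurable_fun setT g ->
  measurable_fun setT (fun t => dotp (f t) (g t)).
Proof.
move=> mf mg; apply: measurable_funD; apply: measurable_funM;
  by [exact: (measurableT_comp measurable_fst)|exact: (measurableT_comp measurable_snd)].
Qed.

Section bessel.
Context {R : realType}.
Variable A : set (R * R).
Hypothesis mA : measurable A.
Hypothesis Aoo : (leb2 A < +oo)%E.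

Let i1A : pleb.-integrable setT (EFin \o (\1_A : R * R -> R)).
Proof. exact: integrable_indic_lty. Qed.

Let trig (g : R -> R) (x xi : R * R) := g (2 * pi * dotp x xi).

Let measurable_trig (g : R -> R) {d} {T : measurableType d} (f h : T -> R * R) :
  continuous g -> measurable_fun setT f -> measurable_fun setT h ->
  measurable_fun setT (fun t => trig g (f t) (h t)).
Proof.
move=> cg mf mh; apply: (measurableT_comp (continuous_measurable_fun cg)).
apply: measurable_funM; first exact: measurable_cst.
exact: measurable_dotp.
Qed.

Let ft (g : R -> R) (xi : R * R) : R := \int[leb2]_x (\1_A x * trig g x xi).

Let integrable_trig (g : R -> R) xi : continuous g -> (forall t, `|g t| <= 1) ->
  pleb.-integrable setT (fun x => (\1_A x * trig g x xi)%:E).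
Proof.
move=> cg g1; apply: (le_integrable measurableT _ _ i1A).
  apply/measurable_EFinP/measurable_funM => //.
  by apply: measurable_trig => //; exact: measurable_cst.
by move=> x _; rewrite lee_fin normrM ler_piMr // g1.
Qed.

Let ftE (g : R -> R) xi : continuous g -> (forall t, `|g t| <= 1) ->
  (\int[pleb]_x (\1_A x * trig g x xi)%:E)%E = (ft g xi)%:E.
Proof.
by move=> cg g1; rewrite /ft /Rintegral fineK // integrable_fin_num // integrable_trig.
Qed.

Let measurable_ft (g : R -> R) : continuous g -> (forall t, `|g t| <= 1) ->
  measurable_fun setT (ft g).
Proof.
move=> cg g1.
(* Adding 1 makes the integrand nonnegative, so that Tonelli gives the measurability of the partial
   integral; the area of A is subtracted afterwards. *)
pose F xi := (\int[pleb]_x (\1_A x * (1 + trig g x xi))%:E)%E.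
have mF : measurable_fun setT F.
  apply: (@measurable_fun_fubini_tonelli_F _ _ (R * R)%type (R * R)%type R pleb
    (fun z => (\1_A z.2 * (1 + trig g z.2 z.1))%:E)).
    apply/measurable_EFinP/measurable_funM.
      exact: (measurableT_comp _ measurable_snd).
    by apply: measurable_funD => //; exact: measurable_trig.
  move=> z; rewrite lee_fin mulr_ge0 //; have := g1 (2 * pi * dotp z.2 z.1).
  by rewrite ler_norml /trig => /andP[]; lra.
have -> : ft g = fun xi => fine (F xi) - fine (pleb A).
  apply/funext => xi; rewrite /F.
  under eq_integral do rewrite mulrDr mulr1 EFinD.
  rewrite integralD //; last exact: integrable_trig.
  rewrite ftE // integral_indic // setIT.
  by rewrite fineD // ?ge0_fin_numE //= addrAC subrr add0r.
apply: measurable_funB => //.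
by apply: measurableT_comp => //; exact: measurable_fine.
Qed.

Let cos1 (t : R) : `|cos t| <= 1. Proof. by rewrite ler_norml cos_geN1 cos_le1. Qed.
Let sin1 (t : R) : `|sin t| <= 1. Proof. by rewrite ler_norml sin_geN1 sin_le1. Qed.

Let normsq_fourier xi :
  normsq (fourier (\1_A : R * R -> R) xi) = ft cos xi ^+ 2 + ft sin xi ^+ 2.
Proof. by rewrite /normsq /fourier /= sqrrN. Qed.

Lemma measurable_normsq_fourier :
  measurable_fun setT (fun xi => normsq (fourier (\1_A : R * R -> R) xi)).
Proof.
under eq_fun do rewrite normsq_fourier.
by apply: measurable_funD; apply: measurable_funX; apply: measurable_ft => //;
  [exact: continuous_cos|exact: continuous_sin].
Qed.

Let A2 (z : (R * R) * (R * R)) : R := \1_A z.1 * \1_A z.2.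
Let W M (xi : R * R) : R := tent M xi.1 * tent M xi.2.

Let W_ge0 M xi : 0 <= W M xi. Proof. by rewrite mulr_ge0 ?tent_ge0. Qed.

Let measurable_W M : measurable_fun setT (W M).
Proof.
by apply: measurable_funM; apply: measurableT_comp => //; exact: measurable_tent.
Qed.

Let integrable_W M : 0 < M -> pleb.-integrable setT (EFin \o W M).
Proof.
move=> M0.
have itent : leb.-integrable setT (fun t => (tent M t)%:E).
  have := integrable_tent_cos M 0 M0.
  by under eq_fun do rewrite mul0r cos0 mulr1.
exact: (integrable_prod_fun leb leb _ _ itent itent).
Qed.

Local Notation pleb2 := (sprod (pleb : {sigma_finite_measure set _ -> \bar R}) pleb).

Let integrable_A2 : pleb2.-integrable setT (EFin \o A2).
Proof. exact: (integrable_prod_fun pleb pleb _ _ i1A i1A). Qed.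

(** Integrating out the pair of points gives the weighted squared transform ([inner_z]); integrating
    out the frequency gives the Fejer kernel at the difference of the points ([inner_xi]). Fubini
    equates the two. *)
Let Phi M (p : ((R * R) * (R * R)) * (R * R)) : R :=
  A2 p.1 * W M p.2 * cos (2 * pi * dotp (p.1.1 - p.1.2) p.2).

Let integrable_Phi M : 0 < M -> (pleb2 \x pleb)%E.-integrable setT (EFin \o Phi M).
Proof.
move=> M0.
apply: (le_integrable measurableT _ _ (integrable_prod_fun pleb2 pleb _ _
  integrable_A2 (integrable_W _ M0))).
  apply/measurable_EFinP; apply: measurable_funM.
    exact: (measurable_prod_fun pleb2 pleb _ _ integrable_A2 (integrable_W _ M0)).
  apply: measurable_trig; first exact: continuous_cos.
    apply/measurable_fun_pairP; split.
      apply: measurable_funB => /=.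
        exact: (measurableT_comp measurable_fst (measurableT_comp measurable_fst measurable_fst)).
      exact: (measurableT_comp measurable_fst (measurableT_comp measurable_snd measurable_fst)).
    apply: measurable_funB => /=.
      exact: (measurableT_comp measurable_snd (measurableT_comp measurable_fst measurable_fst)).
    exact: (measurableT_comp measurable_snd (measurableT_comp measurable_snd measurable_fst)).
  exact: measurable_snd.
by move=> p _; rewrite lee_fin /Phi normrM ler_piMr.
Qed.

Let dotpB (x y xi : R * R) : dotp (x - y) xi = dotp x xi - dotp y xi.
Proof. by rewrite /dotp /=; ring. Qed.

Let inner_z M xi : (\int[pleb2]_z (Phi M (z, xi))%:E)%E =
  (W M xi * normsq (fourier (\1_A : R * R -> R) xi))%:E.
Proof.
pose c x := \1_A x * trig cos x xi; pose s x := \1_A x * trig sin x xi.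
have ic : pleb.-integrable setT (EFin \o c) by apply: integrable_trig => //; exact: continuous_cos.
have iss : pleb.-integrable setT (EFin \o s) by apply: integrable_trig => //; exact: continuous_sin.
transitivity (\int[pleb2]_z ((W M xi)%:E * ((c z.1 * c z.2)%:E + (s z.1 * s z.2)%:E)))%E.
  apply: eq_integral => z _; rewrite -EFinD -EFinM; congr EFin.
  rewrite /Phi /A2 /= dotpB mulrBr cosB /c /s /trig; ring.
have icc := integrable_prod_fun pleb pleb _ _ ic ic.
have iss2 := integrable_prod_fun pleb pleb _ _ iss iss.
rewrite integralZl //; last exact: integrableD.
rewrite integralD //.
rewrite (integral_prod_fun pleb pleb _ _ ic ic) (integral_prod_fun pleb pleb _ _ iss iss).
rewrite ftE //; last exact: continuous_cos.
rewrite ftE //; last exact: continuous_sin.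
by rewrite normsq_fourier !expr2.
Qed.

Let inner_xi M z : 0 < M -> (\int[pleb]_xi (Phi M (z, xi))%:E)%E =
  (A2 z * (tkern M (z.1.1 - z.2.1) * tkern M (z.1.2 - z.2.2)))%:E.
Proof.
move=> M0; under eq_integral do rewrite /Phi /= -mulrA EFinM.
rewrite integralZl //; last first.
  apply: (le_integrable measurableT _ _ (integrable_W _ M0)).
    apply/measurable_EFinP/measurable_funM; first exact: measurable_W.
    by apply: measurable_trig => //; exact: continuous_cos.
  by move=> xi _; rewrite lee_fin normrM ler_piMr.
by rewrite (integral_tent2_cos M (z.1 - z.2) M0) -EFinM.
Qed.

(** Schur's test: the second indicator is dropped and the kernel integrated over the whole plane,
    which gives [6 * 6 = 36] for each point of A. *)
Let outer M : 0 < M ->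
  (\int[pleb2]_z (A2 z * (tkern M (z.1.1 - z.2.1) * tkern M (z.1.2 - z.2.2)))%:E
   <= 36%:E * leb2 A)%E.
Proof.
move=> M0.
pose q (t : R) := M^-1 * capsq (2 * M ^+ 2) M^-1 t.
have c0 : 0 <= 2 * M ^+ 2 by rewrite mulr_ge0 // exprn_ge0 // ltW.
have q0 t : 0 <= q t by rewrite /q mulr_ge0 ?capsq_ge0 // invr_ge0 ltW.
have mq : measurable_fun setT q.
  by apply: measurable_funM; [exact: measurable_cst|exact: measurable_capsq].
have mqB (f h : (R * R) * (R * R) -> R) : measurable_fun setT f -> measurable_fun setT h ->
    measurable_fun setT (fun z => q (f z - h z)).
  by move=> mf mh; apply: (measurableT_comp mq); exact: measurable_funB.
pose Q z := (\1_A z.1 * (q (z.2.1 - z.1.1) * q (z.2.2 - z.1.2))).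
have mQ : measurable_fun setT (EFin \o Q).
  apply/measurable_EFinP; apply: measurable_funM.
    exact: (measurableT_comp _ measurable_fst).
  apply: measurable_funM; apply: mqB.
  - exact: (measurableT_comp measurable_fst measurable_snd).
  - exact: (measurableT_comp measurable_fst measurable_fst).
  - exact: (measurableT_comp measurable_snd measurable_snd).
  - exact: (measurableT_comp measurable_snd measurable_fst).
have Q0 z : 0 <= Q z by rewrite mulr_ge0 // mulr_ge0.
apply: (@le_trans _ _ (\int[pleb2]_z (Q z)%:E)%E).
  rewrite !ge0_integralTE; last 2 first.
  - by move=> z; rewrite lee_fin.
  - by move=> z; rewrite lee_fin !mulr_ge0 ?tkern_ge0.
  apply: le_ereal_sup => _ [h /= hf <-]; exists h => // z.
  apply: (le_trans (hf z)); rewrite lee_fin /A2 -mulrA ler_wpM2l //.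
  rewrite -[leRHS]mul1r ler_pM ?mulr_ge0 ?tkern_ge0 //.
  rewrite ler_pM ?tkern_ge0 //.
    by rewrite (le_trans (tkern_le _ _ M0)) // /q -[X in capsq _ _ X]opprB capsqN.
  by rewrite (le_trans (tkern_le _ _ M0)) // /q -[X in capsq _ _ X]opprB capsqN.
rewrite fubini_tonelli1 //.
rewrite /fubini_F /=.
have E (x : R * R) : (\int[pleb]_y (Q (x, y))%:E)%E = ((\1_A x)%:E * 36%:E)%E.
  rewrite /Q /=.
  under eq_integral do rewrite EFinM.
  rewrite ge0_integralZl_EFin //; last 2 first.
  - by move=> y _; rewrite lee_fin mulr_ge0.
  - apply/measurable_EFinP/measurable_funM; apply: (measurableT_comp mq);
      apply: measurable_funB => //; exact: measurable_cst.
  congr (_ * _)%E.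
  have mq1 (a : R) : measurable_fun setT (fun t : R => q (t - a)).
    by apply: (measurableT_comp mq); apply: measurable_funB => //; exact: measurable_cst.
  rewrite fubini_tonelli1 //; last 2 first.
  - by apply/measurable_EFinP/measurable_funM; [apply: (measurableT_comp (mq1 _))|
      apply: (measurableT_comp (mq1 _))].
  - by move=> y; rewrite lee_fin mulr_ge0.
  rewrite /fubini_F /=.
  under eq_integral => y _.
    under eq_integral do rewrite EFinM.
    rewrite ge0_integralZl_EFin //; [|by move=> t _; rewrite lee_fin|
      by apply/measurable_EFinP; exact: mq1].
    rewrite integral_tkern_le //.
    over.
  rewrite ge0_integralZr //; [|by apply/measurable_EFinP; exact: mq1|
    by move=> t _; rewrite lee_fin].
  by rewrite integral_tkern_le // -EFinM; congr EFin; ring.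
under eq_integral do rewrite E.
rewrite ge0_integralZr //; last exact/measurable_EFinP.
by rewrite integral_indic // setIT muleC.
Qed.

Let bessel_tent M : 0 < M ->
  (\int[pleb]_xi (W M xi * normsq (fourier (\1_A : R * R -> R) xi))%:E <= 36%:E * leb2 A)%E.
Proof.
move=> M0; under eq_integral do rewrite -inner_z.
rewrite -(Fubini (integrable_Phi _ M0)) /=.
by under eq_integral do rewrite inner_xi //; exact: outer.
Qed.

Let box (n : nat) : set (R * R) :=
  `[- (n.+1%:R / 2), n.+1%:R / 2] `*` `[- (n.+1%:R / 2), n.+1%:R / 2].

Let measurable_box n : measurable (box n).
Proof. by apply: measurableX; exact: measurable_itv. Qed.

(** On the box both tents are at least 1/2, so the cutoff loses a factor 4, and [4 * 36 = 144]. *)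
Let bessel_box n : (\int[leb2]_(xi in box n)
  (normsq (fourier (\1_A : R * R -> R) xi))%:E <= 144%:E * leb2 A)%E.
Proof.
have M0 : 0 < n.+1%:R :> R by rewrite ltr0n.
have h0 xi : 0 <= normsq (fourier (\1_A : R * R -> R) xi).
  by rewrite normsq_fourier addr_ge0 ?sqr_ge0.
apply: (@le_trans _ _ (4%:E * \int[pleb]_xi
    (W n.+1%:R xi * normsq (fourier (\1_A : R * R -> R) xi))%:E)%E).
  rewrite -ge0_integralZl_EFin //; last 2 first.
  - by move=> xi _; rewrite lee_fin mulr_ge0.
  - apply/measurable_EFinP/measurable_funM; first exact: measurable_W.
    exact: measurable_normsq_fourier.
  rewrite (integral_mkcond (box n)) /sprod; apply: ge0_le_integral => //.
  - by move=> xi _; apply: erestrict_ge0 => ? _; rewrite lee_fin.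
  - apply/(measurable_restrictT (fun xi => (normsq (fourier (\1_A : R * R -> R) xi))%:E)
      (measurable_box n)).
    by apply: measurable_funTS; apply/measurable_EFinP; exact: measurable_normsq_fourier.
  - apply: measurable_funeM; apply/measurable_EFinP/measurable_funM.
      exact: measurable_W.
    exact: measurable_normsq_fourier.
  move=> xi _; rewrite patchE; case: ifPn => [|_]; last first.
    by rewrite -EFinM lee_fin mulr_ge0 // mulr_ge0.
  rewrite inE => -[] /=; rewrite !in_itv /= -!ler_norml => x1 x2.
  rewrite -EFinM lee_fin mulrA ler_peMl //.
  have := tent_half _ _ M0 x1; have := tent_half _ _ M0 x2; rewrite /W.
  nra.
apply: (@le_trans _ _ (4%:E * (36%:E * leb2 A))%E).
  by apply: lee_wpmul2l; [rewrite lee_fin|exact: bessel_tent].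
by rewrite muleA -EFinM (_ : 4 * 36 = 144 :> R) //; lra.
Qed.

(** Monotone convergence along the boxes. This is one half of Plancherel's identity up to a
    constant; only the order of magnitude enters the variance bounds. *)
Lemma bessel_indic :
  (\int[leb2]_xi (normsq (fourier (\1_A : R * R -> R) xi))%:E <= 144%:E * leb2 A)%E.
Proof.
have UT : \bigcup_n box n = setT.
  apply/seteqP; split => // -[x y] _.
  have hn : 2 * (`|x| + `|y|) < (Num.bound (2 * (`|x| + `|y|)))%:R.
    by apply: archi_boundP; rewrite mulr_ge0 // addr_ge0.
  exists (Num.bound (2 * (`|x| + `|y|))) => //; move: hn.
  set n := Num.bound _ => hn; have n1 : n%:R <= n.+1%:R :> R by rewrite ler_nat.
  by split; rewrite /= in_itv /= -ler_norml; have := normr_ge0 x;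
    have := normr_ge0 y; lra.
pose h xi := (normsq (fourier (\1_A : R * R -> R) xi))%:E.
have nd : {homo box : n m / (n <= m)%N >-> (n <= m)%O}.
  move=> n m nm; apply/subsetPset => -[x y] [] /=; rewrite !in_itv /= -!ler_norml.
  have nm' : n.+1%:R <= m.+1%:R :> R by rewrite ler_nat.
  by move=> hx hy; split; rewrite /= in_itv /= -ler_norml; lra.
have mh n : measurable_fun (box n) h.
  apply: measurable_funTS.
  by apply/measurable_EFinP; exact: measurable_normsq_fourier.
have h0 n xi : box n xi -> (0 <= h xi)%E.
  by move=> _; rewrite lee_fin normsq_fourier addr_ge0 ?sqr_ge0.
have := @ge0_nondecreasing_set_cvg_integral _ _ R box h leb2 nd measurable_box mh h0.
rewrite UT => H; have /cvg_lim <- // := H.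
apply: lime_le; first exact: cvgP H.
by apply: nearW => n; exact: bessel_box.
Qed.

End bessel.

(** * Fourier tails of squares *)

Section integral_comparison.
Context {d} {T : measurableType d} {R : realType}.

(* No measurability is needed: the integral of a nonnegative function is a
   supremum over the simple functions below it. *)
Lemma ge0_le_integral_any (mu : {measure set T -> \bar R}) (D : set T)
    (f g : T -> \bar R) : (forall x, D x -> 0 <= f x)%E ->
  (forall x, D x -> f x <= g x)%E ->
  (\int[mu]_(x in D) f x <= \int[mu]_(x in D) g x)%E.
Proof.
move=> f0 fg; rewrite !(integral_mkcond D) !ge0_integralTE; last 2 first.
- by apply: erestrict_ge0 => x Dx; exact: le_trans (f0 _ Dx) (fg _ Dx).
- exact: erestrict_ge0.
apply: le_ereal_sup => _ [h /= hf <-]; exists h => // x.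
apply: (le_trans (hf x)); rewrite !patchE; case: ifPn => //.
by rewrite inE => /fg.
Qed.

(** Restricting both measures to D turns a comparison on subsets of D into a comparison of measures.
    It is applied to the spectral measure on a small frequency box, where the better bound on its
    density holds. *)
Lemma le_measure_integral_on (m1 m2 : {measure set T -> \bar R}) (D : set T)
    (k : R) (h : T -> \bar R) : measurable D -> 0 <= k ->
  (forall A, measurable A -> A `<=` D -> (m1 A <= k%:E * m2 A)%E) ->
  (forall x, (0 <= h x)%E) -> measurable_fun setT h ->
  (\int[m1]_(x in D) h x <= k%:E * \int[m2]_(x in D) h x)%E.
Proof.
move=> mD k0 m12 h0 mh.
rewrite (eq_measure_integral (mrestr m1 mD)); last first.
  by move=> A mA AD; rewrite /= /mrestr setIidl.
rewrite (eq_measure_integral (mrestr m2 mD) (m1 := m2)); last first.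
  by move=> A mA AD; rewrite /= /mrestr setIidl.
rewrite -(ge0_integral_mscale _ _ (NngNum k0)) //; last first.
  exact: measurable_funTS.
apply: ge0_le_measure_integral => // A mA.
by rewrite /mrestr /mscale /=; apply: m12; [exact: measurableI|].
Qed.

End integral_comparison.

Section square_fourier.
Context {R : realType}.
Implicit Types (a b l r t : R).

Let lin b : R -> R := b \*: id.

Let FT1 (g : R -> R) a l t : R := \int[leb]_(x in `[a, a + l]) g (2 * pi * t * x).

Lemma FT1_cosE a l b : 0 < l -> b != 0 ->
  \int[leb]_(x in `[a, a + l]) cos (b * x) = (sin (b * (a + l)) - sin (b * a)) / b.
Proof.
move=> l0 b0; rewrite /Rintegral.
have cf : continuous (fun t => cos (b * t)).
  move=> t; apply: (@continuous_comp _ _ _ (fun t => b * t) cos); last exact: continuous_cos.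
  exact: mulrl_continuous.
rewrite leb_integralE //; last first.
  by apply/measurable_EFinP; apply: measurable_funTS; exact: continuous_measurable_fun.
pose F : R -> R := b^-1 \*: (sin \o lin b).
have dF t : is_derive t (1 : R) F (cos (b * t)).
  apply: is_derive_eq; rewrite /GRing.scale /= /lin /= /GRing.scale /=.
  by field.
have cF : continuous F.
  by move=> t; apply/differentiable_continuous/derivable1_diffP; case: (dF t).
rewrite (@continuous_FTC2 R _ F) ?ltrDl //.
- by rewrite /F /lin /= /GRing.scale /=; field.
- exact/continuous_subspaceT.
- split; [by move=> t _; case: (dF t)|exact/cvg_at_right_filter/cF|
    exact/cvg_at_left_filter/cF].
- by move=> t _; rewrite derive1E (@derive_val _ _ _ _ _ _ _ (dF t)).
Qed.

Lemma FT1_sinE a l b : 0 < l -> b != 0 ->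
  \int[leb]_(x in `[a, a + l]) sin (b * x) = (cos (b * a) - cos (b * (a + l))) / b.
Proof.
move=> l0 b0; rewrite /Rintegral.
have cf : continuous (fun t => sin (b * t)).
  move=> t; apply: (@continuous_comp _ _ _ (fun t => b * t) sin); last exact: continuous_sin.
  exact: mulrl_continuous.
rewrite leb_integralE //; last first.
  by apply/measurable_EFinP; apply: measurable_funTS; exact: continuous_measurable_fun.
pose F : R -> R := - b^-1 \*: (cos \o lin b).
have dF t : is_derive t (1 : R) F (sin (b * t)).
  apply: is_derive_eq; rewrite /GRing.scale /= /lin /= /GRing.scale /=.
  by field.
have cF : continuous F.
  by move=> t; apply/differentiable_continuous/derivable1_diffP; case: (dF t).
rewrite (@continuous_FTC2 R _ F) ?ltrDl //.
- by rewrite /F /lin /= /GRing.scale /=; field.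
- exact/continuous_subspaceT.
- split; [by move=> t _; case: (dF t)|exact/cvg_at_right_filter/cF|
    exact/cvg_at_left_filter/cF].
- by move=> t _; rewrite derive1E (@derive_val _ _ _ _ _ _ _ (dF t)).
Qed.

Definition normsq1 a l t : R := FT1 cos a l t ^+ 2 + FT1 sin a l t ^+ 2.

Lemma FT1_le (g : R -> R) a l t : 0 < l -> continuous g -> (forall t, `|g t| <= 1) ->
  `|FT1 g a l t| <= l.
Proof.
move=> l0 cg g1.
have cf : continuous (fun x => g (2 * pi * t * x)).
  move=> x; apply: (@continuous_comp _ _ _ (fun x => 2 * pi * t * x) g); last exact: cg.
  exact: mulrl_continuous.
have lebl : leb (`[a, (a + l)%R]%classic : set R) = l%:E.
  by rewrite leb_cc ?lerDl ?(ltW l0) // addrAC subrr add0r.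
have ig : leb.-integrable `[a, a + l] (EFin \o (fun x => g (2 * pi * t * x))).
  apply: measurable_bounded_integrable => //.
  - by apply: (@le_lt_trans _ _ l%:E); rewrite ?ltry // -lebl.
  - by apply: measurable_funTS; exact: continuous_measurable_fun.
  by exists 1; split => // x x1 y _; apply: le_trans (ltW x1).
rewrite /FT1 (le_trans (le_normr_Rintegral _ ig)) //.
apply: (@le_trans _ _ (\int[leb]_(x in `[a, a + l]) cst 1 x)); last first.
  by rewrite Rintegral_cst //= mul1r -[leRHS]/(fine l%:E) -lebl.
have ig' : leb.-integrable `[a, a + l] (EFin \o (fun x => `|g (2 * pi * t * x)|)).
  exact: integrable_norm ig.
apply: (@le_Rintegral _ _ _ leb _ _ _ _ ig') => //.
apply: measurable_bounded_integrable => //.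
  by apply: (@le_lt_trans _ _ l%:E); rewrite ?ltry // -lebl.
by exists 1; split => // x x1 y _ /=; rewrite normr1 ltW.
Qed.

(** The bound [2 * l ^+ 2] holds for every t and the bound [t ^- 2] for every nonzero t, the latter
    because two points of the unit circle have squared distance at most 4. Hence the threshold r is
    free. *)
Lemma normsq1_le a l r t : 0 < l -> 0 < r -> normsq1 a l t <= capsq (2 * l ^+ 2) r t.
Proof.
move=> l0 r0; rewrite /capsq; case: ifPn => [_|tr].
  have h (g : R -> R) : continuous g -> (forall t, `|g t| <= 1) -> FT1 g a l t ^+ 2 <= l ^+ 2.
    move=> cg g1; rewrite -real_normK ?num_real // lerXn2r ?nnegrE ?(ltW l0) //.
    exact: FT1_le.
  have := h _ (@continuous_cos R) (fun t => _); have := h _ (@continuous_sin R) (fun t => _).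
  rewrite /normsq1.
  have s1 (x : R) : `|sin x| <= 1 by rewrite ler_norml sin_geN1 sin_le1.
  have c1 (x : R) : `|cos x| <= 1 by rewrite ler_norml cos_geN1 cos_le1.
  by have := h _ (@continuous_cos R) c1; have := h _ (@continuous_sin R) s1; lra.
have t0 : t != 0 by apply: contraNneq tr => ->; rewrite normr0.
have p2 : 2 <= pi :> R := pi_ge2 _.
have p0 : 0 < pi :> R := pi_gt0 _.
have b0 : 2 * pi * t != 0 by rewrite !mulf_neq0 // gt_eqF.
rewrite /normsq1 /FT1 FT1_cosE // FT1_sinE //.
set A := 2 * pi * t * a; set B := 2 * pi * t * (a + l).
have : (sin B - sin A) ^+ 2 + (cos A - cos B) ^+ 2 <= 4.
  have := cos2Dsin2 A; have := cos2Dsin2 B; have := cos_geN1 (B - A).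
  rewrite cosB; nra.
have -> : ((sin B - sin A) / (2 * pi * t)) ^+ 2 + ((cos A - cos B) / (2 * pi * t)) ^+ 2 =
  ((sin B - sin A) ^+ 2 + (cos A - cos B) ^+ 2) / (4 * pi ^+ 2) * t ^- 2.
  have : pi != 0 :> R by rewrite gt_eqF.
  rewrite /A /B; move: (sin _) (sin _) (cos _) (cos _) => x1 x2 x3 x4.
  by move: (pi) => p p00; field; rewrite t0 p00.
move=> h; rewrite ler_piMl ?invr_ge0 ?sqr_ge0 //.
have d0 : 0 < 4 * pi ^+ 2 :> R by rewrite mulr_gt0 // exprn_gt0.
by rewrite ler_pdivrMr // mul1r; nra.
Qed.

Lemma normsq_fourier_rect a b l xi : 0 < l ->
  normsq (fourier (\1_(`[a, (a + l)%R[ `*` `[b, (b + l)%R[) : R * R -> R) xi) =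
  normsq1 a l xi.1 * normsq1 b l xi.2.
Proof.
move=> l0.
have int1 (g : R -> R) c t : continuous g -> (forall t, `|g t| <= 1) ->
  leb.-integrable setT (fun x => (\1_(`[c, (c + l)%R[ : set R) x * g (2 * pi * t * x))%:E).
  move=> cg g1.
  have cf : continuous (fun x => g (2 * pi * t * x)).
    move=> x; apply: (@continuous_comp _ _ _ (fun x => 2 * pi * t * x) g); last exact: cg.
    exact: mulrl_continuous.
  have lebl : leb (`[c, (c + l)%R[%classic : set R) = l%:E.
    by rewrite leb_co ?lerDl ?(ltW l0) // addrAC subrr add0r.
  have i1 : leb.-integrable setT (EFin \o \1_(`[c, (c + l)%R[ : set R)).
    apply: integrable_indic_lty => //.
    by apply: (@le_lt_trans _ _ l%:E); rewrite ?ltry // -lebl.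
  apply: (le_integrable measurableT _ _ i1).
    by apply/measurable_EFinP/measurable_funM => //; exact: continuous_measurable_fun.
  by move=> x _; rewrite lee_fin normrM ler_piMr.
have intE (g : R -> R) c t : continuous g -> (forall t, `|g t| <= 1) ->
  (\int[leb]_x (\1_(`[c, (c + l)%R[ : set R) x * g (2 * pi * t * x))%:E)%E = (FT1 g c l t)%:E.
  move=> cg g1.
  have cf : continuous (fun x => g (2 * pi * t * x)).
    move=> x; apply: (@continuous_comp _ _ _ (fun x => 2 * pi * t * x) g); last exact: cg.
    exact: mulrl_continuous.
  have mf : measurable_fun setT (fun x => (g (2 * pi * t * x))%:E).
    by apply/measurable_EFinP; exact: continuous_measurable_fun.
  have E : (\int[leb]_x (\1_(`[c, (c + l)%R[ : set R) x * g (2 * pi * t * x))%:E)%E =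
    (\int[leb]_(x in `[c, (c + l)%R]) (g (2 * pi * t * x))%:E)%E.
    rewrite [RHS]leb_integralE //; last exact: measurable_funTS.
    rewrite -integral_itv_bndo_bndc; last exact: measurable_funTS.
    rewrite -[RHS]leb_integralE //; last exact: measurable_funTS.
    rewrite [RHS]integral_mkcond; apply: eq_integral => x _.
    by rewrite patchE indicE; case: (x \in _); rewrite ?mul1r ?mul0r.
  rewrite E /FT1 /Rintegral fineK // -E; apply: integrable_fin_num => //.
  exact: int1.
have s1 (x : R) : `|sin x| <= 1 by rewrite ler_norml sin_geN1 sin_le1.
have c1 (x : R) : `|cos x| <= 1 by rewrite ler_norml cos_geN1 cos_le1.
have prodE (g h : R -> R) : continuous g -> (forall t, `|g t| <= 1) ->
    continuous h -> (forall t, `|h t| <= 1) ->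
  let k x := \1_(`[a, (a + l)%R[ : set R) x.1 * g (2 * pi * xi.1 * x.1) *
    (\1_(`[b, (b + l)%R[ : set R) x.2 * h (2 * pi * xi.2 * x.2)) in
  leb2.-integrable setT (EFin \o k) /\
  (\int[leb2]_x (k x)%:E)%E = (FT1 g a l xi.1 * FT1 h b l xi.2)%:E.
  move=> cg g1 ch h1 k; split.
    exact: (integrable_prod_fun leb leb _ _ (int1 g a xi.1 cg g1) (int1 h b xi.2 ch h1)).
  rewrite (integral_prod_fun leb leb _ _ (int1 g a xi.1 cg g1) (int1 h b xi.2 ch h1)).
  by rewrite !intE.
have indE (x : R * R) : \1_(`[a, (a + l)%R[ `*` `[b, (b + l)%R[) x =
    \1_(`[a, (a + l)%R[ : set R) x.1 * \1_(`[b, (b + l)%R[ : set R) x.2 :> R.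
  by rewrite !indicE in_setX; case: (_ \in _); case: (_ \in _); rewrite ?mulr1 ?mulr0.
have ccs := @continuous_cos R; have css := @continuous_sin R.
have [icc Ecc] := prodE cos cos ccs c1 ccs c1.
have [iss Ess] := prodE sin sin css s1 css s1.
have [ics Ecs] := prodE cos sin ccs c1 css s1.
have [isc Esc] := prodE sin cos css s1 ccs c1.
rewrite /normsq /fourier /=.
have -> : \int[leb2]_x (\1_(`[a, (a + l)%R[ `*` `[b, (b + l)%R[) x * cos (2 * pi * dotp x xi)) =
   FT1 cos a l xi.1 * FT1 cos b l xi.2 - FT1 sin a l xi.1 * FT1 sin b l xi.2.
  rewrite /Rintegral -[RHS]/(fine (_)%:E) EFinB -Ecc -Ess -integralB //.
  congr fine; apply: eq_integral => x _; rewrite -EFinB; congr EFin.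
  by rewrite indE /dotp mulrDr cosD [x.1 * _]mulrC [x.2 * _]mulrC !mulrA; ring.
have -> : \int[leb2]_x (\1_(`[a, (a + l)%R[ `*` `[b, (b + l)%R[) x * sin (2 * pi * dotp x xi)) =
   FT1 sin a l xi.1 * FT1 cos b l xi.2 + FT1 cos a l xi.1 * FT1 sin b l xi.2.
  rewrite /Rintegral -[RHS]/(fine (_)%:E) EFinD -Ecs -Esc -integralD //.
  congr fine; apply: eq_integral => x _; rewrite -EFinD; congr EFin.
  by rewrite indE /dotp mulrDr sinD [x.1 * _]mulrC [x.2 * _]mulrC !mulrA; ring.
by rewrite /normsq1; ring.
Qed.

(** Outside the frequency box of half-side r one coordinate is at least r and contributes a pure
    tail of mass [2 / r]. The other factor is capped at [l^-1], where its two bounds have the same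
    order, so that its mass is of order l. *)
Definition fourier_tail l r (xi : R * R) : R :=
  capsq 0 r xi.1 * capsq (2 * l ^+ 2) l^-1 xi.2 +
  capsq (2 * l ^+ 2) l^-1 xi.1 * capsq 0 r xi.2.

Lemma normsq1_ge0 a l t : 0 <= normsq1 a l t.
Proof. by rewrite addr_ge0 ?sqr_ge0. Qed.

Lemma fourier_tail_ge0 l r xi : 0 <= fourier_tail l r xi.
Proof. by rewrite addr_ge0 // mulr_ge0 // capsq_ge0 // mulr_ge0 // sqr_ge0. Qed.

Lemma normsq_fourier_tail a b l r xi : 0 < l -> 0 < r ->
  ~ (`|xi.1| < r /\ `|xi.2| < r) ->
  normsq (fourier (\1_(`[a, (a + l)%R[ `*` `[b, (b + l)%R[) : R * R -> R) xi) <=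
  fourier_tail l r xi.
Proof.
move=> l0 r0 xr; rewrite normsq_fourier_rect // /fourier_tail.
have li0 : 0 < l^-1 by rewrite invr_gt0.
have c0 t : 0 <= capsq (2 * l ^+ 2) l^-1 t by rewrite capsq_ge0 // mulr_ge0 // sqr_ge0.
have out c t : r <= `|t| -> normsq1 c l t <= capsq 0 r t.
  move=> rt; rewrite (le_trans (normsq1_le c _ _ _ l0 r0)) // /capsq.
  by rewrite ltNge rt.
have [x1|x1] := ltP `|xi.1| r; last first.
  rewrite (@le_trans _ _ (capsq 0 r xi.1 * capsq (2 * l ^+ 2) l^-1 xi.2)) //.
    by rewrite ler_pM ?normsq1_ge0 ?out ?normsq1_le.
  by rewrite lerDl mulr_ge0 // capsq_ge0.
have [x2|x2] := ltP `|xi.2| r; first by case: xr.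
rewrite (@le_trans _ _ (capsq (2 * l ^+ 2) l^-1 xi.1 * capsq 0 r xi.2)) //.
  by rewrite ler_pM ?normsq1_ge0 ?out ?normsq1_le.
by rewrite lerDr mulr_ge0 // capsq_ge0.
Qed.

Lemma measurable_fourier_tail l r : measurable_fun setT (fourier_tail l r).
Proof.
by apply: measurable_funD; apply: measurable_funM; apply: measurableT_comp => //;
  exact: measurable_capsq.
Qed.

Lemma integral_fourier_tail l r : 0 < l -> 0 < r ->
  (\int[leb2]_xi (fourier_tail l r xi)%:E)%E = (24 * l / r)%:E.
Proof.
move=> l0 r0.
have c0 : 0 <= 2 * l ^+ 2 by rewrite mulr_ge0 // sqr_ge0.
have li0 : 0 < l^-1 by rewrite invr_gt0.
have icap (c rr : R) : 0 <= c -> 0 < rr -> leb.-integrable setT (EFin \o capsq c rr).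
  move=> c00 rr0; apply/integrableP; split.
    by apply/measurable_EFinP; exact: measurable_capsq.
  under eq_integral do rewrite /= ger0_norm ?capsq_ge0 //.
  by rewrite integral_capsq // ltry.
rewrite /fourier_tail; under eq_integral do rewrite EFinD.
rewrite integralD //; last 2 first.
- exact: (integrable_prod_fun leb leb _ _ (icap 0 r (lexx _) r0) (icap _ _ c0 li0)).
- exact: (integrable_prod_fun leb leb _ _ (icap _ _ c0 li0) (icap 0 r (lexx _) r0)).
rewrite (integral_prod_fun leb leb _ _ (icap 0 r (lexx _) r0) (icap _ _ c0 li0)).
rewrite (integral_prod_fun leb leb _ _ (icap _ _ c0 li0) (icap 0 r (lexx _) r0)).
rewrite !integral_capsq // -!EFinM -EFinD; congr EFin.
by field; rewrite !gt_eqF.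
Qed.

End square_fourier.

(** * Variance of counts *)

Section locally_finite.
Context {R : realType}.
Implicit Types (X A : set (R * R)).

(** If the intersection were infinite, its cofinite subsets would generate a proper filter, whose
    cluster point in the compact set is a limit point of X. *)
Lemma compact_no_limit_point_finite X A :
  limit_point X = set0 -> compact A -> finite_set (X `&` A).
Proof.
move=> X0 cA; apply: contrapT => infXA.
pose F : set_system (R * R) := [set U | finite_set ((X `&` A) `\` U)].
have FF : ProperFilter F.
  split; first by rewrite /F /= setD0.
  split; rewrite /F /=.
  - by rewrite setDT; exact: finite_set0.
  - move=> U V fU fV.
    apply: (@sub_finite_set _ _ (((X `&` A) `\` U) `|` ((X `&` A) `\` V))).
      move=> x [XAx nUV]; have [Ux|nUx] := pselect (U x); [right|by left].
      by split => // Vx; exact: nUV.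
    by rewrite finite_setU.
  - move=> U V UV; apply: sub_finite_set => x [XAx nV]; split => // Ux.
    exact/nV/UV.
have [|p [Ap clp]] := cA F FF.
  by apply: (@sub_finite_set _ _ set0) => // x [[_ Ax] /(_ Ax)].
have : ~ limit_point X p by rewrite X0.
rewrite not_limit_pointE => -[V pV XV].
have [|x [[[Xx _] xp] /(conj Xx)/XV]] := clp ((X `&` A) `\ p) V _ pV; last by [].
apply: (@sub_finite_set _ _ [set p]) => // x [XAx nx] /=.
by apply: contrapT => xp; exact: nx.
Qed.

Lemma bounded_no_limit_point_finite X A :
  limit_point X = set0 -> bounded_set A -> finite_set (X `&` A).
Proof.
move=> X0 /bounded_rect [M M0 AM].
apply: (@sub_finite_set _ _ (X `&` (`[- M, M] `*` `[- M, M]))).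
  move=> x [Xx /AM [/= h1 h2]]; split => //; split; [move: h1|move: h2];
    by rewrite /= !in_itv /= => /andP[-> /ltW].
by apply: compact_no_limit_point_finite => //; apply: compact_setX; exact: segment_compact.
Qed.

Lemma sum_indic_npoints X A : finite_set (X `&` A) ->
  \sum_(x \in X) (\1_A x : R) = (npoints (X `&` A))%:R.
Proof.
move=> fXA.
transitivity (\sum_(x \in X `&` A) (1 : R)).
  rewrite fsbig_mkcond [RHS]fsbig_mkcond; apply: eq_fsbigr => x _.
  rewrite !patchE indicE in_setI; case: (x \in X) => //=.
  by case: (x \in A).
by rewrite fsbig_finite //= big_const_seq count_predT iter_addr_0.
Qed.

Lemma esum_indic_npoints X A : finite_set (X `&` A) ->
  (\esum_(x in X) ((\1_A x)%:E : \bar R) = (npoints (X `&` A))%:R%:E)%E.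
Proof.
move=> fXA; rewrite -(sum_indic_npoints _ _ fXA).
transitivity (\esum_(x in X `&` A) ((\1_A x)%:E : \bar R))%E.
  rewrite esum_mkcond [RHS]esum_mkcond; apply: eq_esum => x _.
  rewrite indicE in_setI; case: (x \in X) => //=.
  by case: (x \in A).
rewrite esum_fset //.
rewrite fsumEFin //; congr EFin.
have XAA : X `&` A `&` A = X `&` A by rewrite -setIA setIid.
by rewrite !sum_indic_npoints ?XAA.
Qed.

Lemma counting_npoints X A : finite_set (X `&` A) ->
  counting (X `&` A) = (npoints (X `&` A))%:R%:E :> \bar R.
Proof. by move=> f; rewrite /counting; case: asboolP. Qed.

End locally_finite.

Section count_moments.
Context {d : measure_display} {T : measurableType d} {R : realType}.
Variables (P : probability T R) (Xi : T -> set (R * R)).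
Hypothesis ppXi : point_process Xi.
Implicit Types A : set (R * R).

Let fin t A : bounded_set A -> finite_set (Xi t `&` A).
Proof. by apply: bounded_no_limit_point_finite; case: ppXi. Qed.

Definition cnt (A : set (R * R)) (t : T) : R := (npoints (Xi t `&` A))%:R.

Lemma measurable_cnt A : measurable A -> bounded_set A -> measurable_fun setT (cnt A).
Proof.
move=> mA bA _ B mB; rewrite setTI.
have -> : cnt A @^-1` B = \bigcup_n
   (if (n%:R : R) \in B then [set t | npoints (Xi t `&` A) = n] else set0).
  apply/seteqP; split => [t|t [n _]].
    by rewrite /cnt /= => Bt; exists (npoints (Xi t `&` A)) => //; rewrite ifT // inE.
  by case: ifPn => //; rewrite inE /cnt /= => h ->.
apply: bigcupT_measurable => n; case: ifP => // _.
have [mXi _] := ppXi.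
have -> : [set t | npoints (Xi t `&` A) = n] =
    setT `&` (Xi @^-1` [set X : config R | counting (X `&` A) = n%:R%:E :> \bar R]).
  apply/seteqP; split => t /=.
    by move=> <-; split => //; rewrite counting_npoints //; exact: fin.
  move=> [_]; rewrite counting_npoints; last exact: fin.
  by move=> [/eqP]; rewrite eqr_nat => /eqP.
apply: mXi => //; apply: sub_sigma_algebra; exists A, (n%:R%:E : \bar R); split => //.
Qed.

Lemma integral_cnt A (c1 : R) :
  (forall f : R * R -> \bar R, measurable_fun setT f -> (forall x, 0 <= f x)%E ->
      (\int[P]_t (\esum_(x in Xi t) f x) = c1%:E * \int[leb2]_x f x)%E) ->
  measurable A -> bounded_set A ->
  (\int[P]_t (cnt A t)%:E = c1%:E * leb2 A)%E.
Proof.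
move=> hom mA bA.
have := hom (EFin \o \1_A); rewrite integral_indic // setIT => <- //.
- by apply: eq_integral => t _; rewrite esum_indic_npoints //; exact: fin.
- exact/measurable_EFinP.
- by move=> x; rewrite lee_fin.
Qed.

Lemma test_function_indic A : measurable A -> bounded_set A ->
  test_function (\1_A : R * R -> R).
Proof.
move=> mA bA; split => //.
- exists 1; split => // x x1 y _ /=; rewrite ger0_norm // (le_trans _ (ltW x1)) //.
- have -> : [set x | \1_A x != 0 :> R] = A; last exact: bA.
  apply/seteqP; split => x /=; rewrite indicE.
    by case: (boolP (x \in A)) => [|_]; rewrite ?inE // eqxx.
  by move=> Ax; rewrite mem_set // oner_eq0.
Qed.

(** Homogeneity identifies the mean, so the variance in the spectral formula is the mean square
    about [c1 * fine (leb2 A)]. *)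
Lemma variance_cnt A (c1 : R) (S : {measure set (R * R)%type -> \bar R}) :
  (forall f : R * R -> \bar R, measurable_fun setT f -> (forall x, 0 <= f x)%E ->
      (\int[P]_t (\esum_(x in Xi t) f x) = c1%:E * \int[leb2]_x f x)%E) ->
  spectral_measure P Xi S -> measurable A -> bounded_set A ->
  (\int[P]_t ((cnt A t - c1 * fine (leb2 A)) ^+ 2)%:E =
   \int[S]_xi (normsq (fourier (\1_A : R * R -> R) xi))%:E)%E.
Proof.
move=> hom spS mA bA; rewrite -(spS _ (test_function_indic _ mA bA)).
have -> : (fun t => \sum_(x \in Xi t) (\1_A x : R)) = cnt A.
  by apply/funext => t; rewrite sum_indic_npoints //; exact: fin.
rewrite /variance covariance.unlock !expectation.unlock.
have -> : (\int[P]_t (cnt A t)%:E)%E = (c1 * fine (leb2 A))%:E.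
  by rewrite (integral_cnt _ _ hom) // EFinM fineK // leb2_fin.
by apply: eq_integral => t _; rewrite /= expr2.
Qed.

End count_moments.

Definition square {R : realType} (a b l : R) : set (R * R) :=
  `[a, (a + l)%R[ `*` `[b, (b + l)%R[.

(** * Variance bounds from the spectral measure *)

Section spectral_bounds.
Context {d : measure_display} {T : measurableType d} {R : realType}.
Variables (P : probability T R) (Xi : T -> set (R * R)).

(* What types I, II and III share; the bound r `^ alpha need not be sharp. *)
Definition spectral_gap (S : {measure set (R * R)%type -> \bar R}) (M K alpha r0 : R) :=
  [/\ 0 < M, 0 < K, 0 < alpha, 0 < r0 &
   (forall A : set (R * R), measurable A -> (S A <= M%:E * leb2 A)%E) /\
   (forall (A : set (R * R)) (r : R), measurable A -> 0 < r -> r <= r0 ->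
      A `<=` [set w | `|w.1| < r /\ `|w.2| < r] ->
      (S A <= (K * r `^ alpha)%:E * leb2 A)%E)].

Lemma density_measure_le (S : {measure set (R * R)%type -> \bar R}) (s : R * R -> R)
    (A : set (R * R)) (k : R) :
  (forall w, 0 <= s w) -> 0 <= k ->
  (forall A, measurable A -> (S A = \int[leb2]_(w in A) (s w)%:E)%E) ->
  measurable A -> (forall w, A w -> s w <= k) -> (S A <= k%:E * leb2 A)%E.
Proof.
move=> s0 k0 SE mA sk; rewrite SE //.
have <- : (\int[leb2]_(w in A) cst k%:E w = k%:E * leb2 A)%E by rewrite integral_cst.
apply: ge0_le_integral_any => w Aw; first by rewrite lee_fin.
by rewrite lee_fin sk.
Qed.

Lemma enorm_le (w : R * R) r : 0 <= r -> `|w.1| <= r -> `|w.2| <= r -> enorm w <= 2 * r.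
Proof.
move=> r0; rewrite !ler_norml => /andP[h1 h2] /andP[h3 h4].
rewrite -(ger0_norm (mulr_ge0 (ler0n _ 2) r0)) -sqrtr_sqr /enorm ler_wsqrtr //.
by rewrite /dotp; nra.
Qed.

Lemma enorm_ge0 (w : R * R) : 0 <= enorm w.
Proof. exact: sqrtr_ge0. Qed.

Lemma type_spectral_gap : type_I P Xi \/ type_II P Xi \/ type_III P Xi ->
  exists S M K alpha r0, spectral_measure P Xi S /\ spectral_gap S M K alpha r0.
Proof.
have H s c alpha : structure_factor P Xi s -> 0 < alpha -> origin_behaviour s c alpha ->
    exists S M K alpha r0, spectral_measure P Xi S /\ spectral_gap S M K alpha r0.
  move=> [s0 [M0 [_ sM]] _ [S spS SE]] al0 orig.
  have M00 : 0 < `|M0| + 1 by rewrite ltr_wpDl.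
  have sM' w : s w <= `|M0| + 1.
    have := sM (`|M0| + 1); rewrite (le_lt_trans (ler_norm _)) ?ltrDl // => /(_ isT w I).
    exact: le_trans (ler_norm _).
  have /eqaddoP /(_ 1 ltr01) /nbhs_ballP [e /= e0 He] := orig.
  exists S, (`|M0| + 1), ((`|c| + 1) * 2 `^ alpha), alpha, e; split => //.
  split => //.
  split=> [A mA|A r mA r0 re Ar].
    by apply: density_measure_le SE _ _ => //; exact: ltW.
  apply: density_measure_le SE mA _ => //.
    by rewrite mulr_ge0 ?powR_ge0 // mulr_ge0 ?powR_ge0 // addr_ge0.
  move=> w /Ar /= [w1 w2].
  have /He /= : ball (0 : R * R) e w.
    by split; rewrite /ball /= sub0r normrN; [apply: lt_le_trans w1 _|apply: lt_le_trans w2 _].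
  rewrite mul1r !fctE => hw.
  have en : enorm w `^ alpha <= 2 `^ alpha * r `^ alpha.
    rewrite -powRM ?(ltW r0) // ge0_ler_powR ?nnegrE ?enorm_ge0 ?mulr_ge0 ?(ltW r0) ?(ltW al0) //.
    by apply: enorm_le; rewrite ltW.
  have e0' : 0 <= enorm w `^ alpha := powR_ge0 _ _.
  rewrite -mulrA (@le_trans _ _ ((`|c| + 1) * enorm w `^ alpha)) //; last first.
    by rewrite ler_wpM2l // addr_ge0.
  move: hw; rewrite (ger0_norm e0') => /ler_normlP [_ hw].
  have : c * enorm w `^ alpha <= `|c| * enorm w `^ alpha by rewrite ler_wpM2r // ler_norm.
  lra.
case=> [[s [c [alpha [? a1 ?]]]]|[[s [c [? ?]]]|[s [c [alpha [? ? ? ?]]]]]].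
- by apply: (H s c alpha) => //; exact: lt_trans a1.
- exact: (H s c 1).
- exact: (H s c alpha).
Qed.

Section variance_bounds.
Variables (c1 : R) (S : {measure set (R * R)%type -> \bar R}) (M K alpha r0 : R).
Hypothesis ppXi : point_process Xi.
Hypothesis hom : forall f : R * R -> \bar R, measurable_fun setT f ->
  (forall x, 0 <= f x)%E ->
  (\int[P]_t (\esum_(x in Xi t) f x) = c1%:E * \int[leb2]_x f x)%E.
Hypothesis spS : spectral_measure P Xi S.
Hypothesis gap : spectral_gap S M K alpha r0.

Let h_ge0 (A : set (R * R)) xi : (0 <= (normsq (fourier (\1_A : R * R -> R) xi))%:E)%E.
Proof. by rewrite lee_fin /normsq addr_ge0 ?sqr_ge0. Qed.

Lemma variance_cnt_le (A : set (R * R)) : measurable A -> bounded_set A ->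
  (\int[P]_t ((cnt Xi A t - c1 * fine (leb2 A)) ^+ 2)%:E <=
   (144 * M * fine (leb2 A))%:E)%E.
Proof.
move=> mA bA; have [M0 _ _ _ [SM _]] := gap.
have fA := leb2_fin _ mA bA.
have Aoo : (leb2 A < +oo)%E by rewrite -ge0_fin_numE.
rewrite (variance_cnt P Xi ppXi A c1 S) //.
apply: (@le_trans _ _ (M%:E * (144%:E * leb2 A))%E); last first.
  by rewrite -(fineK fA) -!EFinM lee_fin /= mulrA (mulrC M).
apply: (@le_trans _ _ (M%:E * \int[leb2]_xi (normsq (fourier (\1_A : R * R -> R) xi))%:E)%E).
  apply: le_measure_integral_on => //; first exact: ltW.
    by move=> B mB _; exact: SM.
  by apply/measurable_EFinP; exact: measurable_normsq_fourier.
by apply: lee_wpmul2l; [rewrite lee_fin ltW|exact: bessel_indic].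
Qed.

(** Frequencies are split at r: in the box the density is at most [K] times the power alpha of r and
    Bessel's inequality applies, outside it is at most M and the Fourier tail of the square has mass
    [24 * l / r]. The split r stays free, to be matched to l. *)
Lemma variance_square_le0 a b l r : 0 < l -> 0 < r -> r <= r0 ->
  (\int[P]_t ((cnt Xi (square a b l) t - c1 * l ^+ 2) ^+ 2)%:E <=
   (144 * K * r `^ alpha * l ^+ 2 + 24 * M * l / r)%:E)%E.
Proof.
set Q := square a b l; move=> l0 rp rr0; have [M0 K0 al0 _ [SM SK]] := gap.
have mQ : measurable Q by exact: measurable_rect.
have bQ : bounded_set Q by exact: rect_bounded.
have Ql : leb2 Q = (l ^+ 2)%:E.
  by rewrite /Q leb2_rect ?lerDl ?(ltW l0) //; congr EFin; ring.
have Qoo : (leb2 Q < +oo)%E by rewrite Ql ltry.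
have := variance_cnt P Xi ppXi Q c1 S hom spS mQ bQ; rewrite Ql /= => ->.
pose h xi := (normsq (fourier (\1_Q : R * R -> R) xi))%:E.
have mh : measurable_fun setT h.
  by apply/measurable_EFinP; exact: measurable_normsq_fourier.
pose D : set (R * R) := `](- r)%R, r[ `*` `](- r)%R, r[.
have mD : measurable D by apply: measurableX; exact: measurable_itv.
have Dr : D `<=` [set w | `|w.1| < r /\ `|w.2| < r].
  by move=> w [] /=; rewrite !in_itv /= -!ltr_norml.
rewrite -(setvU D) setUC ge0_integral_setU //; last 3 first.
- exact: measurableC.
- by rewrite setUv.
- by apply/disj_setPS; rewrite setICr.
rewrite EFinD; apply: leeD.
- apply: (@le_trans _ _ ((K * r `^ alpha)%:E * \int[leb2]_(xi in D) h xi)%E).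
    apply: le_measure_integral_on => //.
      by rewrite mulr_ge0 ?powR_ge0 // ltW.
    by move=> A mA AD; apply: SK => //; exact: subset_trans AD Dr.
  apply: (@le_trans _ _ ((K * r `^ alpha)%:E * (144%:E * (l ^+ 2)%:E))%E).
    apply: lee_wpmul2l; first by rewrite lee_fin mulr_ge0 ?powR_ge0 // ltW.
    rewrite -Ql; apply: le_trans (bessel_indic Q mQ Qoo).
    by apply: ge0_subset_integral => // x _; exact: h_ge0.
  by rewrite -!EFinM lee_fin; lra.
apply: (@le_trans _ _ (M%:E * \int[leb2]_xi (fourier_tail l r xi)%:E)%E).
  apply: (@le_trans _ _ (\int[S]_xi (fourier_tail l r xi)%:E)%E).
    rewrite (integral_mkcond (~` D)); apply: ge0_le_integral_any => x _.
      by apply: erestrict_ge0 => ? _; exact: h_ge0.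
    rewrite patchE; case: ifPn => [|_]; last by rewrite lee_fin fourier_tail_ge0.
    rewrite inE => Dx; rewrite lee_fin; apply: normsq_fourier_tail => //.
    by move=> [x1 x2]; apply: Dx; split; rewrite /= in_itv /= -ltr_norml.
  apply: le_measure_integral_on => //; first exact: ltW.
  + by move=> A mA _; exact: SM.
  + by move=> x; rewrite lee_fin fourier_tail_ge0.
  + by apply/measurable_EFinP; exact: measurable_fourier_tail.
by rewrite integral_fourier_tail // -EFinM lee_fin; lra.
Qed.

(** The gain is the power [g / 2] of the side, where g is the minimum of alpha and 1: the corners
    and edges of a square allow no more than the exponent 1 in this argument. The factor u lets the
    finest cells have any side between 1 and 2. *)
Lemma variance_square_le : exists C q : R, [/\ 0 < C, 0 < q, q < 1 &
  forall (m : nat) (u a b : R), 1 <= u -> u <= 2 ->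
  (\int[P]_t ((cnt Xi (square a b (2 ^+ m * u)) t - c1 * (2 ^+ m * u) ^+ 2) ^+ 2)%:E <= (C * 4 ^+ m * q ^+ m)%:E)%E].
Proof.
have [M0 K0 al0 rp _] := gap.
pose g := Num.min alpha 1.
have g0 : 0 < g by rewrite lt_min al0 ltr01.
pose q : R := 2 `^ (- (g / 2)).
have q0 : 0 < q by rewrite powR_gt0.
have q1 : q < 1.
  have g20 : 0 < g / 2 by rewrite divr_gt0.
  rewrite /q powRN invf_lt1 ?powR_gt0 //.
  have : 1 `^ (g / 2) < 2 `^ (g / 2) :> R.
    by apply: gt0_ltr_powR; rewrite ?nnegrE // ltr1n.
  by rewrite powR1.
have [k k0 [Hk1 Hk2]] : exists2 k : R, 0 < k &
    (forall a b l r, 0 < l -> 0 < r -> r <= r0 ->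
      (\int[P]_t ((cnt Xi (square a b l) t - c1 * l ^+ 2) ^+ 2)%:E <=
       (k * (r `^ alpha * l ^+ 2 + l / r))%:E)%E) /\
    (forall A : set (R * R), measurable A -> bounded_set A ->
      (\int[P]_t ((cnt Xi A t - c1 * fine (leb2 A)) ^+ 2)%:E <=
       (k * fine (leb2 A))%:E)%E).
  pose k := Num.max (144 * K) (144 * M).
  have kK : 144 * K <= k by rewrite le_max lexx.
  have kM : 144 * M <= k by rewrite le_max lexx orbT.
  exists k; first by apply: lt_le_trans kK; rewrite mulr_gt0.
  split=> [a b l r l0 r_gt0 rr0|A mA bA].
    apply: (le_trans (variance_square_le0 _ _ _ _ l0 r_gt0 rr0)).
    rewrite lee_fin mulrDr -(mulrA (144 * K)) -(mulrA (24 * M)); apply: lerD.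
      by rewrite ler_wpM2r // mulr_ge0 ?powR_ge0 ?sqr_ge0.
    rewrite ler_wpM2r ?divr_ge0 ?(ltW l0) ?(ltW r_gt0) // (le_trans _ kM) //.
    by rewrite ler_wpM2r ?(ltW M0) // ler_nat.
  apply: (le_trans (variance_cnt_le _ mA bA)).
  by rewrite lee_fin ler_wpM2r // fine_ge0.
have r0g0 : 0 < r0 `^ g by rewrite powR_gt0.
exists (4 * (2 * k + k / r0 `^ g)), q; split => //.
  by rewrite mulr_gt0 // addr_gt0 ?divr_gt0 ?mulr_gt0.
move=> m u a b u1 u2; set l := 2 ^+ m * u.
have u0 : 0 < u by exact: lt_le_trans u1.
have l0 : 0 < l by rewrite mulr_gt0 // exprn_gt0.
have m1 : 1 <= 2 ^+ m :> R by rewrite exprn_ege1 // ler1n.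
have l1 : 1 <= l by rewrite /l mulr_ege1.
(* With [r * r = l^-1] the tail [l / r] equals [l ^+ 2 * r], so both terms are at most [l ^+ 2]
   times the power g of r. *)
pose r := l `^ (- 2^-1).
have r_gt0 : 0 < r by rewrite powR_gt0.
have r1 : r <= 1.
  have h : - 2^-1 <= 0 :> R by lra.
  by have := ler_powR l1 h; rewrite powRr0.
have rl : l / r = l ^+ 2 * r.
  have hrr : r * r = l^-1.
    rewrite /r -powRD; last by rewrite (gt_eqF l0) implybT.
    have -> : - 2^-1 + - 2^-1 = - 1 :> R by lra.
    by rewrite powR_inv1 // ltW.
  have hr : l * r * r = 1 by rewrite -mulrA hrr divff // gt_eqF.
  have E : l ^+ 2 * r * r = l by rewrite -[RHS]mulr1 -hr; ring.
  by rewrite -{1}E mulfK // gt_eqF.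
have rg : r `^ g <= q ^+ m.
  have -> : q ^+ m = (2 ^+ m) `^ (- (2^-1 * g)).
    rewrite /q -(powR_mulrn m (powR_ge0 2 _)) -(powR_mulrn m (ler0n _ 2)) -!powRrM.
    by congr (_ `^ _); ring.
  rewrite /r -powRrM mulNr !powRN lef_pV2 ?posrE ?powR_gt0 ?exprn_gt0 //.
  apply: ge0_ler_powR; rewrite ?nnegrE ?exprn_ge0 ?(ltW l0) // ?mulr_ge0 ?(ltW g0) //.
  by rewrite /l ler_peMr // exprn_ge0.
have l2 : l ^+ 2 <= 4 * 4 ^+ m.
  have -> : 4 ^+ m = (2 ^+ m) ^+ 2 :> R by rewrite exprAC; congr (_ ^+ m); ring.
  have u4 : u ^+ 2 <= 4.
    by rewrite (_ : 4 = 2 ^+ 2 :> R) ?lerXn2r ?nnegrE ?(ltW u0) //; ring.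
  by rewrite /l exprMn mulrC ler_wpM2r ?sqr_ge0.
have rgl : l ^+ 2 * r `^ g <= 4 * 4 ^+ m * q ^+ m.
  by rewrite ler_pM ?sqr_ge0 ?powR_ge0.
have kr0 : 0 <= k / r0 `^ g by rewrite divr_ge0 // ltW.
suff /le_trans : (\int[P]_t ((cnt Xi (square a b l) t - c1 * l ^+ 2) ^+ 2)%:E <=
    ((2 * k + k / r0 `^ g) * (l ^+ 2 * r `^ g))%:E)%E.
  apply; rewrite lee_fin; move: rgl; set y := 2 * k + _; set z := l ^+ 2 * _ => rgl.
  have y0 : 0 <= y by rewrite addr_ge0 // mulr_ge0 // ltW.
  have -> : 4 * y * 4 ^+ m * q ^+ m = y * (4 * 4 ^+ m * q ^+ m) by ring.
  by rewrite ler_wpM2l.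
have [rr0|rr0] := leP r r0.
  apply: (le_trans (Hk1 a b _ _ l0 r_gt0 rr0)).
  rewrite lee_fin rl.
  have ra : r `^ alpha <= r `^ g.
    by apply: ger_powR; rewrite ?r_gt0 ?r1 // ge_min lexx.
  have r1g : r <= r `^ g.
    by rewrite -{1}(powRr1 (ltW r_gt0)); apply: ger_powR; rewrite ?r_gt0 ?r1 // ge_min lexx orbT.
  apply: (@le_trans _ _ (k * (2 * (l ^+ 2 * r `^ g)))).
    rewrite ler_wpM2l ?(ltW k0) // [2 * _]mulr_natl mulr2n.
    by apply: lerD; rewrite ?(mulrC (r `^ alpha)) ler_wpM2l ?sqr_ge0.
  rewrite mulrA [k * 2]mulrC ler_wpM2r ?lerDl //.
  by rewrite mulr_ge0 ?powR_ge0 ?sqr_ge0.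
(* In the remaining case [r0 < r] the side l is bounded, and the plain variance bound suffices after
   division by the power g of [r0]. *)
have Ql : fine (leb2 (square a b l)) = l ^+ 2.
  by rewrite /square leb2_rect ?lerDl ?(ltW l0) //=; ring.
have := Hk2 (square a b l) (measurable_rect _ _ _ _) (rect_bounded _ _ _ _).
rewrite Ql => /le_trans; apply; rewrite lee_fin.
have r0g : r0 `^ g <= r `^ g.
  by apply: ge0_ler_powR; rewrite ?nnegrE ?(ltW g0) ?(ltW rp) ?(ltW r_gt0) // ltW.
apply: (@le_trans _ _ (k / r0 `^ g * (l ^+ 2 * r `^ g))).
  rewrite -mulrA ler_wpM2l ?(ltW k0) // mulrCA ler_peMr ?sqr_ge0 //.
  by rewrite ler_pdivlMl // mulr1.
rewrite ler_wpM2r //; last by rewrite lerDr mulr_ge0 // ltW.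
by rewrite mulr_ge0 ?powR_ge0 ?sqr_ge0.
Qed.

End variance_bounds.

End spectral_bounds.

(** * From finite couplings to the Wasserstein distance *)

Lemma exists_measure_sum {d} {T : measurableType d} {R : realType} {I : Type}
    (r : seq I) (m : I -> {measure set T -> \bar R}) :
  exists p : {measure set T -> \bar R},
    (forall E, p E = \sum_(i <- r) m i E)%E /\
    (forall f : T -> \bar R, (forall x, 0 <= f x)%E -> measurable_fun setT f ->
       \int[p]_x f x = \sum_(i <- r) \int[m i]_x f x)%E.
Proof.
(* Indices beyond the length of the list receive the zero measure and are never summed. *)
pose m' k : {measure set T -> \bar R} :=
  if insub k : option 'I_(size r) is Some i then m (tnth (in_tuple r) i) else mzero.
exists (msum m' (size r)); split=> [E|f f0 mf].
  rewrite /msum /= [RHS]big_tnth; apply: eq_bigr => i _.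
  by rewrite /m' valK.
rewrite (ge0_integral_measure_sum m') // [RHS]big_tnth; apply: eq_bigr => i _.
by rewrite /m' valK.
Qed.

Lemma integral_mrestr_le {d} {T : measurableType d} {R : realType}
    (mu : {measure set T -> \bar R}) (A : set T) (mA : measurable A)
    (f : T -> \bar R) (c : R) : (forall x, 0 <= f x)%E -> measurable_fun setT f ->
  (forall x, A x -> f x <= c%:E)%E ->
  (\int[mrestr mu mA]_x f x <= c%:E * mu A)%E.
Proof.
move=> f0 mf fc.
have -> : (\int[mrestr mu mA]_x f x = \int[mrestr mu mA]_(x in A) f x)%E.
  rewrite -(setvU A) setUC ge0_integral_setU //; last 3 first.
  - exact: measurableC.
  - by rewrite setUv.
  - by apply/disj_setPS; rewrite setICr.
  rewrite [X in (_ + X)%E]null_set_integral ?adde0 //.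
  - exact: measurableC.
  - exact: measurable_funTS.
  - by rewrite /= /mrestr setICl measure0.
rewrite (eq_measure_integral mu); last first.
  by move=> E mE EA; rewrite /= /mrestr setIidl.
rewrite -(integral_cst mu mA c%:E); exact: ge0_le_integral_any.
Qed.

Lemma measure_fin_partition {d} {T : measurableType d} {R : realType} {B : finType}
    (mu : {measure set T -> \bar R}) (A : B -> set T) (U : set T) :
  (forall b, measurable (A b)) -> (forall b b' x, A b x -> A b' x -> b = b') ->
  (forall x, U x <-> exists b, A b x) -> mu U = (\sum_b mu (A b))%E.
Proof.
move=> mA dA cU.
have H r : uniq r -> mu (\big[setU/set0]_(b <- r) A b) = (\sum_(b <- r) mu (A b))%E.
  elim: r => [_|b r IH /= /andP[br ur]]; first by rewrite !big_nil measure0.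
  have dis : A b `&` \big[setU/set0]_(b <- r) A b = set0.
    apply/seteqP; split => // x [Ab]; rewrite -bigcup_seq => -[b' /= b'r Ab'].
    by move: br; rewrite (dA _ _ _ Ab Ab') b'r.
  have mU : measurable (\big[setU/set0]_(b <- r) A b) by exact: bigsetU_measurable.
  rewrite !big_cons -IH //.
  exact: measureU.
rewrite -[RHS]big_enum -H ?enum_uniq //; congr (mu _); rewrite -bigcup_seq.
apply/seteqP; split => x; first by move=> /cU [b Ab]; exists b => //=; rewrite mem_enum.
by move=> [b _ Ab]; apply/cU; exists b.
Qed.

Section finite_coupling_to_W2.
Context {R : realType} {B : finType}.
Variables (Om X : set (R * R)) (A : B -> set (R * R)).
Variables (p : B -> R * R) (h : R) (pi : B -> B -> R).
Hypothesis mOm : measurable Om.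
Hypothesis Om0 : 0 < fine (leb2 Om).
Hypothesis Omoo : (leb2 Om < +oo)%E.
Hypothesis finX : finite_set X.
Hypothesis XOm : X `<=` Om.
Hypothesis X0 : npoints X != 0%N.
Hypothesis mA : forall b, measurable (A b).
Hypothesis A_disj : forall b b' x, A b x -> A b' x -> b = b'.
Hypothesis A_cover : forall x, Om x <-> exists b, A b x.
Hypothesis A_near : forall b x, A b x -> `|x - p b| <= h.
Let nu b := fine (leb2 (A b)) / fine (leb2 Om).
Let v b : R := (npoints (X `&` A b))%:R / (npoints X)%:R.
Hypothesis nu0 : forall b, 0 < nu b.
Hypothesis cpi : fcoupling nu v pi.

Let N : R := (npoints X)%:R.
Let N0 : 0 < N. Proof. by rewrite ltr0n lt0n. Qed.
Let s := fset_set X : seq (R * R).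

Let AOm b : A b `<=` Om. Proof. by move=> x Ax; apply/A_cover; exists b. Qed.

Let Afin b : leb2 (A b) \is a fin_num.
Proof.
rewrite ge0_fin_numE // (le_lt_trans _ Omoo) //.
by apply: le_measure; rewrite ?inE.
Qed.

Let pi0 b b' : 0 <= pi b b'. Proof. by case: cpi. Qed.

Let v_ge0 b : 0 <= v b. Proof. by rewrite divr_ge0. Qed.

(** A block without points receives no mass, which settles the terms where a quotient by [v b'] has
    the default value 0. *)
Let pi_v0 b b' : v b' = 0 -> pi b b' = 0.
Proof.
have [_ _ <-] := cpi => /eqP; rewrite psumr_eq0 => [|b1 _ //].
by move=> /allP /(_ b (mem_index_enum _)) /= /eqP.
Qed.

Let s_X x : x \in s -> X x.
Proof. by rewrite in_fset_set // inE. Qed.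

Let block_of : exists bf : R * R -> B, forall x, Om x -> A (bf x) x.
Proof.
have [x0 Xx0] : X !=set0.
  by apply/set0P; apply: contraNneq X0 => ->; rewrite /npoints fset_set0 cardfs0.
have [b0 _] := (A_cover x0).1 (XOm _ Xx0).
have H x : exists b, Om x -> A b x.
  have [/A_cover [b Ab]|nOm] := pselect (Om x); first by exists b.
  by exists b0.
by have [f Hf] := choice H; exists f.
Qed.

(** The mass [pi b b'] is spread uniformly over [A b] on the continuous side and shared equally
    among the points of [A b'] on the discrete side; replacing points by the centres [p] costs [h]
    at either end. *)
Lemma W2_finite_le (c : R) : 3 * fcost p pi + 12 * h ^+ 2 <= c ->
  (W2 (empirical X) (uniform_on Om) <= (Num.sqrt c)%:E)%E.
Proof.
move=> hc.
have [bf Abf] := block_of.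
have sum_s (G : B -> R) :
    \sum_(x <- s) G (bf x) = \sum_b (npoints (X `&` A b))%:R * G b.
  transitivity (\sum_(x <- s) \sum_b (bf x == b)%:R * G b).
    apply: eq_bigr => x _; rewrite (bigD1 (bf x)) //= eqxx mul1r big1 ?addr0 //.
    by move=> b /negbTE; rewrite eq_sym => ->; rewrite mul0r.
  rewrite exchange_big; apply: eq_bigr => b _ /=; rewrite -mulr_suml; congr (_ * _).
  rewrite -sum_indic_npoints; last exact: sub_finite_set finX.
  rewrite fsbig_finite //=; apply: eq_big_seq => x /s_X /XOm /Abf Ax.
  rewrite indicE; congr ((nat_of_bool _)%:R).
  apply/idP/idP => [/eqP <-|]; first by rewrite mem_set.
  by rewrite inE => Abx; apply/eqP; exact: A_disj Ax Abx.
have mpair (x : R * R) : measurable_fun setT (fun y : R * R => (x, y)).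
  exact: pair1_measurable.
(* Chosen so that [w (x, b)] times the area of [A b] is [pi b (bf x)] divided by the number of
   points in the block of x. *)
pose w (i : (R * R) * B) : R :=
  pi i.2 (bf i.1) / (nu i.2 * v (bf i.1) * N * fine (leb2 Om)).
have w0 i : 0 <= w i.
  apply: divr_ge0; first exact: pi0.
  apply: mulr_ge0; last exact: ltW.
  apply: mulr_ge0; last exact: ltW.
  by apply: mulr_ge0; [exact/ltW/nu0|exact: v_ge0].
pose m (i : (R * R) * B) : {measure set ((R * R) * (R * R)) -> \bar R} :=
  mscale (NngNum (w0 i)) (pushm (mrestr leb2 (mA i.2)) (mpair i.1)).
pose r := [seq (x, b) | x <- s, b <- enum B].
have [P [PE Pint]] := exists_measure_sum r m.
have mE (i : (R * R) * B) (E : set ((R * R) * (R * R))) :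
  m i E = ((w i)%:E * leb2 ([set y | E (i.1, y)] `&` A i.2))%E by [].
have sumr (G : (R * R) * B -> \bar R) :
    (\sum_(i <- r) G i = \sum_(x <- s) \sum_b G (x, b))%E.
  by rewrite big_allpairs; apply: eq_bigr => x _; rewrite big_enum.
have Nne : N != 0 by rewrite gt_eqF.
have Omne : fine (leb2 Om) != 0 by rewrite gt_eqF.
have nune b : nu b != 0 by rewrite gt_eqF.
have lebA b : leb2 (A b) = (nu b * fine (leb2 Om))%:E.
  by rewrite /nu divfK // fineK.
have vN b : (npoints (X `&` A b))%:R = v b * N by rewrite /v divfK.
have v_bf x : Om x -> X x -> v (bf x) != 0.
  move=> Omx Xx; rewrite /v mulf_neq0 ?invr_eq0 // pnatr_eq0 /npoints cardfs_eq0.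
  apply/eqP => /(congr1 (fun S : {fset _} => x \in S)); rewrite in_fset0.
  rewrite in_fset_set; last exact: sub_finite_set finX.
  by rewrite mem_set //; split => //; exact: Abf.
have cplP : coupling (empirical X) (uniform_on Om) P.
  split=> E mE'.
  - rewrite PE sumr /empirical fsbig_finite //= -/s ge0_sume_distrr; last by [].
    apply: eq_big_seq => x sx; have Xx := s_X _ sx; have Omx := XOm _ Xx.
    transitivity (\sum_b (pi b (bf x) / (v (bf x) * N) * \1_E x)%:E)%E.
      apply: eq_bigr => b _; rewrite mE /= /w /= indicE.
      have [xE|xE] := boolP (x \in E).
        have -> : [set y | (E `*` setT) (x, y)] `&` A b = A b.
          apply/seteqP; split => y /=; first by case.
          by move=> Ay; split => //; split => //=; move: xE; rewrite inE.
        rewrite lebA -EFinM; congr EFin; rewrite mulr1.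
        by field; rewrite Nne Omne nune v_bf.
      have -> : [set y | (E `*` setT) (x, y)] `&` A b = set0.
        by apply/seteqP; split => y // [[]] /=; move: xE; rewrite notin_setE.
      by rewrite measure0 mule0 mulr0.
    rewrite sumEFin -mulr_suml -mulr_suml; have [_ _ ->] := cpi.
    rewrite diracE -EFinM; congr EFin; rewrite indicE.
    by field; rewrite Nne v_bf.
  - rewrite PE sumr /uniform_on.
    have H b : (\sum_(x <- s) m (x, b) (setT `*` E))%E =
       ((fine (leb2 Om))^-1 * fine (leb2 (E `&` A b)))%:E.
      under eq_bigr => x _.
        rewrite mE /=.
        have -> : [set y | (setT `*` E) (x, y)] `&` A b = E `&` A b.
          apply/seteqP; split => y /=; first by move=> [[]].
          by move=> [].
        have fE : leb2 (E `&` A b) \is a fin_num.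
          rewrite ge0_fin_numE // (@le_lt_trans _ _ (leb2 (A b))) -?ge0_fin_numE //.
          by apply: le_measure; rewrite ?inE //; exact: measurableI.
        rewrite -(fineK fE) -EFinM /=.
        over.
      rewrite sumEFin -mulr_suml; congr EFin; congr (_ * _).
      rewrite (sum_s (fun b' => pi b b' / (nu b * v b' * N * fine (leb2 Om)))).
      transitivity (\sum_b' pi b b' / (nu b * fine (leb2 Om))).
        apply: eq_bigr => b' _; rewrite vN.
        have [v0|v0] := eqVneq (v b') 0; first by rewrite (pi_v0 _ _ v0) !mul0r mulr0.
        by field; rewrite Nne Omne nune v0.
      rewrite -mulr_suml; have [_ -> _] := cpi.
      by field; rewrite Omne nune.
    rewrite exchange_big /=; under eq_bigr do rewrite H EFinM.
    rewrite -ge0_sume_distrr; last by move=> b _; rewrite lee_fin fine_ge0.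
    congr (_ * _)%E.
    rewrite (measure_fin_partition leb2 (fun b => E `&` A b) (E `&` Om)); last 3 first.
    - by move=> b; exact: measurableI.
    - by move=> b b' x [_ Ab] [_ Ab']; exact: A_disj Ab Ab'.
    - move=> x; split => [[Ex /A_cover [b Ab]]|[b [Ex Ab]]]; first by exists b.
      by split => //; exact: AOm Ab.
    apply: eq_bigr => b _; rewrite fineK //.
    rewrite ge0_fin_numE // (@le_lt_trans _ _ (leb2 (A b))) -?ge0_fin_numE //.
    by apply: le_measure; rewrite ?inE //; exact: measurableI.
have c0 : 0 <= c.
  apply: (le_trans _ hc); apply: addr_ge0; apply: mulr_ge0 => //; last exact: sqr_ge0.
  apply: addr_ge0; apply: sumr_ge0 => b _; apply: sumr_ge0 => b' _;
    by apply: mulr_ge0; [exact: pi0|exact: sqr_ge0].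
have costP : (\int[P]_z (enorm (z.1 - z.2) ^+ 2)%:E <= c%:E)%E.
  have en (z : (R * R) * (R * R)) : enorm (z.1 - z.2) ^+ 2 =
      (z.1.1 - z.2.1) ^+ 2 + (z.1.2 - z.2.2) ^+ 2.
    by rewrite /enorm /dotp sqr_sqrtr ?addr_ge0 -?expr2 ?sqr_ge0.
  pose f (z : (R * R) * (R * R)) : \bar R := (enorm (z.1 - z.2) ^+ 2)%:E.
  have f0 z : (0 <= f z)%E by rewrite lee_fin sqr_ge0.
  have mf : measurable_fun setT f.
    apply/measurable_EFinP; rewrite (_ : (fun z => _) = fun z : (R * R) * (R * R) =>
      (z.1.1 - z.2.1) ^+ 2 + (z.1.2 - z.2.2) ^+ 2); last by apply/funext => z; rewrite en.
    apply: measurable_funD; apply: measurable_funX; apply: measurable_funB.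
    - exact: (measurableT_comp measurable_fst measurable_fst).
    - exact: (measurableT_comp measurable_fst measurable_snd).
    - exact: (measurableT_comp measurable_snd measurable_fst).
    - exact: (measurableT_comp measurable_snd measurable_snd).
  (* Each coordinate of [x - y] is a difference of centres plus two errors of size at most [h]. The
     square of a sum of three terms gives 3 and 6, and the two coordinates turn 6 into 12. *)
  pose D b b' := 3 * (((p b).1 - (p b').1) ^+ 2 + ((p b).2 - (p b').2) ^+ 2) + 12 * h ^+ 2.
  have fD b b' x y : A b y -> A b' x -> enorm (x - y) ^+ 2 <= D b b'.
    move=> /A_near + /A_near; rewrite [ `|y - _|]prod_normE [ `|x - _|]prod_normE /= !ge_max.
    rewrite !ler_norml => /andP[/andP[y1 y2] /andP[y3 y4]] /andP[/andP[x1 x2] /andP[x3 x4]].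
    rewrite (en (x, y)) /= /D.
    have H (xx yy a a' : R) : - h <= xx - a' -> xx - a' <= h -> - h <= yy - a -> yy - a <= h ->
      (xx - yy) ^+ 2 <= 3 * (a - a') ^+ 2 + 6 * h ^+ 2.
      move=> g1 g2 g3 g4.
      have e1 : (xx - a') ^+ 2 <= h ^+ 2 by nra.
      have e2 : (yy - a) ^+ 2 <= h ^+ 2 by nra.
      have -> : xx - yy = (xx - a') - (yy - a) - (a - a') by ring.
      have := sqr_ge0 ((xx - a') + (yy - a)); have := sqr_ge0 ((xx - a') + (a - a')).
      have := sqr_ge0 ((yy - a) - (a - a')).
      move: e1 e2; move: (xx - a') (yy - a) (a - a') => {g1 g2 g3 g4} X1 Y1 Z1; nra.
    have := H _ _ _ _ x1 x2 y1 y2; have := H _ _ _ _ x3 x4 y3 y4; lra.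
  rewrite (Pint f f0 mf) sumr.
  apply: (@le_trans _ _ (\sum_(x <- s) \sum_b (pi b (bf x) / (v (bf x) * N) * D b (bf x))%:E)%E).
    rewrite big_seq [leRHS]big_seq; apply: lee_sum => x sx; apply: lee_sum => b _.
    have Xx := s_X _ sx; have Omx := XOm _ Xx.
    rewrite ge0_integral_mscale //=.
    have -> : (\int[pushm (mrestr leb2 (mA b)) (mpair x)]_z f z =
       \int[mrestr leb2 (mA b)]_y f (x, y))%E.
      by have := @ge0_integral_pushforward _ _ _ _ R _ (mpair x) (mrestr leb2 (mA b))
        setT f measurableT mf (fun z _ => f0 z); rewrite preimage_setT.
    apply: (@le_trans _ _ ((w (x, b))%:E * ((D b (bf x))%:E * leb2 (A b)))%E).
      apply: lee_wpmul2l; first by rewrite lee_fin.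
      apply: integral_mrestr_le => //; first exact: (measurableT_comp mf (mpair x)).
      by move=> y Ay; rewrite lee_fin; apply: fD => //; exact: Abf.
    rewrite lebA -!EFinM lee_fin /w /=; rewrite le_eqVlt; apply/orP; left; apply/eqP.
    by field; rewrite Nne Omne nune v_bf.
  under eq_bigr do rewrite sumEFin.
  rewrite sumEFin lee_fin (sum_s (fun b' => \sum_b pi b b' / (v b' * N) * D b b')).
  apply: (le_trans _ hc); rewrite le_eqVlt; apply/orP; left; apply/eqP.
  transitivity (\sum_b' \sum_b pi b b' * D b b').
    apply: eq_bigr => b' _; rewrite mulr_sumr; apply: eq_bigr => b _.
    rewrite vN; have [v0|v0] := eqVneq (v b') 0; first by rewrite (pi_v0 _ _ v0) !mul0r mulr0.
    by field; rewrite Nne v0.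
  rewrite exchange_big /= /fcost /sqcost -big_split /= mulr_sumr.
  have nu1 : \sum_b nu b = 1.
    rewrite -mulr_suml.
    have /(congr1 fine) /= := measure_fin_partition leb2 A Om mA A_disj A_cover.
    rewrite -sum_fine => [<-|b _]; first by rewrite divff.
    exact: Afin.
  have -> : 12 * h ^+ 2 = \sum_b \sum_b' pi b b' * (12 * h ^+ 2).
    under eq_bigr do rewrite -mulr_suml; rewrite -mulr_suml.
    have [_ pl _] := cpi; under eq_bigr do rewrite pl.
    by rewrite nu1 mul1r.
  rewrite -big_split /=; apply: eq_bigr => b _.
  rewrite -big_split mulr_sumr -big_split; apply: eq_bigr => b' _ /=.
  by rewrite /D; ring.
rewrite /W2 -(powR12_sqrt c0) -poweR_EFin; apply: gt0_ler_poweR.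
- by [].
- rewrite in_itv /= leey andbT; apply: le_ereal_inf_tmp => _ [q _ <-].
  by apply: integral_ge0 => z _; rewrite lee_fin sqr_ge0.
- by rewrite in_itv /= leey lee_fin c0.
apply: le_trans costP; apply: ereal_inf_lbound.
by exists P.
Qed.

End finite_coupling_to_W2.

(** * Gauge of a convex set *)

Section gauge.
Context {R : realType} {V : normedModType R}.
Variables (U : set V) (rho R0 : R).
Hypothesis U_conv : forall (x y : V) (t : R), U x -> U y -> 0 <= t -> t <= 1 ->
  U (t *: x + (1 - t) *: y).
Hypothesis rho0 : 0 < rho.
Hypothesis U_ball : forall x, `|x| < rho -> U x.
Hypothesis U_bound : forall x, U x -> `|x| <= R0.

Definition gauge (x : V) : R := inf [set t | 0 < t /\ U (t^-1 *: x)].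

Let U0 : U 0. Proof. by apply: U_ball; rewrite normr0. Qed.

Let R00 : 0 <= R0. Proof. by have := U_bound _ U0; rewrite normr0. Qed.

Let gset_lb x : has_lbound [set t | 0 < t /\ U (t^-1 *: x)].
Proof. by exists 0 => t [/ltW]. Qed.

Lemma gauge_le x t : 0 < t -> U (t^-1 *: x) -> gauge x <= t.
Proof. by move=> t0 Ut; apply: ge_inf => //; split. Qed.

Let gset_big x t : `|x| / rho < t -> 0 < t /\ U (t^-1 *: x).
Proof.
move=> xt; have t0 : 0 < t by rewrite (le_lt_trans _ xt)// divr_ge0// ltW.
split => //; apply: U_ball; rewrite normrZ gtr0_norm ?invr_gt0//.
by rewrite mulrC ltr_pdivrMr // mulrC -ltr_pdivrMr.
Qed.

Lemma gauge_le_norm x : gauge x <= `|x| / rho.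
Proof.
apply/ler_addgt0Pr => e e0.
have [t0 Ut] : 0 < `|x| / rho + e /\ U ((`|x| / rho + e)^-1 *: x).
  by apply: gset_big; rewrite ltrDl.
exact: gauge_le.
Qed.

Lemma gauge_ge0 x : 0 <= gauge x.
Proof.
apply: lb_le_inf; last by move=> t [/ltW].
by exists (`|x| / rho + 1); apply: gset_big; rewrite ltrDl.
Qed.

(** Some admissible s lies below t, and convexity with the point 0 passes from s to t. *)
Lemma gauge_lt x t : gauge x < t -> U (t^-1 *: x).
Proof.
move=> xt; have [s [s0 Us] st] : exists2 s, (0 < s /\ U (s^-1 *: x)) & s < t.
  apply: inf_lt xt.
  by exists (`|x| / rho + 1); apply: gset_big; rewrite ltrDl.
have t0 := lt_trans s0 st.
have := U_conv _ _ (s / t) Us U0; rewrite scaler0 addr0 scalerA.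
rewrite mulrAC divff ?gt_eqF // mul1r; apply.
  by rewrite divr_ge0 // ltW.
by rewrite ler_pdivrMr // mul1r ltW.
Qed.

Lemma gaugeD x y : gauge (x + y) <= gauge x + gauge y.
Proof.
apply/ler_addgt0Pr => e e0.
pose s := gauge x + e / 2; pose t := gauge y + e / 2.
have e20 : 0 < e / 2 by rewrite divr_gt0.
have s0 : 0 < s by rewrite ltr_wpDl // gauge_ge0.
have t0 : 0 < t by rewrite ltr_wpDl // gauge_ge0.
have -> : gauge x + gauge y + e = s + t by rewrite /s /t; field.
apply: gauge_le; first exact: addr_gt0.
have Us : U (s^-1 *: x) by apply: gauge_lt; rewrite ltrDl.
have Ut : U (t^-1 *: y) by apply: gauge_lt; rewrite ltrDl.
have st : s + t != 0 by rewrite gt_eqF // addr_gt0.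
have := U_conv _ _ (s / (s + t)) Us Ut.
rewrite !scalerA scalerDr.
have -> : (s / (s + t)) / s = (s + t)^-1 by field; rewrite st gt_eqF.
have -> : (1 - s / (s + t)) / t = (s + t)^-1 by field; rewrite st gt_eqF.
apply; first by apply: divr_ge0; lra.
by have := addr_gt0 s0 t0 => ?; rewrite ler_pdivrMr //; lra.
Qed.

Let gaugeZ_le a x : 0 < a -> gauge (a *: x) <= a * gauge x.
Proof.
move=> a0; apply/ler_addgt0Pr => e e0.
have -> : a * gauge x + e = a * (gauge x + e / a) by field; rewrite gt_eqF.
have t0 : 0 < gauge x + e / a by rewrite ltr_wpDl ?gauge_ge0 // divr_gt0.
apply: gauge_le; first exact: mulr_gt0.
rewrite scalerA invfM mulrAC mulVf ?gt_eqF // mul1r.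
by apply: gauge_lt; rewrite ltrDl divr_gt0.
Qed.

Lemma gaugeZ a x : 0 < a -> gauge (a *: x) = a * gauge x.
Proof.
move=> a0; apply/eqP; rewrite eq_le gaugeZ_le //=.
have ai0 : 0 < a^-1 by rewrite invr_gt0.
have := gaugeZ_le a^-1 (a *: x) ai0.
by rewrite scalerA mulVf ?gt_eqF // scale1r mulrC ler_pdivlMr // mulrC.
Qed.

Lemma norm_le_gauge x : `|x| <= R0 * gauge x.
Proof.
have key t : gauge x < t -> `|x| <= R0 * t.
  move=> xt; have t0 := le_lt_trans (gauge_ge0 x) xt.
  have := U_bound _ (gauge_lt _ _ xt).
  by rewrite normrZ gtr0_norm ?invr_gt0 // mulrC ler_pdivrMr.
have R1 : 0 < R0 + 1 by rewrite ltr_wpDl.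
apply/ler_addgt0Pr => e e0.
have ea : 0 < e / (R0 + 1) by rewrite divr_gt0.
apply: (@le_trans _ _ (R0 * (gauge x + e / (R0 + 1)))).
  by apply: key; rewrite ltrDl.
rewrite mulrDr lerD2l mulrA ler_pdivrMr // mulrC ler_pM2l //.
by rewrite lerDl.
Qed.

Lemma gauge_dist x y : `|gauge x - gauge y| <= `|x - y| / rho.
Proof.
have H u v : gauge u - gauge v <= `|u - v| / rho.
  rewrite lerBlDr -{1}(subrK v u); apply: (le_trans (gaugeD _ _)).
  by rewrite lerD2r gauge_le_norm.
by rewrite ler_norml H lerNl opprB distrC H.
Qed.

Lemma gauge_lt1 x : gauge x < 1 -> U x.
Proof. by move=> /gauge_lt; rewrite invr1 scale1r. Qed.

Lemma gauge_le1 x : U x -> gauge x <= 1.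
Proof. by move=> Ux; apply: gauge_le; rewrite ?invr1 ?scale1r. Qed.

(* The inversion in the boundary of [U], an involution, applied outside [U] only. *)
Definition inversion (x : V) : V := (Num.max 1 (gauge x) ^+ 2)^-1 *: x.

Let m x := Num.max 1 (gauge x).
Let m1 x : 1 <= m x. Proof. by rewrite le_max lexx. Qed.
Let mg x : gauge x <= m x. Proof. by rewrite le_max lexx orbT. Qed.
Let m_dist x y : `|m x - m y| <= `|x - y| / rho.
Proof.
apply: (le_trans _ (gauge_dist x y)); rewrite /m.
case: (leP 1 (gauge x)) => h1; case: (leP 1 (gauge y)) => h2;
  rewrite // ?subrr ?normr0 //.
- by rewrite ger0_norm ?subr_ge0 // (le_trans _ (ler_norm _)) // lerD2l lerN2 ltW.
- rewrite ler0_norm ?subr_le0 // opprB distrC (le_trans _ (ler_norm _)) //.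
  by rewrite lerD2l lerN2 ltW.
Qed.

Lemma gauge_inversion x : gauge (inversion x) <= 1.
Proof.
have m0 : 0 < m x ^+ 2 by rewrite exprn_gt0 // (lt_le_trans _ (m1 x)).
rewrite gaugeZ ?invr_gt0 // mulrC ler_pdivrMr // mul1r.
rewrite -/(m x); apply: (le_trans (mg x)); rewrite expr2 ler_peMl //.
exact: le_trans (m1 x).
Qed.

Lemma inversion_id x : gauge x <= 1 -> inversion x = x.
Proof. by move=> x1; rewrite /inversion max_l // expr1n invr1 scale1r. Qed.

Lemma norm_inversion x : `|inversion x| <= R0.
Proof.
apply: (le_trans (norm_le_gauge _)); rewrite -[leRHS]mulr1.
by apply: ler_wpM2l => //; exact: gauge_inversion.
Qed.

(** The scaling factor varies with the Lipschitz function [m], and its variation is multiplied by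
    [|y|], which is at most [R0 * m y]; the negative powers of [m] absorb this growth. *)
Lemma inversion_lip x y : `|inversion x - inversion y| <= (1 + 2 * R0 / rho) * `|x - y|.
Proof.
have := m1 x; have := m1 y; have := m_dist x y; have := norm_le_gauge y.
have := mg y; rewrite /inversion -/(m x) -/(m y).
move: (m x) (m y) => a b gb ny ab b1 a1.
have a0 : 0 < a by rewrite (lt_le_trans _ a1).
have b0 : 0 < b by rewrite (lt_le_trans _ b1).
have -> : (a ^+ 2)^-1 *: x - (b ^+ 2)^-1 *: y =
  (a ^+ 2)^-1 *: (x - y) + ((a ^+ 2)^-1 - (b ^+ 2)^-1) *: y.
  by rewrite scalerBr scalerBl addrA subrK.
apply: (le_trans (ler_normD _ _)); rewrite !normrZ mulrDl mul1r; apply: lerD.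
  rewrite gtr0_norm ?invr_gt0 ?exprn_gt0 // mulrC ler_pdivrMr ?exprn_gt0 //.
  by rewrite ler_peMr // expr_ge1 // ltW.
have -> : (a ^+ 2)^-1 - (b ^+ 2)^-1 = (b - a) * ((a^-1 + b^-1) / (a * b)).
  by field; rewrite !gt_eqF.
have ab0 : 0 <= (a^-1 + b^-1) / (a * b).
  by rewrite divr_ge0 ?mulr_ge0 ?addr_ge0 ?invr_ge0 // ltW.
rewrite normrM (ger0_norm ab0) distrC.
have yb : `|y| <= R0 * b by apply: (le_trans ny); exact: ler_wpM2l.
apply: (@le_trans _ _ ((`|x - y| / rho) * ((a^-1 + b^-1) / (a * b)) * (R0 * b))).
  apply: ler_pM => //; first by rewrite mulr_ge0.
  by apply: ler_wpM2r.
have -> : (`|x - y| / rho) * ((a^-1 + b^-1) / (a * b)) * (R0 * b) =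
  (`|x - y| / rho * R0) * ((a^-1 + b^-1) / a).
  by field; rewrite !gt_eqF.
have -> : 2 * R0 / rho * `|x - y| = (`|x - y| / rho * R0) * 2.
  by field; rewrite !gt_eqF.
apply: ler_wpM2l; first by rewrite mulr_ge0 // divr_ge0 // ltW.
rewrite ler_pdivrMr //.
have : a^-1 <= 1 by rewrite invf_le1.
have : b^-1 <= 1 by rewrite invf_le1.
lra.
Qed.

(** Outside U the image has the inverse gauge, so x is [gauge x ^+ 2] times its image and the
    estimate of [inversion_lip] can be run backwards, as long as the gauges stay below G. This is
    what bounds the multiplicity of the folding. *)
Lemma inversion_inv_lip G x y : 1 <= gauge x -> 1 <= gauge y ->
  gauge x <= G -> gauge y <= G ->
  `|x - y| <= (G ^+ 2 * (1 + 2 * R0 / rho)) * `|inversion x - inversion y|.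
Proof.
move=> x1 y1 xG yG.
have ex : m x = gauge x by rewrite /m max_r.
have ey : m y = gauge y by rewrite /m max_r.
have a0 : 0 < gauge x by rewrite (lt_le_trans _ x1).
have b0 : 0 < gauge y by rewrite (lt_le_trans _ y1).
have gf z : 1 <= gauge z -> gauge (inversion z) = (gauge z)^-1.
  move=> z1; have z0 : 0 < gauge z by rewrite (lt_le_trans _ z1).
  rewrite gaugeZ ?invr_gt0 ?max_r ?exprn_gt0 //.
  by field; rewrite gt_eqF.
have := gauge_dist (inversion x) (inversion y); rewrite !gf //.
have nf : `|inversion y| <= R0 / gauge y.
  by apply: (le_trans (norm_le_gauge _)); rewrite gf.
have xE : x = gauge x ^+ 2 *: inversion x.
  by rewrite /inversion -/(m x) ex scalerA divff ?scale1r // sqrf_eq0 gt_eqF.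
have yE : y = gauge y ^+ 2 *: inversion y.
  by rewrite /inversion -/(m y) ey scalerA divff ?scale1r // sqrf_eq0 gt_eqF.
rewrite {3}xE {3}yE.
move: nf; move: (inversion x) (inversion y) (gauge x) (gauge y) x1 y1 xG yG a0 b0.
move=> {xE yE ex ey gf} X Y a b a1 b1 aG bG a0 b0 nY ab.
have -> : a ^+ 2 *: X - b ^+ 2 *: Y = a ^+ 2 *: (X - Y) + (a ^+ 2 - b ^+ 2) *: Y.
  by rewrite scalerBr scalerBl addrA subrK.
apply: (le_trans (ler_normD _ _)); rewrite !normrZ.
have := normr_ge0 (X - Y); move: ab; move: (`|X - Y|) => D ab D0.
rewrite !(gtr0_norm a0) -expr2 mulrDr mulr1 mulrDl; apply: lerD.
  by apply: ler_wpM2r => //; rewrite lerXn2r // nnegrE; lra.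
have eab : a ^+ 2 - b ^+ 2 = (a^-1 - b^-1) * - (a * b * (a + b)).
  by field; rewrite !gt_eqF.
have abab : 0 <= a * b * (a + b) by rewrite !mulr_ge0 ?addr_ge0 // ltW.
rewrite eab normrM normrN (ger0_norm abab).
apply: (@le_trans _ _ ((D / rho) * (a * b * (a + b)) * (R0 / b))).
  by apply: ler_pM => //; [rewrite mulr_ge0|apply: ler_wpM2r].
have -> : (D / rho) * (a * b * (a + b)) * (R0 / b) = (D / rho * R0) * (a * (a + b)).
  by field; rewrite !gt_eqF.
have -> : G ^+ 2 * (2 * R0 / rho) * D = (D / rho * R0) * (2 * G ^+ 2).
  by field; rewrite !gt_eqF.
apply: ler_wpM2l; first by rewrite mulr_ge0 // divr_ge0 // ltW.
nra.
Qed.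

End gauge.

(** * Retraction of a grid onto the cells inside a convex set *)

Lemma sub_split {V : zmodType} (A B C : V) : A - B = - (C - A) - (B - C).
Proof. by rewrite !opprB addrA subrK. Qed.

Lemma sub_split3 {V : zmodType} (A B C D : V) : A - B = (A - C) + (C - D) - (B - D).
Proof. by rewrite opprB !subrKA. Qed.

Lemma sub_split2 {V : zmodType} (A B C : V) : A - B = (C - B) - (C - A).
Proof. by rewrite opprB [RHS]addrC subrKA. Qed.

Lemma card_box_le n d (F : {set 'I_n * 'I_n}) :
  (forall c c', c \in F -> c' \in F -> (c.1 <= c'.1 + d)%N && (c.2 <= c'.2 + d)%N) ->
  (#|F| <= (2 * d).+1 ^ 2)%N.
Proof.
move=> HF; have [->|[c0 c0F]] := set_0Vmem F; first by rewrite cards0.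
pose phi (c : 'I_n * 'I_n) : 'I_(2 * d).+1 * 'I_(2 * d).+1 :=
  (inord (c.1 + d - c0.1), inord (c.2 + d - c0.2)).
have phi_inj : {in F &, injective phi}.
  move=> [i j] [i' j'] cF cF' [/(congr1 val) + /(congr1 val)] /=.
  have /= /andP[h1 h2] := HF _ _ cF c0F; have /= /andP[h3 h4] := HF _ _ cF' c0F.
  have /= /andP[h5 h6] := HF _ _ c0F cF; have /= /andP[h7 h8] := HF _ _ c0F cF'.
  rewrite !inordK; try lia.
  by move=> e1 e2; congr pair; apply/val_inj => /=; lia.
rewrite -(card_in_imset phi_inj); apply: (leq_trans (max_card _)).
by rewrite card_prod card_ord -mulnn.
Qed.

Section grid_cells.
Context {R : realType}.
Variables (x0 y0 : R).

Definition corner (l : R) {n} (c : 'I_n * 'I_n) : R * R :=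
  (x0 + (c.1)%:R * l, y0 + (c.2)%:R * l).

Definition cell (l : R) {n} (c : 'I_n * 'I_n) : set (R * R) :=
  square (corner l c).1 (corner l c).2 l.

Lemma cell_near l n (c : 'I_n * 'I_n) x : cell l c x -> `|x - corner l c| <= l.
Proof.
rewrite /cell /square => -[/=]; rewrite !in_itv /= => /andP[h1 h2] /andP[h3 h4].
rewrite [ `|_|]prod_normE /= ge_max !ler_norml.
by apply/andP; split; apply/andP; split; lra.
Qed.

Lemma index_exists (a l : R) n x : 0 < l -> a <= x -> x < a + n%:R * l ->
  exists i : 'I_n, (a + i%:R * l <= x) && (x < a + i%:R * l + l).
Proof.
move=> l0 ax xn; have xl0 : 0 <= (x - a) / l by rewrite divr_ge0 ?subr_ge0 // ltW.
have /andP[h1 h2] := truncn_itv xl0.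
have lt_n : (Num.truncn ((x - a) / l) < n)%N.
  rewrite -(ltr_nat R); apply: (le_lt_trans h1).
  by rewrite ltr_pdivrMr // ltrBlDl.
exists (Ordinal lt_n) => /=.
move: {lt_n} h1 h2; move: (Num.truncn _) => k; rewrite ler_pdivlMr // ltr_pdivrMr // -natr1 mulrDl mul1r => h1 h2.
by apply/andP; split; lra.
Qed.

Lemma cell_exists l n x : 0 < l -> square x0 y0 (n%:R * l) x ->
  exists c : 'I_n * 'I_n, cell l c x.
Proof.
move=> l0 [/=]; rewrite !in_itv /= => /andP[h1 h2] /andP[h3 h4].
have [i Hi] := index_exists x0 l n x.1 l0 h1 h2.
have [j Hj] := index_exists y0 l n x.2 l0 h3 h4.
by exists (i, j); split => /=; rewrite in_itv.
Qed.

Lemma cell_inj l n (c c' : 'I_n * 'I_n) x : 0 < l -> cell l c x -> cell l c' x -> c = c'.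
Proof.
have H (a y : R) (i j : 'I_n) : 0 < l -> a + i%:R * l <= y -> y < a + j%:R * l + l ->
    (i <= j)%N.
  move=> l0 h1 h2; rewrite -ltnS -(ltr_nat R) -(ltr_pM2r l0) -natr1 mulrDl mul1r.
  lra.
case: c c' => [i j] [i' j'] l0 [/=]; rewrite !in_itv /= => /andP[h1 h2] /andP[h3 h4].
move=> [/=]; rewrite !in_itv /= => /andP[h5 h6] /andP[h7 h8].
have e1 : i = i' by apply/val_inj/eqP; rewrite eqn_leq (H x0 x.1 i i') // (H x0 x.1 i' i).
have e2 : j = j' by apply/val_inj/eqP; rewrite eqn_leq (H y0 x.2 j j') // (H y0 x.2 j' j).
by rewrite e1 e2.
Qed.

Lemma corner_dist_le l n (c c' : 'I_n * 'I_n) D d : 0 < l -> D <= d%:R ->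
  `|corner l c - corner l c'| <= D * l -> (c.1 <= c'.1 + d)%N && (c.2 <= c'.2 + d)%N.
Proof.
move=> l0 Dd; rewrite [ `|_|]prod_normE /= ge_max => /andP[].
have H (a : R) (i j : 'I_n) : `|(a + i%:R * l) - (a + j%:R * l)| <= D * l -> (i <= j + d)%N.
  rewrite opprD addrACA subrr add0r -mulrBl => h.
  rewrite -(ler_nat R) natrD -lerBlDl; apply: (le_trans _ Dd).
  rewrite -(ler_pM2r l0); exact: le_trans (ler_norm _) h.
by move=> /H -> /H ->.
Qed.

Section retraction.
Variables (Om : set (R * R)) (p0 : R * R) (rho R0 S : R).
Hypothesis Om_conv : forall (x y : R * R) (t : R), Om x -> Om y -> 0 <= t -> t <= 1 ->
  Om (t *: x + (1 - t) *: y).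
Hypothesis rho0 : 0 < rho.
Hypothesis Om_ball : forall x, `|x - p0| < rho -> Om x.
Hypothesis Om_bound : forall x, Om x -> `|x - p0| <= R0.

Let U : set (R * R) := [set x | Om (p0 + x)].

Let U_conv (x y : R * R) (t : R) : U x -> U y -> 0 <= t -> t <= 1 -> U (t *: x + (1 - t) *: y).
Proof.
move=> Ux Uy t0 t1; have := Om_conv _ _ t Ux Uy t0 t1; rewrite /U /=.
rewrite !scalerDr addrACA; have -> // : t *: p0 + (1 - t) *: p0 = p0.
by rewrite scalerBl scale1r addrC subrK.
Qed.

Let U_ball x : `|x| < rho -> U x.
Proof. by move=> xr; apply: Om_ball; rewrite addrC addKr. Qed.

Let U_bound x : U x -> `|x| <= R0.
Proof. by move=> /Om_bound; rewrite addrC addKr. Qed.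

Let R00 : 0 <= R0.
Proof. by apply: le_trans (U_bound 0 _) => //; apply: U_ball; rewrite normr0. Qed.

(** Cells well inside Om are fixed. Any other cell is sent to the cell containing its inverted
    corner, shrunk slightly towards [p0] so as to land among the fixed cells; this makes [a]
    idempotent. Since [a] stays within a multiple of l of the inversion, it inherits its Lipschitz
    bounds at scale l. *)
Lemma grid_retraction : exists (C : R) (M : nat) (l0 : R), 0 < C /\ 0 < l0 /\
  forall n (l : R), 0 < l -> l <= l0 -> Om `<=` square x0 y0 (n%:R * l) -> n%:R * l <= S ->
  exists a : 'I_n * 'I_n -> 'I_n * 'I_n,
    [/\ forall c, a (a c) = a c, forall c, cell l (a c) `<=` Om,
        forall c c', `|corner l c - corner l c'| <= l ->
          `|corner l (a c) - corner l (a c')| <= C * l,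
        forall c x, cell l c x -> Om x -> `|corner l (a c) - corner l c| <= C * l &
        forall b, (#|[pred c | a c == b]| <= M)%N].
Proof.
pose g := @gauge R _ U; pose f := @inversion R _ U.
have g_lip x y : g x <= g y + `|x - y| / rho.
  by rewrite -lerBlDl; exact: le_trans (ler_norm _) (gauge_dist _ _ U_conv rho0 U_ball x y).
pose Lam := 1 + 2 * R0 / rho.
pose E := 1 + 3 * R0 / rho.
pose G := S / rho.
pose D := 2 * E * (1 + G ^+ 2 * Lam).
pose dd := (Num.truncn D).+1.
have RR : 0 <= R0 / rho by rewrite divr_ge0 // ltW.
have Lam1 : 1 <= Lam by rewrite /Lam -mulrA lerDl mulr_ge0.
have E1 : 1 <= E by rewrite /E -mulrA lerDl mulr_ge0.
have GL : 0 <= G ^+ 2 * Lam by rewrite mulr_ge0 ?sqr_ge0 //; lra.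
have Ddd : D <= dd%:R by rewrite ltW // truncnS_gt.
pose C := 2 * E + Lam + 2 * (R0 / rho).
(* The bound [rho / 6] on l keeps the shrinking ratio [kap] at least 1/2. *)
exists C, (2 * (2 * dd).+1 ^ 2)%N, (rho / 6); split; first by rewrite /C; lra.
split => [|n l l0 lr OmQ nS]; first by rewrite divr_gt0.
pose z (c : 'I_n * 'I_n) := corner l c - p0.
(* The shrunk point has gauge at most [kap], hence the corner of its cell at most
   [1 - 2 * (l / rho)], which is below the threshold of [good]. *)
pose kap := 1 - 3 * (l / rho).
have lr6 : l / rho <= 6^-1 by rewrite ler_pdivrMr // mulrC.
have lr0 : 0 < l / rho by rewrite divr_gt0.
(* Every point of a cell is within l of the corner, so the margin [l / rho] puts the whole cell
   inside Om. *)
pose good c := g (z c) < 1 - l / rho.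
have cell_z c x : cell l c (p0 + x) -> `|x - z c| <= l.
  by move=> /cell_near; rewrite /z opprB addrA (addrC x).
have cell_sub c : good c -> cell l c `<=` Om.
  move=> gc x cx; have -> : x = p0 + (x - p0) by rewrite addrCA subrr addr0.
  apply: (gauge_lt1 _ _ U_conv rho0 U_ball).
  apply: (le_lt_trans (g_lip _ (z c))).
  have := cell_z c (x - p0); rewrite addrCA subrr addr0 => /(_ cx) h.
  have : `|x - p0 - z c| / rho <= l / rho by rewrite ler_pdivrMr // divfK ?gt_eqF.
  by move: gc; rewrite /good; lra.
pose spec c b := (good c /\ b = c) \/ (~ good c /\ cell l b (p0 + kap *: f (z c))).
have gf x : g (kap *: f x) <= kap.
  have k0 : 0 < kap by rewrite /kap; lra.
  rewrite /g (gaugeZ _ _ U_conv rho0 U_ball) // -[leRHS]mulr1 ler_pM2l //.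
  exact: (gauge_inversion _ _ U_conv rho0 U_ball).
have /choice[a aP] : forall c, exists b, spec c b.
  move=> c; have [gc|ngc] := pselect (good c); first by exists c; left.
  have [b bP] : exists b : 'I_n * 'I_n, cell l b (p0 + kap *: f (z c)).
    apply: cell_exists => //; apply: OmQ.
    apply: (gauge_lt1 _ _ U_conv rho0 U_ball); apply: (le_lt_trans (gf _)).
    by rewrite /kap; lra.
  by exists b; right.
have agood c : good (a c).
  case: (aP c) => [[gc ->] //|[_ /cell_z h]].
  apply: (le_lt_trans (g_lip _ (kap *: f (z c)))).
  have : `|z (a c) - kap *: f (z c)| / rho <= l / rho.
    by rewrite ler_pdivrMr // divfK ?gt_eqF // distrC.
  by have := gf (z c); rewrite /kap; lra.
(* An error l from the position in the target cell and [(3 * R0 / rho) * l] from the shrinking;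
   everything below is deduced from the inversion through this estimate. *)
have a_near c : `|z (a c) - f (z c)| <= E * l.
  case: (aP c) => [[gc ->]|[_ /cell_z h]].
    rewrite /f (inversion_id U) ?subrr ?normr0 ?mulr_ge0 //; [lra|exact: ltW|].
    by move: gc; rewrite /good /g; lra.
  have -> : z (a c) - f (z c) = - (kap *: f (z c) - z (a c)) - (1 - kap) *: f (z c).
    by rewrite (scalerBl 1 kap) scale1r; exact: sub_split.
  apply: (le_trans (ler_normB _ _)); rewrite normrN normrZ.
  have k0 : 0 <= 1 - kap by rewrite /kap; lra.
  rewrite (ger0_norm k0).
  have := norm_inversion _ _ _ U_conv rho0 U_ball U_bound (z c) => nf.
  have : (1 - kap) * `|f (z c)| <= (1 - kap) * R0 by apply: ler_wpM2l.
  have -> : (1 - kap) * R0 = (3 * R0 / rho) * l by rewrite /kap; field; rewrite gt_eqF.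
  by rewrite /E mulrDl mul1r; lra.
have zB c c' : corner l c - corner l c' = z c - z c'.
  by rewrite /z opprB addrA subrK.
have f_lip := inversion_lip _ _ _ U_conv rho0 U_ball U_bound.
exists a; split.
- by move=> c; case: (aP (a c)) => [[_ ->] //|[]]; have := agood c.
- by move=> c; apply: cell_sub; exact: agood.
- move=> c c'; rewrite !zB => cc'.
  have -> : z (a c) - z (a c') = (z (a c) - f (z c)) + (f (z c) - f (z c')) - (z (a c') - f (z c')).
    exact: sub_split3.
  have h1 := a_near c; have h2 := a_near c'; have h3 := f_lip (z c) (z c').
  apply: (le_trans (ler_normB _ _)).
  have := ler_normD (z (a c) - f (z c)) (f (z c) - f (z c')).
  have : Lam * `|z c - z c'| <= Lam * l by rewrite ler_pM2l //; lra.
  have : 0 <= R0 / rho * l by rewrite mulr_ge0 // ltW.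
  by move: h3; rewrite -/Lam -/f /C; lra.
- move=> c x cx Omx; rewrite zB.
  (* A cell that meets Om has its corner just outside at worst, where the inversion moves points by
     at most a multiple of l. *)
  have gz : g (z c) <= 1 + l / rho.
    apply: (le_trans (g_lip _ (x - p0))); apply: lerD.
      by apply: gauge_le1; rewrite /U /= addrCA subrr addr0.
    rewrite ler_pdivrMr // divfK ?gt_eqF // distrC; apply: cell_z.
    by rewrite addrCA subrr addr0.
  rewrite -(subrKA (f (z c))).
  have h1 := a_near c.
  have h2 : `|f (z c) - z c| <= 2 * (R0 / rho) * l.
    have [g1|g1] := leP (g (z c)) 1.
      by rewrite /f (inversion_id U) // subrr normr0; apply: mulr_ge0; lra.
    have nz : `|z c| <= R0 * g (z c) := norm_le_gauge _ _ _ U_conv rho0 U_ball U_bound (z c).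
    rewrite /f /inversion (max_r (ltW g1)).
    rewrite -/g (_ : _ - z c = ((g (z c) ^+ 2)^-1 - 1) *: z c); last first.
      by rewrite (scalerBl _ 1) scale1r.
    rewrite normrZ.
    move: nz gz g1; move: (g (z c)) => m nz gz g1.
    have m0 : 0 < m by lra.
    have mi : (m ^+ 2)^-1 <= 1 by rewrite invf_le1 ?exprn_ege1 ?exprn_gt0 // ltW.
    rewrite ler0_norm ?subr_le0 //.
    apply: (@le_trans _ _ (- ((m ^+ 2)^-1 - 1) * (R0 * m))).
      by apply: ler_wpM2l => //; lra.
    have -> : - ((m ^+ 2)^-1 - 1) * (R0 * m) = R0 * (m - m^-1).
      by field; rewrite gt_eqF.
    have -> : 2 * (R0 / rho) * l = R0 * (2 * (l / rho)) by field; rewrite gt_eqF.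
    apply: ler_wpM2l => //.
    have mm : 1 - m^-1 <= m - 1.
      have : m^-1 * m = 1 by rewrite mulVf // gt_eqF.
      have : 0 < m^-1 by rewrite invr_gt0.
      by nra.
    by lra.
  apply: (le_trans (ler_normD _ _)).
  have : 0 <= Lam * l by rewrite mulr_ge0 //; lra.
  have : 0 <= E * l by rewrite mulr_ge0 //; lra.
  by rewrite /C; lra.
- move=> b.
  (* The grid has side at most S and contains [p0], so corners are at distance at most S from
     [p0]. *)
  have Gz c : g (z c) <= G.
    apply: (le_trans (gauge_le_norm _ _ rho0 U_ball _)).
    rewrite /G ler_pM2r ?invr_gt0 //; apply: (le_trans _ nS).
    have [] : square x0 y0 (n%:R * l) p0.
      by apply: OmQ; apply: Om_ball; rewrite subrr normr0.
    rewrite /= !in_itv /= => /andP[h1 h2] /andP[h3 h4].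
    have H (i : 'I_n) : 0 <= i%:R * l /\ i%:R * l <= n%:R * l.
      by split; [rewrite mulr_ge0 // ltW|rewrite ler_pM2r // ler_nat ltnW].
    have [e1 e2] := H c.1; have [e3 e4] := H c.2.
    rewrite [ `|_|]prod_normE /= ge_max !ler_norml.
    by apply/andP; split; apply/andP; split; lra.
  have fz c c' : a c = b -> a c' = b -> `|f (z c) - f (z c')| <= 2 * E * l.
    move=> ac ac'.
    have -> : f (z c) - f (z c') = (z b - f (z c')) - (z b - f (z c)).
      exact: sub_split2.
    apply: (le_trans (ler_normB _ _)).
    by have := a_near c; have := a_near c'; rewrite ac ac'; lra.
  have box (F : {set 'I_n * 'I_n}) : (forall c c', c \in F -> c' \in F ->
      `|z c - z c'| <= (1 + G ^+ 2 * Lam) * `|f (z c) - f (z c')|) ->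
      (forall c, c \in F -> a c = b) -> (#|F| <= (2 * dd).+1 ^ 2)%N.
    move=> HF Hb; apply: card_box_le => c c' cF cF'.
    apply: (@corner_dist_le l _ _ _ D) => //; rewrite zB.
    apply: (le_trans (HF _ _ cF cF')).
    have -> : D * l = (1 + G ^+ 2 * Lam) * (2 * E * l) by rewrite /D; ring.
    apply: ler_wpM2l; first by lra.
    by apply: fz; exact: Hb.
  (* The inversion folds two sheets together but is injective, with Lipschitz inverse, on each; each
     sheet of the fibre fits in a box of indices. *)
  pose F1 : {set 'I_n * 'I_n} := [set c | (a c == b) && (g (z c) <= 1)]%SET.
  pose F2 : {set 'I_n * 'I_n} := [set c | (a c == b) && (1 <= g (z c))]%SET.
  have FU : [pred c | a c == b] \subset (F1 :|: F2)%SET.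
    apply/fintype.subsetP => c; rewrite !inE => ->/=; exact: le_total.
  apply: (leq_trans (subset_leq_card FU)); apply: (leq_trans (leq_card_setU _ _)).
  rewrite mul2n -addnn leq_add //; apply: box.
  + move=> c c'; rewrite !inE => /andP[_ gc] /andP[_ gc'].
    rewrite /f !(inversion_id U) //; rewrite ler_peMl //; lra.
  + by move=> c; rewrite inE => /andP[/eqP].
  + move=> c c'; rewrite !inE => /andP[_ gc] /andP[_ gc'].
    apply: (le_trans (inversion_inv_lip _ _ _ U_conv rho0 U_ball U_bound G _ _ gc gc' _ _)) => //.
    by rewrite -/Lam -/f ler_wpM2r //; lra.
  + by move=> c; rewrite inE => /andP[/eqP].
Qed.

End retraction.
End grid_cells.

Lemma convex_open_bounded_data {R : realType} (Om : set (R * R)) :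
  Om !=set0 -> open Om -> bounded_set Om ->
  convex_set (Om : set (convex_lmodType (R * R)%type)) ->
  exists (p0 : R * R) (rho R0 : R),
    [/\ forall (x y : R * R) (t : R), Om x -> Om y -> 0 <= t -> t <= 1 ->
          Om (t *: x + (1 - t) *: y), 0 < rho,
        forall x, `|x - p0| < rho -> Om x & forall x, Om x -> `|x - p0| <= R0].
Proof.
move=> [p0 Omp0] oOm [M [_ HM]] cOm.
have /nbhs_ballP[rho /= rho0 Hb] : nbhs p0 Om by apply: oOm.
exists p0, rho, (`|M| + 1 + `|p0|); split => //.
- move=> x y t Omx Omy t0 t1.
  have := cOm x y (Itv01 t0 t1); rewrite !inE => /(_ Omx Omy); exact.
- by move=> x; rewrite distrC => xr; apply: Hb; rewrite -ball_normE.
- move=> x Omx; apply: (le_trans (ler_normB _ _)); rewrite lerD2r.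
  by apply: HM => //; rewrite (le_lt_trans (ler_norm _)) // ltrDl.
Qed.

(** * The boundary layer of a convex set *)

Section boundary.
Context {R : realType}.
Variables (Om : set (R * R)) (p0 : R * R) (rho : R).
Hypothesis mOm : measurable Om.
Hypothesis bOm : bounded_set Om.
Hypothesis Om_conv : forall (x y : R * R) (t : R), Om x -> Om y -> 0 <= t -> t <= 1 ->
  Om (t *: x + (1 - t) *: y).
Hypothesis rho0 : 0 < rho.
Hypothesis Om_ball : forall x, `|x - p0| < rho -> Om x.

Lemma square_near (a b l : R) x y : square a b l x -> square a b l y -> `|y - x| <= l.
Proof.
move=> [/=]; rewrite !in_itv /= => /andP[h1 h2] /andP[h3 h4].
move=> [/=]; rewrite !in_itv /= => /andP[h5 h6] /andP[h7 h8].
rewrite [ `|_|]prod_normE /= ge_max !ler_norml.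
by apply/andP; split; apply/andP; split; lra.
Qed.

(* By convexity a square of side [l] which meets the homothetic copy of [Om] of
   ratio [1 - 2 l / rho] lies in [Om]; the layer is the rest of [Om]. *)
Lemma boundary_layer l : 0 < l -> exists E : set (R * R),
  [/\ measurable E, E `<=` Om, fine (leb2 E) <= 4 * fine (leb2 Om) / rho * l &
    forall a b x, Om x -> square a b l x -> ~ (square a b l `<=` Om) -> E x].
Proof.
move=> l0; pose eta := 2 * l / rho.
have eta0 : 0 < eta by rewrite divr_gt0 // mulr_gt0.
have Omfin := leb2_fin _ mOm bOm.
have Om0 : 0 <= fine (leb2 Om) by apply: fine_ge0.
have -> : 4 * fine (leb2 Om) / rho * l = 2 * eta * fine (leb2 Om).
  by rewrite /eta; field; rewrite gt_eqF.
(* For such large l the whole of Om serves as the layer, and the area bound is trivial. *)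
have [eta1|eta1] := leP 1 eta.
  exists Om; split => //; rewrite ler_peMl //; lra.
pose s := (1 - eta)^-1.
have s0 : 0 < s by rewrite invr_gt0 subr_gt0.
have sE : (1 - eta) * s = 1 by rewrite divff // gt_eqF // subr_gt0.
(* The inverse of the homothety of ratio [1 - eta] about [p0], so that T is the homothetic copy of
   Om. *)
pose psi := fun x : R * R => (p0 - s *: p0) + s *: x.
pose T := psi @^-1` Om.
have mT : measurable T.
  by rewrite -[T]setTI; apply: (measurable_affine2 (p0 - s *: p0) s).
have p0Om : Om p0 by apply: Om_ball; rewrite subrr normr0.
(* A convex combination of [psi x], in Om when x is in T, and of a point of the ball about [p0],
   because [|y - x| <= l] and [rho * eta = 2 * l]. The case [y = x] shows that T lies in Om. *)
have psiE x y : y = (1 - eta) *: psi x + (1 - (1 - eta)) *: (p0 + eta^-1 *: (y - x)).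
  have H (u v p : R) :
      v = (1 - eta) * ((p - s * p) + s * u) + (1 - (1 - eta)) * (p + eta^-1 * (v - u)).
    have -> : (1 - eta) * ((p - s * p) + s * u) =
      (1 - eta) * p + ((1 - eta) * s) * (u - p) by ring.
    by rewrite sE; field; rewrite gt_eqF.
  rewrite /psi; case: (x) (y) (p0) => [x1 x2] [y1 y2] [p1 p2].
  by congr pair; exact: H.
have TOm : T `<=` Om.
  move=> x Tx; rewrite (psiE x x) subrr scaler0 addr0.
  by apply: Om_conv => //; lra.
have lebT : leb2 T = ((1 - eta) ^+ 2 * fine (leb2 Om))%:E.
  have := leb2_affine (p0 - s *: p0) s Om s0 mOm; rewrite -[in LHS](fineK Omfin).
  have /fineK <- : leb2 T \is a fin_num.
    rewrite ge0_fin_numE // (le_lt_trans _ (_ : leb2 Om < +oo)%E) //.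
      by apply: le_measure; rewrite ?inE.
    by rewrite -ge0_fin_numE.
  rewrite -EFinM => -[->]; congr EFin.
  by rewrite mulrA -exprMn sE expr1n mul1r.
exists (Om `\` T); split.
- exact: measurableD.
- by move=> x [].
- have -> : leb2 (Om `\` T) = (leb2 Om - leb2 T)%E.
    rewrite measureD // ?(setIidr TOm) //.
    by rewrite -ge0_fin_numE.
  rewrite lebT -(fineK Omfin) -EFinB /=.
  have -> : fine (leb2 Om) - (1 - eta) ^+ 2 * fine (leb2 Om) =
    (2 * eta - eta ^+ 2) * fine (leb2 Om) by ring.
  by apply: ler_wpM2r => //; have := sqr_ge0 eta; lra.
- move=> a b x Omx Qx nQ; split => // Tx; apply: nQ => y Qy.
  rewrite (psiE x y); apply: Om_conv => //; [|lra|lra].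
  apply: Om_ball; rewrite addrAC subrr add0r normrZ gtr0_norm ?invr_gt0 //.
  have := square_near a b l x y Qx Qy => h.
  have e : rho * eta = 2 * l by rewrite /eta; field; rewrite gt_eqF.
  by rewrite mulrC ltr_pdivrMr // e; lra.
Qed.
End boundary.

(** * Wasserstein bound from a flow on the grid *)

Section signed_flow.
Context {R : realType} {B E : finType}.
Variables (nu v : B -> R) (src tgt : E -> B) (J : E -> R) (p : B -> R * R).
Variables (h kap M : R).
Hypothesis v0 : forall b, 0 <= v b.
Hypothesis nu1 : \sum_b nu b = 1.
Hypothesis kap0 : 0 < kap.
Hypothesis kap_nu : forall b, kap <= nu b.
Hypothesis h0 : 0 < h.
Hypothesis divJ : forall b,
  v b - nu b = \sum_e J e * ((tgt e == b)%:R - (src e == b)%:R).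
Hypothesis J_short : forall e, J e != 0 -> `|p (src e) - p (tgt e)| <= h.
Hypothesis deg : forall b, \sum_e ((src e == b)%:R + (tgt e == b)%:R) <= M.

Let Jp e := Num.max (J e) 0.
Let Jn e := Num.max (- J e) 0.
(** Jump rates are nonnegative, so an edge with negative flow carries mass from its target to its
    source. *)
Let K b c := \sum_e ((src e == b)%:R * (tgt e == c)%:R * Jp e +
                     (tgt e == b)%:R * (src e == c)%:R * Jn e).

Let Jp0 e : 0 <= Jp e. Proof. by rewrite le_max lexx orbT. Qed.
Let Jn0 e : 0 <= Jn e. Proof. by rewrite le_max lexx orbT. Qed.
Let JpnE e : Jp e - Jn e = J e.
Proof. by rewrite /Jp /Jn; case: (leP (J e) 0); case: (leP (- J e) 0); lra. Qed.
Let Jpn_abs e : Jp e + Jn e = `|J e|.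
Proof.
rewrite /Jp /Jn; case: (leP (J e) 0) => h1; case: (leP (- J e) 0) => h2;
  rewrite ?(ler0_norm h1) ?(gtr0_norm h1); lra.
Qed.

Let K0 b c : 0 <= K b c.
Proof. by apply: sumr_ge0 => e _; rewrite addr_ge0 // !mulr_ge0. Qed.

Let sum_one (x : B) : \sum_c ((x == c)%:R : R) = 1.
Proof. by rewrite (bigD1 x) //= eqxx big1 ?addr0 // => c; rewrite eq_sym => /negPf ->. Qed.

Let Kout b : \sum_c K b c = \sum_e ((src e == b)%:R * Jp e + (tgt e == b)%:R * Jn e).
Proof.
rewrite exchange_big /=; apply: eq_bigr => e _; rewrite big_split /=.
by under eq_bigr do rewrite mulrAC; under [X in _ + X]eq_bigr do rewrite mulrAC;
   rewrite -!mulr_sumr !sum_one !mulr1.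
Qed.

Let Kin b : \sum_c K c b = \sum_e ((tgt e == b)%:R * Jp e + (src e == b)%:R * Jn e).
Proof.
rewrite exchange_big /=; apply: eq_bigr => e _; rewrite big_split /=.
by under eq_bigr do rewrite -mulrA; under [X in _ + X]eq_bigr do rewrite -mulrA;
   rewrite -!mulr_suml !sum_one !mul1r.
Qed.

(** Cauchy-Schwarz over the edges at a node costs the degree M, and each edge is counted at its two
    ends, hence [2 * M]. *)
Lemma signed_flow_coupling : exists pi, fcoupling nu v pi /\
  fcost p pi <= 150 * h ^+ 2 * (1 + 2 * M / kap * \sum_e J e ^+ 2).
Proof.
have nu0 b : 0 < nu b by exact: lt_le_trans (kap_nu b).
have divK b : v b - nu b = \sum_c K c b - \sum_c K b c.
  rewrite Kin Kout divJ -sumrB; apply: eq_bigr => e _.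
  by rewrite -JpnE; ring.
have Kh b c : K b c != 0 -> `|p b - p c| <= h.
  have [] := pselect (exists e, J e != 0 /\
      ((src e = b /\ tgt e = c) \/ (tgt e = b /\ src e = c))).
    by move=> [e [Je [[<- <-]|[<- <-]]]] _; [|rewrite distrC]; exact: J_short.
  move=> ne /negP[]; apply/eqP/big1 => e _.
  have [Je|Je] := eqVneq (J e) 0.
    by rewrite /Jp /Jn Je oppr0 maxxx !mulr0 addr0.
  case: (eqVneq (src e) b) => sb; case: (eqVneq (tgt e) c) => tc;
  case: (eqVneq (tgt e) b) => tb; case: (eqVneq (src e) c) => sc;
  rewrite ?(mul0r, mulr0, addr0) //; case: ne; exists e; tauto.
have [pi [cpi Hpi]] := flow_coupling_short nu v K nu0 v0 K0 divK p h nu1 h0 Kh.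
exists pi; split => //; apply: (le_trans Hpi).
apply: ler_wpM2l; first by rewrite mulr_ge0 // sqr_ge0.
rewrite lerD2l.
pose al e b : R := (src e == b)%:R + (tgt e == b)%:R.
have al0 e b : 0 <= al e b by rewrite addr_ge0.
apply: (@le_trans _ _ (\sum_b M / kap * \sum_e al e b * J e ^+ 2)).
  apply: ler_sum => b _.
  have Kle : \sum_c K b c <= \sum_e al e b * `|J e|.
    rewrite Kout; apply: ler_sum => e _; rewrite -Jpn_abs /al.
    move: (Jp0 e) (Jn0 e); move: (Jp e) (Jn e) => x y x0 y0.
    rewrite mulrDl !mulrDr.
    have H0 (c : bool) (z : R) : 0 <= z -> 0 <= c%:R * z by move=> ?; rewrite mulr_ge0.
    rewrite lerD ?lerDl ?lerDr ?H0 //.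
  have sq0 : 0 <= \sum_e al e b * J e ^+ 2.
    by apply: sumr_ge0 => e _; rewrite mulr_ge0 ?sqr_ge0.
  have CS : (\sum_e al e b * `|J e|) ^+ 2 <= M * \sum_e al e b * J e ^+ 2.
    apply: (@le_trans _ _ ((\sum_e al e b) * \sum_e al e b * J e ^+ 2)); last first.
      by apply: ler_wpM2r => //; exact: deg.
    (* Lagrange's form of the Cauchy-Schwarz inequality with weights [al e b]. *)
    have : 0 <= \sum_e \sum_e' al e b * al e' b * (`|J e| - `|J e'|) ^+ 2.
      apply: sumr_ge0 => e _; apply: sumr_ge0 => e' _.
      by rewrite -mulrA; do 2!apply: mulr_ge0 => //; exact: sqr_ge0.
    have -> : \sum_e \sum_e' al e b * al e' b * (`|J e| - `|J e'|) ^+ 2 =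
       2 * ((\sum_e al e b) * (\sum_e al e b * J e ^+ 2)) - 2 * (\sum_e al e b * `|J e|) ^+ 2.
      transitivity (\sum_e ((al e b * J e ^+ 2) * (\sum_e' al e' b) +
        al e b * (\sum_e' al e' b * J e' ^+ 2) -
        2 * (al e b * `|J e|) * (\sum_e' al e' b * `|J e'|))).
        apply: eq_bigr => e _; rewrite !mulr_sumr -big_split -sumrB /=.
        by apply: eq_bigr => e' _; rewrite sqrrB !real_normK ?num_real //; ring.
      rewrite sumrB big_split /= -!mulr_suml -mulr_sumr.
      by rewrite expr2; ring.
    lra.
  have K00 : 0 <= \sum_c K b c by apply: sumr_ge0 => c _; exact: K0.
  have H1 : (\sum_c K b c) ^+ 2 <= M * \sum_e al e b * J e ^+ 2.
    by apply: (le_trans _ CS); rewrite lerXn2r // nnegrE // (le_trans K00).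
  rewrite ler_pdivrMr //; apply: (le_trans H1).
  have M0 : 0 <= M by apply: (le_trans _ (deg b)); apply: sumr_ge0 => e _; exact: al0.
  have -> : M / kap * (\sum_e al e b * J e ^+ 2) * nu b =
    (M * \sum_e al e b * J e ^+ 2) * (nu b / kap) by ring.
  by rewrite ler_peMr ?mulr_ge0 // ler_pdivlMr // mul1r.
rewrite -mulr_sumr exchange_big /=.
under eq_bigr do rewrite -mulr_suml big_split /= !sum_one.
rewrite -mulr_sumr le_eqVlt; apply/orP; left; apply/eqP; ring.
Qed.

End signed_flow.

Lemma sub_bounded_set {R : realType} (A B : set (R * R)) :
  A `<=` B -> bounded_set B -> bounded_set A.
Proof. by move=> AB [M [Mr H]]; exists M; split => // y My x /AB; exact: H. Qed.

Section partitions.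
Context {R : realType} {B : finType}.
Variables (A : B -> set (R * R)) (U : set (R * R)).
Hypothesis A_disj : forall b b' x, A b x -> A b' x -> b = b'.
Hypothesis A_cover : forall x, U x <-> exists b, A b x.

Lemma npoints_partition (X : set (R * R)) : finite_set (X `&` U) ->
  (npoints (X `&` U))%:R = \sum_b (npoints (X `&` A b))%:R :> R.
Proof.
move=> finX.
have AU b : A b `<=` U by move=> x Ab; apply/A_cover; exists b.
have npE D : D `<=` U -> (npoints (X `&` D))%:R = \sum_(x \in X `&` U) (\1_D x : R).
  move=> DU; have -> : X `&` D = (X `&` U) `&` D by rewrite -setIA (setIidr DU).
  by rewrite sum_indic_npoints //; apply: sub_finite_set finX => x [].
rewrite npE // fsbig_finite //=.
under [RHS]eq_bigr do rewrite npE // fsbig_finite //=.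
rewrite exchange_big /=; apply: eq_big_seq => x.
rewrite in_fset_set // inE => -[_ Ux].
have [b Ab] := (A_cover x).1 Ux.
rewrite (bigD1 b) //= !indicE !mem_set // big1 ?addr0 // => b' bb'.
by rewrite indicE memNset // => Ab'; move: bb'; rewrite (A_disj _ _ _ Ab Ab') eqxx.
Qed.

Lemma area_partition : (forall b, measurable (A b)) -> bounded_set U ->
  fine (leb2 U) = \sum_b fine (leb2 (A b)).
Proof.
move=> mA bU; rewrite (measure_fin_partition leb2 A U) // -sum_fine // => b _.
apply: leb2_fin => //; apply: (sub_bounded_set _ _ _ bU) => x Ab; apply/A_cover; by exists b.
Qed.

End partitions.

Section grid_coupling.
Context {R : realType}.
Variables (x0 y0 l C : R) (n M : nat) (Om X : set (R * R)).
Variable a : 'I_n * 'I_n -> 'I_n * 'I_n.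
Variables Jh Jv : nat -> nat -> R.
Hypothesis l0 : 0 < l.
Hypothesis C0 : 0 < C.
Hypothesis mOm : measurable Om.
Hypothesis bOm : bounded_set Om.
Hypothesis OmQ : Om `<=` square x0 y0 (n%:R * l).
Hypothesis Om0 : 0 < fine (leb2 Om).
Hypothesis aa : forall c, a (a c) = a c.
Hypothesis aOm : forall c, cell x0 y0 l (a c) `<=` Om.
Hypothesis a_lip : forall c c', `|corner x0 y0 l c - corner x0 y0 l c'| <= l ->
  `|corner x0 y0 l (a c) - corner x0 y0 l (a c')| <= C * l.
Hypothesis a_near : forall c x, cell x0 y0 l c x -> Om x ->
  `|corner x0 y0 l (a c) - corner x0 y0 l c| <= C * l.
Hypothesis aM : forall b, (#|[pred c | a c == b]| <= M)%N.
Hypothesis finX : finite_set (X `&` Om).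
Let N := npoints (X `&` Om).
Hypothesis N0 : N != 0%N.
Hypothesis flowJ : forall c : 'I_n * 'I_n,
  (npoints (X `&` (cell x0 y0 l c `&` Om)))%:R / N%:R -
    fine (leb2 (cell x0 y0 l c `&` Om)) / fine (leb2 Om) =
  (Jh c.1.+1 c.2 - Jh c.1 c.2) + (Jv c.1 c.2.+1 - Jv c.1 c.2).
Hypothesis Jh0 : forall j, Jh 0%N j = 0 /\ Jh n j = 0.
Hypothesis Jv0 : forall i, Jv i 0%N = 0 /\ Jv i n = 0.

Local Notation cl := (cell x0 y0 l).
Local Notation cn := (corner x0 y0 l).
Local Notation B := {c : 'I_n * 'I_n | a c == c}.

Let ab c : B := exist _ (a c) (introT eqP (aa c)).
(** All parts of Om folded onto the cell b: b itself together with slivers of boundary cells, which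
    thus share its mass. *)
Let A (b : B) := [set x | Om x /\ exists2 c, ab c = b & cl c x].
Let E : finType := (bool * ('I_n * 'I_n))%type.
Let J (e : E) := if e.1 then Jh e.2.1 e.2.2 else Jv e.2.1 e.2.2.
Let src (e : E) := ab e.2.
(** An edge joins a cell to its predecessor in one direction, and a positive flow goes to the
    predecessor. [ord_pred] wraps around at index 0, so reindexing is a bijection; the wrapped edges
    carry no flow by [Jh0] and [Jv0]. *)
Let prd (e : E) : 'I_n * 'I_n :=
  if e.1 then (ord_pred e.2.1, e.2.2) else (e.2.1, ord_pred e.2.2).
Let tgt (e : E) := ab (prd e).
Let G c (b : B) := if ab c == b then cl c `&` Om else set0.

Let mcl (c : 'I_n * 'I_n) : measurable (cl c). Proof. exact: measurable_rect. Qed.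
Let mG c b : measurable (G c b).
Proof. by rewrite /G; case: ifP => // _; exact: measurableI. Qed.

Let G_disj b c c' x : G c b x -> G c' b x -> c = c'.
Proof.
rewrite /G; case: ifP => // _; case: ifP => // _ [cx _] [cx' _].
exact: (cell_inj x0 y0 l _ c c' x).
Qed.

Let G_cover b x : A b x <-> exists c, G c b x.
Proof.
rewrite /A /G; split.
  by move=> [Omx [c <- cx]]; exists c; rewrite eqxx.
by move=> [c]; case: ifP => // /eqP cb [cx Omx]; split => //; exists c.
Qed.

Let mA b : measurable (A b).
Proof.
have -> : A b = \bigcup_(c in [set: 'I_n * 'I_n]) G c b.
  by apply/seteqP; split => x; [move=> /G_cover[c]; exists c|move=> [c _ ?]; apply/G_cover; exists c].
by apply: fin_bigcup_measurable.
Qed.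

Let A_disj b b' x : A b x -> A b' x -> b = b'.
Proof. by move=> [_ [c <- cx]] [_ [c' <- cx']]; rewrite (cell_inj x0 y0 l _ c c' x). Qed.

Let A_cover x : Om x <-> exists b, A b x.
Proof.
split => [Omx|[b []] //].
have [c cx] := cell_exists x0 y0 l n x l0 (OmQ _ Omx).
by exists (ab c); split => //; exists c.
Qed.

Let AOm b : A b `<=` Om. Proof. by move=> x []. Qed.

Let nu b := fine (leb2 (A b)) / fine (leb2 Om).
Let v b : R := (npoints (X `&` A b))%:R / N%:R.

Let v_nu b : v b - nu b = \sum_c (ab c == b)%:R *
  ((Jh c.1.+1 c.2 - Jh c.1 c.2) + (Jv c.1 c.2.+1 - Jv c.1 c.2)).
Proof.
have finA : finite_set (X `&` A b).
  by apply: sub_finite_set finX => x [Xx /AOm].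
have bA : bounded_set (A b) by apply: (sub_bounded_set _ _ _ bOm); exact: AOm.
rewrite /v /nu (npoints_partition (fun c => G c b) (A b) (G_disj b) (G_cover b)) //.
rewrite (area_partition (fun c => G c b) (A b) (G_disj b) (G_cover b)) //.
rewrite !mulr_suml -sumrB; apply: eq_bigr => c _; rewrite -flowJ /G.
have [_|_] := eqVneq (ab c) b; first by rewrite mul1r.
by rewrite setI0 measure0 /npoints fset_set0 cardfs0 !mul0r subrr.
Qed.

Let sum_E (F : E -> R) : \sum_e F e = \sum_c F (true, c) + \sum_c F (false, c).
Proof.
rewrite (eq_bigr (fun e : E => F (e.1, e.2))); last by case.
by rewrite -(pair_bigA _ (fun b c => F (b, c))) /= big_bool.
Qed.

Let predh (c : 'I_n * 'I_n) := (ord_pred c.1, c.2).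
Let predv (c : 'I_n * 'I_n) := (c.1, ord_pred c.2).
Let predh_inj : injective predh.
Proof.
by move=> [i j] [i' j'] /eqP; rewrite xpair_eqE /= => /andP[/eqP/ord_pred_inj -> /eqP ->].
Qed.
Let predv_inj : injective predv.
Proof.
by move=> [i j] [i' j'] /eqP; rewrite xpair_eqE /= => /andP[/eqP -> /eqP/ord_pred_inj ->].
Qed.

Let divJ b : v b - nu b = \sum_e J e * ((tgt e == b)%:R - (src e == b)%:R).
Proof.
rewrite v_nu sum_E.
transitivity (\sum_(c : 'I_n * 'I_n) Jh c.1 c.2 * ((ab (predh c) == b)%:R - (ab c == b)%:R) +
  \sum_(c : 'I_n * 'I_n) Jv c.1 c.2 * ((ab (predv c) == b)%:R - (ab c == b)%:R)); last by [].
(* The index n reached by [i.+1] becomes 0 for the cyclic successor; the flow vanishes at both. *)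
have H (F : nat -> R) (i : 'I_n) : F 0%N = 0 -> F n = 0 -> F i.+1 = F (ordS i).
  move=> F0 Fn /=; have := ltn_ord i; rewrite leq_eqVlt => /orP[/eqP e|lt].
    by rewrite e modnn Fn F0.
  by rewrite modn_small.
have Rh : \sum_(c : 'I_n * 'I_n) Jh c.1 c.2 * (ab (predh c) == b)%:R =
    \sum_(c : 'I_n * 'I_n) Jh c.1.+1 c.2 * (ab c == b)%:R.
  rewrite [RHS](reindex_inj predh_inj); apply: eq_bigr => c _; congr (_ * _).
  have [h1 h2] := Jh0 c.2.
  by have := H (Jh^~ c.2) (ord_pred c.1) h1 h2; rewrite ord_predK => ->.
have Rv : \sum_(c : 'I_n * 'I_n) Jv c.1 c.2 * (ab (predv c) == b)%:R =
    \sum_(c : 'I_n * 'I_n) Jv c.1 c.2.+1 * (ab c == b)%:R.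
  rewrite [RHS](reindex_inj predv_inj); apply: eq_bigr => c _; congr (_ * _).
  have [h1 h2] := Jv0 c.1.
  by have := H (Jv c.1) (ord_pred c.2) h1 h2; rewrite ord_predK => ->.
have Sh : \sum_(c : 'I_n * 'I_n) Jh c.1 c.2 * ((ab (predh c) == b)%:R - (ab c == b)%:R) =
    \sum_(c : 'I_n * 'I_n) (Jh c.1.+1 c.2 - Jh c.1 c.2) * (ab c == b)%:R.
  under eq_bigr do rewrite mulrBr.
  rewrite sumrB; apply: (etrans (congr1 (fun z => z - _) Rh)).
  by rewrite -sumrB; apply: eq_bigr => c _; rewrite mulrBl.
have Sv : \sum_(c : 'I_n * 'I_n) Jv c.1 c.2 * ((ab (predv c) == b)%:R - (ab c == b)%:R) =
    \sum_(c : 'I_n * 'I_n) (Jv c.1 c.2.+1 - Jv c.1 c.2) * (ab c == b)%:R.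
  under eq_bigr do rewrite mulrBr.
  rewrite sumrB; apply: (etrans (congr1 (fun z => z - _) Rv)).
  by rewrite -sumrB; apply: eq_bigr => c _; rewrite mulrBl.
apply: (etrans _ (esym (congr2 +%R Sh Sv))).
by rewrite -big_split; apply: eq_bigr => c _ /=; rewrite mulrC mulrDl.
Qed.

Let J_short e : J e != 0 -> `|cn (val (src e)) - cn (val (tgt e))| <= C * l.
Proof.
move=> Je; apply: a_lip; move: Je; rewrite /J /prd; case: e => [[] [i j]] /= Je.
  rewrite [ `|_|]prod_normE /= subrr normr0 ge_max (ltW l0) andbT.
  have : (0 < i)%N by rewrite lt0n; apply: contraNneq Je => ->; apply/eqP; case: (Jh0 j).
  move=> i0; have -> : ((i + n).-1 %% n)%N = i.-1.
    by have := ltn_ord i; case: (nat_of_ord i) i0 => // k _ kn; rewrite addSn /= modnDr modn_small // ltnW.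
  rewrite opprD addrACA subrr add0r -mulrBl -{1}(prednK i0) -natr1 addrAC subrr add0r mul1r.
  by rewrite gtr0_norm.
rewrite [ `|_|]prod_normE /= subrr normr0 ge_max (ltW l0) andTb.
have : (0 < j)%N by rewrite lt0n; apply: contraNneq Je => ->; apply/eqP; case: (Jv0 i).
move=> j0; have -> : ((j + n).-1 %% n)%N = j.-1.
  by have := ltn_ord j; case: (nat_of_ord j) j0 => // k _ kn; rewrite addSn /= modnDr modn_small // ltnW.
rewrite opprD addrACA subrr add0r -mulrBl -{1}(prednK j0) -natr1 addrAC subrr add0r mul1r.
by rewrite gtr0_norm.
Qed.

Let fiber_card b : \sum_c ((ab c == b)%:R : R) <= M%:R.
Proof.
rewrite -natr_sum ler_nat; apply: (leq_trans _ (aM (val b))).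
rewrite -sum1_card [leqRHS]big_mkcond /=; apply: leq_sum => c _.
by rewrite -(inj_eq val_inj) /= unfold_in /=; case: (_ == _).
Qed.

Let deg b : \sum_e ((src e == b)%:R + (tgt e == b)%:R) <= (4 * M)%:R :> R.
Proof.
rewrite sum_E.
suff H : \sum_c ((ab c == b)%:R + (ab (predh c) == b)%:R) +
  \sum_c ((ab c == b)%:R + (ab (predv c) == b)%:R) <= (4 * M)%:R :> R by exact: H.
have Fh : \sum_c ((ab (predh c) == b)%:R : R) = \sum_c (ab c == b)%:R.
  by rewrite [RHS](reindex_inj predh_inj).
have Fv : \sum_c ((ab (predv c) == b)%:R : R) = \sum_c (ab c == b)%:R.
  by rewrite [RHS](reindex_inj predv_inj).
have F := fiber_card b.
apply: (le_trans (y := M%:R + M%:R + (M%:R + M%:R))).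
  rewrite [X in X + _ <= _]big_split [X in _ + X <= _]big_split.
  apply: lerD; apply: lerD; [exact: F| |exact: F|].
    by apply: (le_trans _ F); rewrite le_eqVlt; apply/orP; left; apply/eqP; exact: Fh.
  by apply: (le_trans _ F); rewrite le_eqVlt; apply/orP; left; apply/eqP; exact: Fv.
by rewrite natrM mulr_natl -!mulr2n -mulrnA.
Qed.

(** The gain of the folding: the block of b contains the entire cell b, as that cell is fixed by [a]
    and lies in Om. *)
Let kap_nu b : l ^+ 2 / fine (leb2 Om) <= nu b.
Proof.
rewrite ler_pM2r ?invr_gt0 //.
have ba : ab (val b) = b by apply/val_inj/eqP; exact: (valP b).
have cA : cl (val b) `<=` A b.
  move=> x cx; split; last by exists (val b).
  by move: cx; rewrite -{1}(eqP (valP b)); exact: aOm.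
have -> : l ^+ 2 = fine (leb2 (cl (val b))).
  rewrite /cell /square leb2_rect ?lerDl ?ltW //=; ring.
have fA : leb2 (A b) \is a fin_num.
  by apply: leb2_fin => //; apply: (sub_bounded_set _ _ _ bOm); exact: AOm.
apply: fine_le => //; last by apply: le_measure; rewrite ?inE.
by apply: leb2_fin => //; exact: rect_bounded.
Qed.

(** Blocks have radius [(1 + C) * l] about their cells and edges have length at most [C * l], so
    [462 = 3 * 150 + 12]. A node has degree at most [4 * M], two directions with two ends each,
    whence [8 * M]. *)
Lemma W2_grid_le (c : R) :
  (462 * (1 + C) ^+ 2) * l ^+ 2 * (1 + 8 * M%:R * fine (leb2 Om) / l ^+ 2 *
    \sum_(i < n) \sum_(j < n) (Jh i j ^+ 2 + Jv i j ^+ 2)) <= c ->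
  (W2 (empirical (X `&` Om)) (uniform_on Om) <= (Num.sqrt c)%:E)%E.
Proof.
move=> hc.
have kap0 : 0 < l ^+ 2 / fine (leb2 Om) by rewrite divr_gt0 // exprn_gt0.
have v0 b : 0 <= v b by rewrite divr_ge0.
have nu1 : \sum_b nu b = 1.
  by rewrite -mulr_suml -(area_partition A Om A_disj A_cover) // divff // gt_eqF.
have h0 : 0 < C * l by rewrite mulr_gt0.
have [pi [cpi Hpi]] := signed_flow_coupling nu v src tgt J (fun b => cn (val b)) (C * l)
  _ _ v0 nu1 kap0 kap_nu h0 divJ J_short deg.
apply: (@W2_finite_le _ _ Om (X `&` Om) A (fun b => cn (val b)) ((1 + C) * l) pi) => //.
- by rewrite -ge0_fin_numE // leb2_fin.
- move=> b x [Omx [c' <- cx]].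
  have -> : x - cn (val (ab c')) = (x - cn c') - (cn (val (ab c')) - cn c').
    by rewrite opprB addrA subrK.
  apply: (le_trans (ler_normB _ _)); rewrite mulrDl mul1r; apply: lerD.
    exact: cell_near.
  exact: a_near cx Omx.
- by move=> b; apply: lt_le_trans (kap_nu b).
- case: cpi => p0 pl pr; split => // y; rewrite pr /v.
  by rewrite -setIA (setIidr (@AOm y)).
set SJ := \sum_(i < n) _ in hc.
have SJE : \sum_e J e ^+ 2 = SJ.
  rewrite sum_E /J /= -big_split /= /SJ.
  by rewrite (pair_bigA _ (fun i j : 'I_n => Jh i j ^+ 2 + Jv i j ^+ 2)).
have SJ0 : 0 <= SJ.
  by rewrite -SJE; apply: sumr_ge0 => e _; exact: sqr_ge0.
apply: (le_trans _ hc).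
move: Hpi; rewrite SJE natrM.
have -> : 2 * (4 * M%:R) / (l ^+ 2 / fine (leb2 Om)) * SJ =
    8 * M%:R * fine (leb2 Om) / l ^+ 2 * SJ.
  by field; rewrite !gt_eqF.
have : 0 <= 8 * M%:R * fine (leb2 Om) / l ^+ 2 * SJ.
  by apply: mulr_ge0 => //; apply: divr_ge0; rewrite ?sqr_ge0 // !mulr_ge0 // ltW.
move: (8 * M%:R * fine (leb2 Om) / l ^+ 2 * SJ) => Q Q0 Hpi.
have e1 : (C * l) ^+ 2 <= ((1 + C) * l) ^+ 2.
  move: (ltW h0); rewrite mulrDl mul1r; move: (C * l) => z z0.
  have l00 := ltW l0; rewrite lerXn2r ?nnegrE ?addr_ge0 //.
  by rewrite lerDr.
have e2 : 0 <= ((1 + C) * l) ^+ 2 by exact: sqr_ge0.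
have -> : 462 * (1 + C) ^+ 2 * l ^+ 2 * (1 + Q) = 462 * (((1 + C) * l) ^+ 2 * (1 + Q)) by ring.
have e3 : (C * l) ^+ 2 * (1 + Q) <= ((1 + C) * l) ^+ 2 * (1 + Q) by apply: ler_wpM2r => //; lra.
have e4 : 0 <= ((1 + C) * l) ^+ 2 * Q by exact: mulr_ge0.
lra.
Qed.

End grid_coupling.

(** * Mean bounds and scaling *)

Section mean_bounds.
Context {d : measure_display} {T : measurableType d} {R : realType}.
Variable P : probability T R.

(** Measurability and sign travel with the bound, so that bounds can be added and scaled without
    side conditions. *)
Definition mean_le (g : T -> R) (c : R) : Prop :=
  [/\ measurable_fun setT g, forall t, 0 <= g t & (\int[P]_t (g t)%:E <= c%:E)%E].

Lemma mean_leW (g : T -> R) (c c' : R) : c <= c' -> mean_le g c -> mean_le g c'.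
Proof. by move=> cc [m g0 h]; split => //; rewrite (le_trans h) // lee_fin. Qed.

Lemma mean_le_dom (g g' : T -> R) (c : R) : measurable_fun setT g' -> (forall t, 0 <= g' t) ->
  (forall t, g' t <= g t) -> mean_le g c -> mean_le g' c.
Proof.
move=> mg' g'0 gg [m g0 h]; split => //; apply: (le_trans _ h).
by apply: ge0_le_integral_any => // t; rewrite lee_fin.
Qed.

Lemma mean_leD (g1 g2 : T -> R) (a b : R) : mean_le g1 a -> mean_le g2 b ->
  mean_le (fun t => g1 t + g2 t) (a + b).
Proof.
move=> [m1 p1 h1] [m2 p2 h2]; split => [|t|]; first exact: measurable_funD.
  exact: addr_ge0.
under eq_integral do rewrite EFinD.
rewrite ge0_integralD //; try (by move=> t _; rewrite lee_fin); try exact/measurable_EFinP.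
by rewrite EFinD; exact: leeD.
Qed.

Lemma mean_leZ (g : T -> R) (a k : R) : 0 <= k -> mean_le g a -> mean_le (fun t => k * g t) (k * a).
Proof.
move=> k0 [m p h]; split => [|t|]; first exact: measurable_funM.
  exact: mulr_ge0.
under eq_integral do rewrite EFinM.
rewrite ge0_integralZl //; try (by move=> t _; rewrite lee_fin); try exact/measurable_EFinP.
by rewrite EFinM; apply: lee_wpmul2l.
Qed.

Lemma mean_le_cst (c : R) : 0 <= c -> mean_le (fun=> c) c.
Proof.
move=> c0; split => //.
by rewrite integral_cst // -[leRHS]mule1; apply: lee_wpmul2l => //; exact: probability_le1.
Qed.

Lemma mean_le_sum (I : Type) (r : seq I) (g : I -> T -> R) (c : I -> R) :
  (forall i, mean_le (g i) (c i)) ->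
  mean_le (fun t => \sum_(i <- r) g i t) (\sum_(i <- r) c i).
Proof.
move=> H; elim: r => [|i r IH].
  rewrite big_nil (_ : (fun t => _) = fun=> 0); first exact: mean_le_cst.
  by apply/funext => t; rewrite big_nil.
rewrite big_cons (_ : (fun t => _) = fun t => g i t + \sum_(i <- r) g i t).
  exact: mean_leD.
by apply/funext => t; rewrite big_cons.
Qed.

End mean_bounds.

Section scaling.
Context {R : realType}.

Definition up (s : R) (A : set (R * R)) : set (R * R) := (fun y => s^-1 *: y) @^-1` A.

Lemma npoints_dilate s (X A : set (R * R)) : 0 < s ->
  npoints (dilate s^-1 X `&` A) = npoints (X `&` up s A).
Proof.
move=> s0; rewrite /npoints.
have sK : injective (fun y : R * R => s^-1 *: y).
  by apply: scalerI; rewrite gt_eqF // invr_gt0.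
have -> : dilate s^-1 X `&` A = [set s^-1 *: y | y in X `&` up s A].
  apply/seteqP; split => x; first by move=> [[y Xy <-] Ay]; exists y.
  by move=> [y [Xy Ay] <-]; split => //; exists y.
have [fin|infin] := pselect (finite_set (X `&` up s A)).
  by rewrite fset_set_image // card_imfset.
(* When the sets are infinite, [fset_set] is empty on both sides and both counts are 0. *)
have infin' : ~ finite_set [set s^-1 *: y | y in X `&` up s A].
  move=> /(finite_image (fun y => s *: y)); rewrite image_comp.
  rewrite (_ : _ \o _ = id) ?image_id //; apply/funext => y /=.
  by rewrite scalerA divff ?scale1r // gt_eqF.
by rewrite /fset_set; case: pselect => // _; case: pselect.
Qed.

Lemma up_square s a b l : 0 < s -> up s (square a b l) = square (s * a) (s * b) (s * l).
Proof.
move=> s0; rewrite /up /square.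
have H (a0 l0 x : R) : (a0 <= s^-1 * x < a0 + l0) = (s * a0 <= x < s * a0 + s * l0).
  by rewrite -mulrDr mulrC ler_pdivlMr // ltr_pdivrMr // ![_ * s]mulrC.
apply/seteqP; split => x [/=]; rewrite !in_itv /= => h1 h2; split;
  rewrite /= ?in_itv /=; by [rewrite -H|rewrite H].
Qed.

Lemma measurable_up s A : measurable A -> measurable (up s A).
Proof.
move=> mA; rewrite -[up s A]setTI.
have -> : up s A = (fun x => 0 + s^-1 *: x) @^-1` A.
  by apply/seteqP; split => x; rewrite /up /= add0r.
by apply: (measurable_affine2 0 s^-1).
Qed.

Lemma bounded_up s A : 0 < s -> bounded_set A -> bounded_set (up s A).
Proof.
move=> s0 /bounded_rect[M M0 AM].
apply: (sub_bounded_set _ (up s (square (- M) (- M) (M + M)))).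
  by move=> x Ax; have := AM _ Ax; rewrite /up /square /= addKr.
by rewrite up_square //; exact: rect_bounded.
Qed.

Lemma area_up s A : 0 < s -> measurable A -> fine (leb2 (up s A)) = s ^+ 2 * fine (leb2 A).
Proof.
move=> s0 mA; rewrite (leb2_affine 0 s) //; last exact: measurable_up.
have -> : (fun x => 0 + s *: x) @^-1` up s A = A.
  by apply/seteqP; split => x; rewrite /up /= add0r scalerA mulVf ?gt_eqF // scale1r.
by case: (leb2 A) => [r //||]; rewrite ?gt0_muley ?gt0_muleNy ?lte_fin ?exprn_gt0 //= mulr0.
Qed.

End scaling.

(** * Discrepancies of squares *)

Section discrepancy.
Context {d : measure_display} {T : measurableType d} {R : realType}.
Variables (P : probability T R) (Xi : T -> set (R * R)) (Om : set (R * R)).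
Variables (c1 V Cq q s : R).
Hypothesis ppXi : point_process Xi.
Hypothesis mOm : measurable Om.
Hypothesis bOm : bounded_set Om.
Hypothesis Om0 : 0 < fine (leb2 Om).
Hypothesis V0 : 0 <= V.
Hypothesis Cq0 : 0 <= Cq.
Hypothesis q0 : 0 <= q.
Hypothesis s0 : 0 < s.
Hypothesis varV : forall A : set (R * R), measurable A -> bounded_set A ->
  (\int[P]_t ((cnt Xi A t - c1 * fine (leb2 A)) ^+ 2)%:E <= (V * fine (leb2 A))%:E)%E.
Hypothesis varS : forall (m : nat) (u a b : R), 1 <= u -> u <= 2 ->
  (\int[P]_t ((cnt Xi (square a b (2 ^+ m * u)) t - c1 * (2 ^+ m * u) ^+ 2) ^+ 2)%:E
    <= (Cq * 4 ^+ m * q ^+ m)%:E)%E.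

Definition dev (A : set (R * R)) (t : T) : R :=
  cnt Xi (up s A) t - c1 * (s ^+ 2 * fine (leb2 A)).

(** The share of the area is multiplied by the actual number of points in Om. The total over the
    square is then exactly zero, and division by that number gives the difference of the two
    probability masses. *)
Definition disc (A : set (R * R)) (t : T) : R :=
  cnt Xi (up s (A `&` Om)) t - fine (leb2 (A `&` Om)) / fine (leb2 Om) * cnt Xi (up s Om) t.

Let area_ge0 (A : set (R * R)) : 0 <= fine (leb2 A). Proof. exact: fine_ge0. Qed.

Lemma area_le (A B : set (R * R)) : measurable A -> measurable B -> bounded_set B ->
  A `<=` B -> fine (leb2 A) <= fine (leb2 B).
Proof.
move=> mA mB bB AB; apply: fine_le.
- by apply: leb2_fin => //; exact: (sub_bounded_set _ _ _ bB).
- exact: leb2_fin.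
- by apply: le_measure; rewrite ?inE.
Qed.

Lemma measurable_dev (A : set (R * R)) : measurable A -> bounded_set A -> measurable_fun setT (dev A).
Proof.
move=> mA bA; apply: measurable_funB => //.
by apply: measurable_cnt => //; [exact: measurable_up|exact: bounded_up].
Qed.

Lemma mean_dev (A : set (R * R)) : measurable A -> bounded_set A ->
  mean_le P (fun t => dev A t ^+ 2) (V * (s ^+ 2 * fine (leb2 A))).
Proof.
move=> mA bA; split; first by apply: measurable_funX; exact: measurable_dev.
  by move=> t; exact: sqr_ge0.
have := varV _ (measurable_up s A mA) (bounded_up s A s0 bA).
by rewrite area_up.
Qed.

Lemma measurable_square (a b l : R) : measurable (square a b l).
Proof. exact: measurable_rect. Qed.

Lemma bounded_square (a b l : R) : bounded_set (square a b l).
Proof. exact: rect_bounded. Qed.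

Lemma area_square (a b l : R) : 0 <= l -> fine (leb2 (square a b l)) = l ^+ 2.
Proof. by move=> l0; rewrite /square leb2_rect ?lerDl //=; ring. Qed.

Lemma mean_dev_square (m : nat) (u a b l : R) : 0 <= l -> s * l = 2 ^+ m * u ->
  1 <= u -> u <= 2 ->
  mean_le P (fun t => dev (square a b l) t ^+ 2) (Cq * 4 ^+ m * q ^+ m).
Proof.
move=> l0 sl u1 u2; split.
- apply: measurable_funX; apply: measurable_dev; [exact: measurable_square|exact: bounded_square].
- by move=> t; exact: sqr_ge0.
have := varS m u (s * a) (s * b) u1 u2; rewrite -sl.
by rewrite /dev up_square // area_square // exprMn.
Qed.

Lemma disc_dev (A : set (R * R)) t : disc A t = dev (A `&` Om) t - fine (leb2 (A `&` Om)) / fine (leb2 Om) * dev Om t.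
Proof. by rewrite /disc /dev; field; rewrite gt_eqF. Qed.

Lemma measurable_disc (A : set (R * R)) : measurable A -> measurable_fun setT (disc A).
Proof.
move=> mA; apply: measurable_funB; last apply: measurable_funM => //.
all: apply: measurable_cnt => //; [apply: measurable_up => //; exact: measurableI|apply: bounded_up => //].
all: by apply: (sub_bounded_set _ _ _ bOm) => x [].
Qed.

(** A square inside Om has the improved variance. Otherwise its part in Om lies in the layer E and
    the variance is bounded by area. The random normalisation adds the fluctuation of the count in
    Om, weighted by the squared share of area. *)
Lemma mean_disc_square (m : nat) (u a b l : R) (E : set (R * R)) :
  0 <= l -> s * l = 2 ^+ m * u -> 1 <= u -> u <= 2 ->
  measurable E -> E `<=` Om ->
  (forall x, Om x -> square a b l x -> ~ (square a b l `<=` Om) -> E x) ->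
  mean_le P (fun t => disc (square a b l) t ^+ 2)
   (2 * (Cq * 4 ^+ m * q ^+ m + V * (s ^+ 2 * fine (leb2 (square a b l `&` E)))) +
    2 * ((fine (leb2 (square a b l `&` Om)) / fine (leb2 Om)) ^+ 2 *
     (V * (s ^+ 2 * fine (leb2 Om))))).
Proof.
move=> l0 sl u1 u2 mE EOm layer; set Q := square a b l.
have mQ : measurable Q by exact: measurable_square.
have bQ : bounded_set Q by exact: bounded_square.
have mQO : measurable (Q `&` Om) by exact: measurableI.
have bQO : bounded_set (Q `&` Om) by apply: (sub_bounded_set _ _ _ bOm) => x [].
set r := fine (leb2 (Q `&` Om)) / fine (leb2 Om).
apply: (@mean_le_dom _ _ _ _ (fun t => 2 * dev (Q `&` Om) t ^+ 2 + 2 * (r ^+ 2 * dev Om t ^+ 2))).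
- by apply: measurable_funX; exact: measurable_disc.
- by move=> t; exact: sqr_ge0.
- move=> t; rewrite disc_dev -/Q -/r.
  have := sqr_ge0 (dev (Q `&` Om) t + r * dev Om t).
  rewrite !expr2; move: (dev _ t) (dev _ t) => x y; nra.
have s20 : 0 <= s ^+ 2 by exact: sqr_ge0.
have CC : 0 <= Cq * 4 ^+ m * q ^+ m by rewrite !mulr_ge0 // exprn_ge0.
apply: mean_leD; apply: mean_leZ => //; last first.
  by apply: mean_leZ; [exact: sqr_ge0|exact: mean_dev].
have [QOm|nQOm] := pselect (Q `<=` Om).
  rewrite setIidl //; apply: (mean_leW _ _ (Cq * 4 ^+ m * q ^+ m)).
    by rewrite lerDl; do 2!apply: mulr_ge0 => //.
  exact: mean_dev_square sl u1 u2.
apply: (mean_leW _ _ (V * (s ^+ 2 * fine (leb2 (Q `&` Om))))); last exact: mean_dev.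
rewrite -[leLHS]add0r; apply: lerD => //.
do 2!apply: ler_wpM2l => //.
apply: area_le => //; first exact: measurableI.
  by apply: (sub_bounded_set _ _ _ bQ) => x [].
by move=> x [Qx Omx]; split => //; exact: layer.
Qed.

Section grid.
Variables (x0 y0 l : R) (n : nat).
Hypothesis l0 : 0 < l.

Let cells_disj (D : set (R * R)) (c c' : 'I_n * 'I_n) x :
  (cell x0 y0 l c `&` D) x -> (cell x0 y0 l c' `&` D) x -> c = c'.
Proof. by move=> [cx _] [cx' _]; apply: (cell_inj x0 y0 l _ c c' x). Qed.

Let cells_cover (D : set (R * R)) x : (square x0 y0 (n%:R * l) `&` D) x <->
  exists c : 'I_n * 'I_n, (cell x0 y0 l c `&` D) x.
Proof.
split => [[Qx Dx]|[c [cx Dx]]].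
  by have [c cx] := cell_exists x0 y0 l n x l0 Qx; exists c.
split => //; move: cx => -[/=]; rewrite !in_itv /= => /andP[h1 h2] /andP[h3 h4].
have H (i : 'I_n) : 0 <= i%:R * l /\ i%:R * l + l <= n%:R * l.
  split; first by rewrite mulr_ge0 // ltW.
  have -> : i%:R * l + l = i.+1%:R * l by rewrite -natr1 mulrDl mul1r.
  by rewrite ler_pM2r // ler_nat.
have [e1 e2] := H c.1; have [e3 e4] := H c.2.
by split; rewrite /= in_itv /=; apply/andP; split; lra.
Qed.

Lemma area_square_cells (D : set (R * R)) : measurable D ->
  fine (leb2 (square x0 y0 (n%:R * l) `&` D)) =
  \sum_(c : 'I_n * 'I_n) fine (leb2 (cell x0 y0 l c `&` D)).
Proof.
move=> mD; apply: area_partition (cells_disj D) (cells_cover D) _ _.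
  by move=> c; apply: measurableI => //; exact: measurable_square.
by apply: (sub_bounded_set _ _ _ (bounded_square x0 y0 (n%:R * l))) => x [].
Qed.

Lemma cnt_square_cells t (D : set (R * R)) :
  cnt Xi (up s (square x0 y0 (n%:R * l) `&` D)) t =
  \sum_(c : 'I_n * 'I_n) cnt Xi (up s (cell x0 y0 l c `&` D)) t.
Proof.
apply: npoints_partition.
- by move=> c c' x; exact: cells_disj.
- by move=> x; exact: cells_cover.
- apply: bounded_no_limit_point_finite; first by case: ppXi.
  apply: bounded_up => //.
  by apply: (sub_bounded_set _ _ _ (bounded_square x0 y0 (n%:R * l))) => x [].
Qed.

Lemma disc_square_cells t :
  \sum_(c : 'I_n * 'I_n) disc (cell x0 y0 l c) t = disc (square x0 y0 (n%:R * l)) t.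
Proof.
by rewrite sumrB -!mulr_suml -area_square_cells // -cnt_square_cells.
Qed.

(** The boundary terms add up to the area of the layer. The shares of area sum to 1 and each is at
    most [l ^+ 2] over the area of Om, so their squares sum to at most that quotient. *)
Lemma mean_disc_level (m : nat) (u eb : R) (E : set (R * R)) :
  s * l = 2 ^+ m * u -> 1 <= u -> u <= 2 -> Om `<=` square x0 y0 (n%:R * l) ->
  measurable E -> E `<=` Om -> fine (leb2 E) <= eb ->
  (forall a b x, Om x -> square a b l x -> ~ (square a b l `<=` Om) -> E x) ->
  mean_le P (fun t => \sum_(c : 'I_n * 'I_n) disc (cell x0 y0 l c) t ^+ 2)
   (2 * (n%:R ^+ 2 * (Cq * 4 ^+ m * q ^+ m)) + 2 * V * s ^+ 2 * (eb + l ^+ 2)).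
Proof.
move=> sl u1 u2 OmQ mE EOm Eeb layer.
apply: mean_leW (mean_le_sum P _ _ _ _ (fun c : 'I_n * 'I_n =>
  mean_disc_square m u _ _ l E (ltW l0) sl u1 u2 mE EOm (layer _ _))).
have QE : square x0 y0 (n%:R * l) `&` E = E by apply/setIidr => x /EOm /OmQ.
have QO : square x0 y0 (n%:R * l) `&` Om = Om by exact/setIidr.
have s20 : 0 <= s ^+ 2 by exact: sqr_ge0.
rewrite big_split /= -!mulr_sumr big_split /= sumr_const card_prod card_ord.
rewrite -!mulr_sumr -(area_square_cells E) // QE.
have -> : (Cq * 4 ^+ m * q ^+ m) *+ (n * n) = n%:R ^+ 2 * (Cq * 4 ^+ m * q ^+ m).
  by rewrite -mulr_natl natrM -expr2.
set W := n%:R ^+ 2 * _.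
have h1 : V * (s ^+ 2 * fine (leb2 E)) <= V * (s ^+ 2 * eb) by do 2!apply: ler_wpM2l => //.
rewrite -mulr_suml.
have h2 : (\sum_(c : 'I_n * 'I_n) (fine (leb2 (cell x0 y0 l c `&` Om)) / fine (leb2 Om)) ^+ 2) *
    (V * (s ^+ 2 * fine (leb2 Om))) <= V * (s ^+ 2 * l ^+ 2).
  have -> : V * (s ^+ 2 * l ^+ 2) = (l ^+ 2 / fine (leb2 Om)) * (V * (s ^+ 2 * fine (leb2 Om))).
    by field; rewrite gt_eqF.
  apply: ler_wpM2r; first by do 2!apply: mulr_ge0 => //.
  apply: (@le_trans _ _ (\sum_(c : 'I_n * 'I_n) (l ^+ 2 / fine (leb2 Om)) *
     (fine (leb2 (cell x0 y0 l c `&` Om)) / fine (leb2 Om)))).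
    apply: ler_sum => c _; rewrite expr2; apply: ler_wpM2r; first by rewrite divr_ge0.
    rewrite ler_pM2r ?invr_gt0 // -(area_square (corner x0 y0 l c).1 (corner x0 y0 l c).2 l (ltW l0)).
    apply: area_le; [|exact: measurable_square|exact: bounded_square|by move=> x []].
    by apply: measurableI => //; exact: measurable_square.
  rewrite -mulr_sumr -mulr_suml -area_square_cells // QO divff ?mulr1 // gt_eqF //.
move: h1 h2; set Y := (X in X <= V * (s ^+ 2 * l ^+ 2)) => h1 h2.
have -> : 2 * V * s ^+ 2 * (eb + l ^+ 2) = 2 * (V * (s ^+ 2 * eb)) + 2 * (V * (s ^+ 2 * l ^+ 2)) by ring.
change (2 * (W + V * (s ^+ 2 * fine (leb2 E))) + 2 * Y <=
  2 * W + (2 * (V * (s ^+ 2 * eb)) + 2 * (V * (s ^+ 2 * l ^+ 2)))).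
by move: W Y h1 h2 => W Y h1 h2; lra.
Qed.

End grid.
End discrepancy.

Lemma sum_geometric_two_sided {R : realFieldType} (rho : R) K : 0 < rho -> rho < 1 ->
  \sum_(m < K) (rho ^+ m + rho ^+ (K - m)) <= 2 / (1 - rho).
Proof.
move=> r0 r1; have r10 : 0 < 1 - rho by lra.
have pK k : 0 <= rho ^+ k by rewrite exprn_ge0 // ltW.
have H1 : (\sum_(m < K) rho ^+ m) * (1 - rho) = 1 - rho ^+ K.
  elim: K => [|K IH]; first by rewrite big_ord0 expr0; ring.
  by rewrite big_ord_recr /= mulrDl IH exprS; ring.
have H2 : (\sum_(m < K) rho ^+ (K - m)) * (1 - rho) = rho - rho ^+ K.+1.
  elim: K {H1} => [|K IH]; first by rewrite big_ord0 expr1; ring.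
  rewrite big_ord_recl /= subn0.
  under eq_bigr do rewrite /bump leq0n add1n subSS.
  by rewrite mulrDl IH !exprS; ring.
rewrite ler_pdivlMr // big_split /= mulrDl H1 H2.
by have := pK K; have := pK K.+1; lra.
Qed.

(** * Energy of the flow, summed over dyadic scales *)

Section levels.
Context {d : measure_display} {T : measurableType d} {R : realType}.
Variables (P : probability T R) (Xi : T -> set (R * R)) (Om : set (R * R)).
Variables (c1 V Cq q s : R).
Hypothesis ppXi : point_process Xi.
Hypothesis mOm : measurable Om.
Hypothesis bOm : bounded_set Om.
Hypothesis Om0 : 0 < fine (leb2 Om).
Hypothesis V0 : 0 <= V.
Hypothesis Cq0 : 0 <= Cq.
Hypothesis q0 : 0 <= q.
Hypothesis s0 : 0 < s.
Hypothesis varV : forall A : set (R * R), measurable A -> bounded_set A ->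
  (\int[P]_t ((cnt Xi A t - c1 * fine (leb2 A)) ^+ 2)%:E <= (V * fine (leb2 A))%:E)%E.
Hypothesis varS : forall (m : nat) (u a b : R), 1 <= u -> u <= 2 ->
  (\int[P]_t ((cnt Xi (square a b (2 ^+ m * u)) t - c1 * (2 ^+ m * u) ^+ 2) ^+ 2)%:E
    <= (Cq * 4 ^+ m * q ^+ m)%:E)%E.
Variables (x0 y0 l Cb S rho : R) (K : nat).
Hypothesis l0 : 0 < l.
Hypothesis S0 : 0 < S.
Hypothesis Kl : (2 ^ K)%:R * l = S.
Hypothesis sl1 : 1 <= s * l.
Hypothesis sl2 : s * l <= 2.
Hypothesis OmQ : Om `<=` square x0 y0 S.
Hypothesis Cb0 : 0 <= Cb.
Hypothesis layers : forall l', 0 < l' -> exists E : set (R * R),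
  [/\ measurable E, E `<=` Om, fine (leb2 E) <= Cb * l' &
    forall a b x, Om x -> square a b l' x -> ~ (square a b l' `<=` Om) -> E x].
Hypothesis rho0 : 0 < rho.
Hypothesis rho1 : rho < 1.
Hypothesis rhoq : q <= rho ^+ 2.
Hypothesis rho2 : 2^-1 <= rho ^+ 2.

Definition grid_disc (t : T) (i j : nat) : R :=
  disc Xi Om s (square (x0 + i%:R * l) (y0 + j%:R * l) l) t.

Definition weight (m : nat) : R := rho ^+ m + rho ^+ (K - m).

Definition energy (t : T) : R := \sum_(m < K) (weight m)^-1 *
  \sum_(a < 2 ^ (K - m)) \sum_(b < 2 ^ (K - m)) block_sum (grid_disc t) m a b ^+ 2.

Lemma weight_gt0 m : 0 < weight m.
Proof. by rewrite addr_gt0 // exprn_gt0. Qed.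

(** The discrepancy is additive over cells, so a block sum is the discrepancy of a single larger
    square, to which the variance bounds apply. *)
Lemma block_sum_disc t m a b : block_sum (grid_disc t) m a b =
  disc Xi Om s (square (x0 + a%:R * ((2 ^ m)%:R * l)) (y0 + b%:R * ((2 ^ m)%:R * l))
    ((2 ^ m)%:R * l)) t.
Proof.
rewrite -(disc_square_cells Xi Om s ppXi mOm s0 _ _ _ (2 ^ m) l0).
rewrite -(pair_bigA _ (fun i j : 'I_(2 ^ m) => disc Xi Om s (cell _ _ _ (i, j)) t)) /=.
apply: eq_bigr => i _; apply: eq_bigr => j _; rewrite /grid_disc /cell /=.
have H (r x k : nat) (z : R) : z + x%:R * (k%:R * l) + r%:R * l = z + (x * k + r)%:R * l.
  by rewrite natrD natrM; ring.
by rewrite !H.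
Qed.

Lemma grid_disc_sum0 t : \sum_(i < 2 ^ K) \sum_(j < 2 ^ K) grid_disc t i j = 0.
Proof.
transitivity (block_sum (grid_disc t) K 0 0).
  by apply: eq_bigr => i _; apply: eq_bigr => j _; rewrite mul0n.
rewrite block_sum_disc Kl !mul0r !addr0 /disc (setIidr OmQ) divff ?gt_eqF // mul1r.
by rewrite subrr.
Qed.

Let A0 := 2 * (Cq * S ^+ 2) + 2 * V * (Cb * S + S ^+ 2).

(** Interior squares contribute with the factor [q ^+ m], at most [(rho ^+ m) ^+ 2]. The layer and
    the random normalisation contribute with the inverse of [n = 2 ^ (K - m)] or better, and this
    inverse is at most [(rho ^+ (K - m)) ^+ 2]. *)
Let mean_level m : (m < K)%N ->
  mean_le P (fun t => \sum_(a < 2 ^ (K - m)) \sum_(b < 2 ^ (K - m))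
      block_sum (grid_disc t) m a b ^+ 2)
    (A0 * s ^+ 2 * ((rho ^+ m) ^+ 2 + (rho ^+ (K - m)) ^+ 2)).
Proof.
move=> mK; pose l' := (2 ^ m)%:R * l; pose n := (2 ^ (K - m))%N.
have l'0 : 0 < l' by rewrite mulr_gt0 // ltr0n expn_gt0.
have nl' : n%:R * l' = S.
  by rewrite /l' mulrA -natrM /n -expnD subnK // ltnW.
have sl' : s * l' = 2 ^+ m * (s * l) by rewrite /l' natrX; ring.
have [E [mE EOm Eeb layer]] := layers l' l'0.
have OmQ' : Om `<=` square x0 y0 (n%:R * l') by rewrite nl'.
have := mean_disc_level P Xi Om c1 V Cq q s ppXi mOm bOm Om0 V0 Cq0 q0 s0 varV varS
  x0 y0 l' n l'0 m (s * l) (Cb * l') E sl' sl1 sl2 OmQ' mE EOm Eeb layer.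
have -> : (fun t => \sum_(c : 'I_n * 'I_n) disc Xi Om s (cell x0 y0 l' c) t ^+ 2) =
  (fun t => \sum_(a < n) \sum_(b < n) block_sum (grid_disc t) m a b ^+ 2).
  apply/funext => t.
  rewrite -(pair_bigA _ (fun i j : 'I_n => disc Xi Om s (cell _ _ _ (i, j)) t ^+ 2)) /=.
  by apply: eq_bigr => i _; apply: eq_bigr => j _; rewrite block_sum_disc.
apply: mean_leW; set x := rho ^+ m; set y := rho ^+ (K - m).
have s20 : 0 <= s ^+ 2 by exact: sqr_ge0.
have hq : q ^+ m <= x ^+ 2.
  by rewrite /x exprAC lerXn2r // nnegrE // sqr_ge0.
have hy : (n%:R)^-1 <= y ^+ 2.
  rewrite /y /n natrX -exprVn exprAC lerXn2r // nnegrE ?sqr_ge0 // invr_ge0 //.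
have n1 : 1 <= n%:R :> R by rewrite ler1n expn_gt0.
have n0 : 0 < n%:R :> R by lra.
have l'E : l' = S * (n%:R)^-1 by rewrite -nl' mulrAC divff ?mul1r // gt_eqF.
have hl : l' <= S * y ^+ 2 by rewrite l'E ler_pM2l.
have hl2 : l' ^+ 2 <= S ^+ 2 * y ^+ 2.
  rewrite l'E exprMn ler_pM2l ?exprn_gt0 //; apply: (le_trans _ hy).
  by rewrite expr2; apply: ler_piMr; rewrite ?invf_le1 // invr_ge0 ltW.
(* The left side is the number of finest cells, at most the area of the square in the original scale
   because [1 <= s * l]. *)
have h4 : n%:R ^+ 2 * 4 ^+ m <= S ^+ 2 * s ^+ 2.
  have -> : n%:R ^+ 2 * 4 ^+ m = ((2 ^ K)%:R) ^+ 2 :> R.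
    have -> : 4 ^+ m = ((2 ^ m)%:R) ^+ 2 :> R by rewrite natrX exprAC; congr (_ ^+ _); ring.
    by rewrite -exprMn -natrM /n -expnD subnK // ltnW.
  have sS : (2 ^ K)%:R <= S * s by rewrite -Kl -mulrA (mulrC l) ler_peMr.
  have Ss0 := ltW (mulr_gt0 S0 s0).
  by rewrite -exprMn lerXn2r ?nnegrE.
have g1 : 2 * (n%:R ^+ 2 * (Cq * 4 ^+ m * q ^+ m)) <= 2 * (Cq * S ^+ 2) * s ^+ 2 * x ^+ 2.
  have -> : 2 * (n%:R ^+ 2 * (Cq * 4 ^+ m * q ^+ m)) =
    (2 * Cq) * ((n%:R ^+ 2 * 4 ^+ m) * q ^+ m) by ring.
  have -> : 2 * (Cq * S ^+ 2) * s ^+ 2 * x ^+ 2 = (2 * Cq) * ((S ^+ 2 * s ^+ 2) * x ^+ 2) by ring.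
  apply: ler_wpM2l; first by rewrite mulr_ge0.
  by apply: ler_pM => //; exact: exprn_ge0.
have g2 : 2 * V * s ^+ 2 * (Cb * l' + l' ^+ 2) <= 2 * V * (Cb * S + S ^+ 2) * s ^+ 2 * y ^+ 2.
  have -> : 2 * V * (Cb * S + S ^+ 2) * s ^+ 2 * y ^+ 2 =
    2 * V * s ^+ 2 * (Cb * (S * y ^+ 2) + S ^+ 2 * y ^+ 2) by ring.
  have V20 : 0 <= 2 * V by exact: mulr_ge0.
  apply: ler_wpM2l; first exact: mulr_ge0.
  by apply: lerD => //; exact: ler_wpM2l.
have g3 : 0 <= 2 * (Cq * S ^+ 2) * s ^+ 2 * y ^+ 2.
  apply: mulr_ge0; last exact: sqr_ge0.
  apply: mulr_ge0 => //; apply: mulr_ge0 => //.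
  by apply: mulr_ge0 => //; exact: sqr_ge0.
have g4 : 0 <= 2 * V * (Cb * S + S ^+ 2) * s ^+ 2 * x ^+ 2.
  apply: mulr_ge0; last exact: sqr_ge0.
  apply: mulr_ge0 => //; apply: mulr_ge0; first exact: mulr_ge0.
  by apply: addr_ge0; [apply: mulr_ge0 => //; exact: ltW|exact: sqr_ge0].
have -> : A0 * s ^+ 2 * (x ^+ 2 + y ^+ 2) =
  2 * (Cq * S ^+ 2) * s ^+ 2 * x ^+ 2 + 2 * V * (Cb * S + S ^+ 2) * s ^+ 2 * y ^+ 2 +
  (2 * (Cq * S ^+ 2) * s ^+ 2 * y ^+ 2 + 2 * V * (Cb * S + S ^+ 2) * s ^+ 2 * x ^+ 2).
  by rewrite /A0; ring.
have H (e f c g e' f' : R) : e <= e' -> f <= f' -> 0 <= c -> 0 <= g ->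
  e + f <= e' + f' + (c + g) by move=> *; lra.
exact: (H _ _ _ _ _ _ g1 g2 g3 g4).
Qed.

(** Level m has mean at most a constant times [weight m ^+ 2]; after division by the weight one
    factor is left, and the weights have a sum independent of K. *)
Lemma mean_energy : mean_le P energy
  ((2 * (Cq * S ^+ 2) + 2 * V * (Cb * S + S ^+ 2)) * s ^+ 2 * (2 / (1 - rho))).
Proof.
rewrite -/A0.
have A00 : 0 <= A0 * s ^+ 2.
  apply: mulr_ge0; last exact: sqr_ge0.
  apply: addr_ge0.
    by apply: mulr_ge0 => //; apply: mulr_ge0 => //; exact: sqr_ge0.
  apply: mulr_ge0; first exact: mulr_ge0.
  by apply: addr_ge0; [apply: mulr_ge0 => //; exact: ltW|exact: sqr_ge0].
apply: mean_leW (mean_le_sum P _ _ _ (fun m : 'I_K => A0 * s ^+ 2 * weight m) _).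
  by rewrite -mulr_sumr; apply: ler_wpM2l => //; exact: sum_geometric_two_sided.
move=> m; have w0 := weight_gt0 m.
apply: mean_leW (mean_leZ P _ _ (weight m)^-1 _ (mean_level m (ltn_ord m))); last first.
  by rewrite invr_ge0 ltW.
rewrite mulrC ler_pdivrMr // -[leRHS]mulrA; apply: ler_wpM2l => //.
rewrite /weight; set x := rho ^+ m; set y := rho ^+ (K - m).
have hx : 0 <= x by rewrite exprn_ge0 // ltW.
have hy : 0 <= y by rewrite exprn_ge0 // ltW.
by rewrite -expr2 sqrrD lerD2r lerDl mulrn_wge0 // mulr_ge0.
Qed.

End levels.

(** * The rate *)

Lemma ediam_ge0 {R : realType} (A : set (R * R)) : 0 <= ediam A.
Proof.
rewrite /ediam; case: (pselect (has_sup [set enorm (p.1 - p.2) | p in A `*` A])) => [hs|nhs].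
  have [[x [p Ap _]] ub] := hs.
  apply: (le_trans (enorm_ge0 (p.1 - p.2))).
  by apply: ub_le_sup => //; exists p.
by rewrite sup_out.
Qed.

Lemma W2_ge0 {R : realType} (mu nu : set (R * R) -> \bar R) : (0 <= W2 mu nu)%E.
Proof. exact: poweR_ge0. Qed.

Lemma W2_to_uniform_ge0 {R : realType} (Om X : set (R * R)) : (0 <= W2_to_uniform Om X)%E.
Proof.
rewrite /W2_to_uniform; case: ifP => _; last exact: W2_ge0.
by rewrite lee_fin ediam_ge0.
Qed.

(** The partition into the single block Om, of radius [R0]: the finite cost is zero, and 12 is
    rounded up to the square 16. *)
Lemma W2_trivial_le {R : realType} (Om X : set (R * R)) (p0 : R * R) (R0 : R) :
  measurable Om -> bounded_set Om -> 0 < fine (leb2 Om) -> 0 <= R0 ->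
  (forall x, Om x -> `|x - p0| <= R0) -> finite_set (X `&` Om) ->
  npoints (X `&` Om) != 0%N ->
  (W2 (empirical (X `&` Om)) (uniform_on Om) <= (4 * R0)%:E)%E.
Proof.
move=> mOm bOm Om0 R00 near finX X0.
have -> : 4 * R0 = Num.sqrt ((4 * R0) ^+ 2) by rewrite sqrtr_sqr ger0_norm // mulr_ge0.
have cost0 : fcost (fun=> p0) (fun _ _ : unit => 1 : R) = 0.
  by rewrite /fcost /sqcost !big1 ?addr0 // => i _; apply: big1 => j _;
    rewrite subrr expr0n mulr0.
apply: (@W2_finite_le R unit Om (X `&` Om) (fun=> Om) (fun=> p0) R0 (fun _ _ => 1)) => //.
- by rewrite -ge0_fin_numE // leb2_fin.
- by move=> [] [].
- by move=> x; split => [Omx|[] //]; exists tt.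
- by move=> _; rewrite divr_gt0.
- split => // [] []; rewrite big_const card_unit /= addr0 ?divff ?gt_eqF //.
  by rewrite -setIA setIid divff // pnatr_eq0.
- rewrite cost0; nra.
Qed.

(** * Bounds for a fixed configuration *)

Section pointwise.
Context {d : measure_display} {T : measurableType d} {R : realType}.
Variables (Xi : T -> set (R * R)) (Om : set (R * R)).
Variables (c1 s : R).
Hypothesis ppXi : point_process Xi.
Hypothesis mOm : measurable Om.
Hypothesis bOm : bounded_set Om.
Hypothesis Om0 : 0 < fine (leb2 Om).
Hypothesis c10 : 0 < c1.
Hypothesis s0 : 0 < s.
Variables (x0 y0 l S rho C : R) (K M : nat).
Hypothesis C0 : 0 < C.
Hypothesis l0 : 0 < l.
Hypothesis Kl : (2 ^ K)%:R * l = S.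
Hypothesis sl1 : 1 <= s * l.
Hypothesis sl2 : s * l <= 2.
Hypothesis OmQ : Om `<=` square x0 y0 S.
Hypothesis rho0 : 0 < rho.
Hypothesis rho1 : rho < 1.
Variable a : 'I_(2 ^ K) * 'I_(2 ^ K) -> 'I_(2 ^ K) * 'I_(2 ^ K).
Hypothesis aa : forall c, a (a c) = a c.
Hypothesis aOm : forall c, cell x0 y0 l (a c) `<=` Om.
Hypothesis a_lip : forall c c', `|corner x0 y0 l c - corner x0 y0 l c'| <= l ->
  `|corner x0 y0 l (a c) - corner x0 y0 l (a c')| <= C * l.
Hypothesis a_near : forall c x, cell x0 y0 l c x -> Om x ->
  `|corner x0 y0 l (a c) - corner x0 y0 l c| <= C * l.
Hypothesis aM : forall b, (#|[pred c | a c == b]| <= M)%N.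

Local Notation area := (fine (leb2 Om)).
Local Notation Y := (energy Xi Om s x0 y0 l rho K).
Local Notation N t := (cnt Xi (up s Om) t).
Local Notation mu := (c1 * (s ^+ 2 * area)).

Lemma energy_ge0 t : 0 <= Y t.
Proof.
apply: sumr_ge0 => m _; apply: mulr_ge0.
  by rewrite invr_ge0 addr_ge0 // exprn_ge0 // ltW.
by apply: sumr_ge0 => i _; apply: sumr_ge0 => j _; exact: sqr_ge0.
Qed.

Lemma cnt_dilate A t : (npoints (dilate s^-1 (Xi t) `&` A))%:R = cnt Xi (up s A) t.
Proof. by rewrite npoints_dilate. Qed.

Lemma finite_dilate t : finite_set (dilate s^-1 (Xi t) `&` Om).
Proof.
have fin : finite_set (Xi t `&` up s Om).
  by apply: bounded_no_limit_point_finite; [case: ppXi|exact: bounded_up].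
apply: (sub_finite_set _ (finite_image (fun y : R * R => s^-1 *: y) fin)).
by move=> x [[y Xy <-] Omy]; exists y.
Qed.

(** The squared distance is of order [(1 + Q) / s ^+ 2] with Q proportional to the energy. Replacing
    the square root of [1 + Q] by [1 + Q] makes the bound linear in the energy, ready for taking
    means. The constants are [1848 = 4 * 462], from [l ^+ 2 <= 4 / s ^+ 2], and
    [512 = 8 * 16 * 4]. *)
Lemma W2_energy_le t : mu / 2 <= N t ->
  (W2_to_uniform Om (dilate s^-1 (Xi t)) <=
    ((1848 * (1 + C) ^+ 2 + 1) / s *
      (1 + 512 * M%:R / (c1 ^+ 2 * area * (1 - rho)) * (Y t / s ^+ 2)))%:E)%E.
Proof.
move=> muN.
have mu0 : 0 < mu by rewrite mulr_gt0 // mulr_gt0 // exprn_gt0.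
have N0 : 0 < N t by lra.
have Nne : npoints (dilate s^-1 (Xi t) `&` Om) != 0%N.
  by rewrite -(pnatr_eq0 R) cnt_dilate gt_eqF.
rewrite /W2_to_uniform (negPf Nne).
have [Jh [Jv [flow Jh0 Jv0 energyJ]]] := grid_flow K (grid_disc Xi Om s x0 y0 l t)
  (weight rho K) (weight_gt0 rho K rho0) (grid_disc_sum0 Xi Om s ppXi mOm Om0 s0 x0 y0 l S K l0 Kl OmQ t).
have r10 : 0 < 1 - rho by rewrite subr_gt0.
have Y0 := energy_ge0 t.
set SJ := \sum_(i < 2 ^ K) _ in energyJ.
have SJle : SJ <= 16 / (1 - rho) * Y t.
  apply: (le_trans energyJ).
  have -> : 16 / (1 - rho) * Y t = 8 * (2 / (1 - rho)) * Y t by ring.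
  apply: ler_wpM2r => //; rewrite ler_pM2l //.
  exact: sum_geometric_two_sided.
have OmQ' : Om `<=` square x0 y0 ((2 ^ K)%:R * l) by rewrite Kl.
pose Q := 512 * M%:R / (c1 ^+ 2 * area * (1 - rho)) * (Y t / s ^+ 2).
have ca0 : 0 < c1 ^+ 2 * area * (1 - rho) by rewrite !mulr_gt0.
have Q0 : 0 <= Q.
  rewrite /Q; apply: mulr_ge0; apply: divr_ge0.
  - by apply: mulr_ge0; exact: ler0n.
  - exact: ltW.
  - exact: Y0.
  - exact: sqr_ge0.
set b := 1848 * (1 + C) ^+ 2 + 1.
have b1 : 1 <= b by rewrite /b lerDr; apply: mulr_ge0; [exact: ler0n|exact: sqr_ge0].
rewrite -/Q.
have bE : b - 1 = 462 * (1 + C) ^+ 2 * 4 by rewrite /b; ring.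
clearbody b.
have -> : b / s * (1 + Q) = Num.sqrt ((b / s * (1 + Q)) ^+ 2).
  rewrite sqrtr_sqr ger0_norm //; apply: mulr_ge0; last exact: addr_ge0.
  by apply: divr_ge0; [exact: le_trans b1|exact: ltW].
pose N' : R := (npoints (dilate s^-1 (Xi t) `&` Om))%:R.
have N'E : N' = N t by exact: cnt_dilate.
(* Division by the number of points turns the flow of counts into a flow of probability masses. *)
apply: (@W2_grid_le R x0 y0 l C (2 ^ K) M Om (dilate s^-1 (Xi t)) a
  (fun i j => Jh i j / N') (fun i j => Jv i j / N')) => //.
- exact: finite_dilate.
- move=> c; rewrite -/N' cnt_dilate N'E.
  have := flow c.1 c.2 (ltn_ord _) (ltn_ord _); rewrite /grid_disc /disc => e.
  transitivity ((Jh c.1.+1 c.2 - Jh c.1 c.2 + (Jv c.1 c.2.+1 - Jv c.1 c.2)) / N t).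
    by rewrite -e; rewrite /cell /=; field; rewrite !gt_eqF.
  by ring.
- by move=> j; have [-> ->] := Jh0 j; rewrite mul0r.
- by move=> i; have [-> ->] := Jv0 i; rewrite mul0r.
have -> : \sum_(i < 2 ^ K) \sum_(j < 2 ^ K) ((Jh i j / N') ^+ 2 + (Jv i j / N') ^+ 2) =
    SJ / N t ^+ 2.
  rewrite /SJ mulr_suml; apply: eq_bigr => i _; rewrite mulr_suml; apply: eq_bigr => j _.
  by rewrite N'E !expr_div_n mulrDl.
have il : (l ^+ 2)^-1 <= s ^+ 2.
  rewrite -[leLHS]mul1r ler_pdivrMr ?exprn_gt0 // -exprMn.
  by rewrite exprn_ege1.
have l2 : l ^+ 2 <= 4 / s ^+ 2.
  rewrite ler_pdivlMr ?exprn_gt0 // -exprMn mulrC.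
  have -> : 4 = 2 ^+ 2 :> R by ring.
  by rewrite lerXn2r // ?nnegrE ?mulr_ge0 // ltW.
have inner : 8 * M%:R * area / l ^+ 2 * (SJ / N t ^+ 2) <= Q.
  have SJ0 : 0 <= SJ by apply: sumr_ge0 => i _; apply: sumr_ge0 => j _; rewrite addr_ge0 // sqr_ge0.
  have iN : (N t ^+ 2)^-1 <= 4 / mu ^+ 2.
    rewrite -[leLHS]mul1r ler_pdivrMr ?exprn_gt0 //.
    rewrite mulrAC ler_pdivlMr ?exprn_gt0 // mul1r.
    have -> : 4 * N t ^+ 2 = (2 * N t) ^+ 2 by ring.
    rewrite lerXn2r ?nnegrE //; [exact: ltW|by rewrite mulr_ge0|lra].
  have -> : Q = (8 * M%:R * area) * (s ^+ 2 * ((16 / (1 - rho) * Y t) * (4 / mu ^+ 2))).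
    rewrite /Q; field; rewrite !gt_eqF //.
  rewrite -mulrA; apply: ler_wpM2l; first by rewrite !mulr_ge0 // ltW.
  apply: ler_pM => //; rewrite ?invr_ge0 ?sqr_ge0 //.
    by rewrite divr_ge0 // sqr_ge0.
  by apply: ler_pM => //; rewrite invr_ge0 sqr_ge0.
have e0 : 0 <= 462 * (1 + C) ^+ 2 by apply: mulr_ge0; [exact: ler0n|exact: sqr_ge0].
move: (462 * (1 + C) ^+ 2) e0 bE => z z0 bE.
apply: (@le_trans _ _ (z * (4 / s ^+ 2) * (1 + Q))).
  apply: ler_pM => //.
  - by apply: mulr_ge0 => //; exact: sqr_ge0.
  - rewrite addr_ge0 // mulr_ge0 // divr_ge0 ?sqr_ge0 //.
      by rewrite !mulr_ge0 // ltW.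
    by apply: sumr_ge0 => i _; apply: sumr_ge0 => j _; rewrite addr_ge0 // sqr_ge0.
  - by apply: ler_wpM2l.
  - by rewrite lerD2l.
have -> : z * (4 / s ^+ 2) * (1 + Q) = (1 + Q) / s ^+ 2 * (b - 1).
  by rewrite bE; field; rewrite gt_eqF.
have -> : (b / s * (1 + Q)) ^+ 2 = (1 + Q) / s ^+ 2 * (b ^+ 2 * (1 + Q)).
  by field; rewrite gt_eqF.
apply: ler_wpM2l; first by rewrite divr_ge0 ?sqr_ge0 // addr_ge0.
clearbody Q; nra.
Qed.

(** Chebyshev's inequality before taking means: on this event [4 * (N t - mu) ^+ 2 / mu ^+ 2] is at
    least 1, and the distance is at most a constant, also under the convention for no points. *)
Lemma W2_deviation_le t (p0 : R * R) (R0 : R) : 0 <= R0 ->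
  (forall x, Om x -> `|x - p0| <= R0) -> N t < mu / 2 ->
  (W2_to_uniform Om (dilate s^-1 (Xi t)) <=
    ((ediam Om + 4 * R0) * (4 / mu ^+ 2) * dev Xi c1 s Om t ^+ 2)%:E)%E.
Proof.
move=> R00 near Nmu; have mu0 : 0 < mu by rewrite mulr_gt0 // mulr_gt0 // exprn_gt0.
have e0 := ediam_ge0 Om.
apply: (@le_trans _ _ (ediam Om + 4 * R0)%:E).
  rewrite /W2_to_uniform; case: ifPn => [_|ne].
    by rewrite lee_fin lerDl mulr_ge0.
  apply: le_trans (W2_trivial_le Om _ p0 R0 mOm bOm Om0 R00 near (finite_dilate t) ne) _.
  by rewrite lee_fin lerDr.
rewrite lee_fin -mulrA ler_peMr ?addr_ge0 ?mulr_ge0 //.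
rewrite mulrAC ler_pdivlMr ?exprn_gt0 // mul1r /dev.
have -> : 4 * (N t - mu) ^+ 2 = (2 * (mu - N t)) ^+ 2 by ring.
rewrite lerXn2r ?nnegrE //; [exact: ltW| |]; lra.
Qed.

End pointwise.

Lemma dyadic_scale {R : realType} (x : R) : 1 <= x ->
  exists K : nat, (2 ^ K)%:R <= x /\ x <= 2 * (2 ^ K)%:R.
Proof.
move=> x1; have x0 : 0 <= x by lra.
have /andP[h1 h2] := truncn_itv x0.
set k := Num.truncn x in h1 h2.
have k1 : (0 < k)%N by rewrite -ltnS -(ltr_nat R); apply: le_lt_trans h2.
exists (trunc_log 2 k); split.
  by apply: le_trans h1; rewrite ler_nat trunc_logP.
apply: (le_trans (ltW h2)); rewrite -natrM -expnS ler_nat.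
exact: trunc_log_ltn.
Qed.

Theorem theorem6 (R : realType) (d : measure_display) (T : measurableType d)
    (P : probability T R) (Xi : T -> set (R * R)%type)
    (hXi : hyperuniform P Xi)
    (htype : type_I P Xi \/ type_II P Xi \/ type_III P Xi)
    (Om : set (R * R)%type) (Om_nonempty : Om !=set0) (Om_open : open Om)
    (Om_bounded : bounded_set Om)
    (Om_convex : convex_set (Om : set (convex_lmodType (R * R)%type))) :
  exists C L0 : R, [/\ 0 < C, 1 <= L0 &
    forall L : R, L0 <= L ->
      (\int[P]_t W2_to_uniform Om (dilate (Num.sqrt L)^-1 (Xi t))
         <= (C / Num.sqrt L)%:E)%E].
Proof.
have [ppXi [c1 [c10 hom]] _ _] := hXi.
have [Sm [Ms [Ks [al [r0 [spS gap]]]]]] := type_spectral_gap P Xi htype.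
have [V V0 varV] : exists2 V : R, 0 <= V &
    forall A : set (R * R), measurable A -> bounded_set A ->
    (\int[P]_t ((cnt Xi A t - c1 * fine (leb2 A)) ^+ 2)%:E <= (V * fine (leb2 A))%:E)%E.
  exists (144 * Ms); last by move=> A mA bA; exact: variance_cnt_le spS gap A mA bA.
  by case: gap => M0 _ _ _ _; apply: mulr_ge0; [exact: ler0n|exact: ltW].
have [Cq [q [Cq0 q0 q1 varS]]] := variance_square_le P Xi c1 Sm Ms Ks al r0 ppXi hom spS gap.
have mOm := open_measurable2 _ Om_open.
have [p0 [rh [R0 [Om_conv rh0 Om_ball Om_bound]]]] :=
  convex_open_bounded_data Om Om_nonempty Om_open Om_bounded Om_convex.
have Omp0 : Om p0 by apply: Om_ball; rewrite subrr normr0.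
have R00 : 0 <= R0 by apply: le_trans (Om_bound _ Omp0).
have area0 : 0 < fine (leb2 Om).
  have r20 : 0 < rh / 2 by rewrite divr_gt0.
  apply: (@lt_le_trans _ _ (fine (leb2 (square p0.1 p0.2 (rh / 2))))).
    by rewrite area_square ?exprn_gt0 // ltW.
  apply: area_le => //; first exact: measurable_square.
  move=> x Qx; apply: Om_ball; apply: le_lt_trans (_ : rh / 2 < rh); last by lra.
  by apply: (square_near _ _ _ _ _ _ Qx); split; rewrite /= in_itv /= lexx ltrDl.
have [Mb Mb0 OmMb] := bounded_rect _ Om_bounded.
pose S := 2 * Mb + 1.
have S1 : 1 <= S by rewrite /S; lra.
have S0 : 0 < S by lra.
have OmS : Om `<=` square (- Mb) (- Mb) S.
  move=> x /OmMb [/=]; rewrite !in_itv /= => /andP[h1 h2] /andP[h3 h4].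
  by split; rewrite /= in_itv /= /S; apply/andP; split; lra.
have [C [M [l0 [C0 [l00 retr]]]]] := grid_retraction (- Mb) (- Mb) Om p0 rh R0 S
  Om_conv rh0 Om_ball Om_bound.
pose Cb := 4 * fine (leb2 Om) / rh.
have Cb0 : 0 <= Cb by apply: divr_ge0; [apply: mulr_ge0|]; rewrite ?ler0n // ltW.
have layers := boundary_layer Om p0 rh mOm Om_bounded Om_conv rh0 Om_ball.
(* The arithmetic mean of 1 and m has square at least m. *)
have [rho [rho0 rho1 rhoq rho2]] : exists rho : R,
    [/\ 0 < rho, rho < 1, q <= rho ^+ 2 & 2^-1 <= rho ^+ 2].
  pose m := Num.max q 2^-1; exists ((1 + m) / 2).
  have mq : q <= m by rewrite le_max lexx.
  have m2 : 2^-1 <= m by rewrite le_max lexx orbT.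
  have m1 : m < 1 by rewrite gt_max q1; lra.
  have mm : m <= ((1 + m) / 2) ^+ 2.
    have := sqr_ge0 (1 - m); have -> : ((1 + m) / 2) ^+ 2 = (1 - m) ^+ 2 / 4 + m by field.
    lra.
  split; [lra|lra|exact: le_trans mm|exact: le_trans mm].
have r10 : 0 < 1 - rho by rewrite subr_gt0.
have [B [B0 BE]] : exists B : R, 0 < B /\ B = 1848 * (1 + C) ^+ 2 + 1.
  eexists; split; last by [].
  by apply: ltr_wpDl; [apply: mulr_ge0; [exact: ler0n|exact: sqr_ge0]|exact: ltr01].
have [A2 [A20 A2E]] : exists A2 : R, 0 <= A2 /\
    A2 = 512 * M%:R / (c1 ^+ 2 * fine (leb2 Om) * (1 - rho)).
  eexists; split; last by [].
  apply: divr_ge0; first by apply: mulr_ge0; exact: ler0n.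
  by apply: mulr_ge0; [apply: mulr_ge0; [exact: sqr_ge0|exact: ltW]|exact: ltW].
pose A1 := (2 * (Cq * S ^+ 2) + 2 * V * (Cb * S + S ^+ 2)) * (2 / (1 - rho)).
have A10 : 0 <= A1.
  have S20 := sqr_ge0 S; apply: mulr_ge0; last by apply: divr_ge0; [|exact: ltW].
  apply: addr_ge0.
    by apply: mulr_ge0 => //; apply: mulr_ge0 => //; exact: ltW.
  apply: mulr_ge0; first exact: mulr_ge0.
  by apply: addr_ge0 => //; apply: mulr_ge0 => //; exact: ltW.
pose D := ediam Om + 4 * R0.
have D0 : 0 <= D by apply: addr_ge0; [exact: ediam_ge0|exact: mulr_ge0].
pose A4 := 4 * D * V / (c1 ^+ 2 * fine (leb2 Om)).
have A40 : 0 <= A4.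
  apply: divr_ge0; first by apply: mulr_ge0 => //; exact: mulr_ge0.
  by apply: mulr_ge0; [exact: sqr_ge0|exact: ltW].
(* The threshold gives [1 <= s] and [2 / l0 <= s]; the latter makes the cells smaller than [l0], as
   [grid_retraction] requires. *)
exists (B * (1 + A2 * A1) + A4), (1 + (2 / l0) ^+ 2); split.
- by apply: ltr_pwDl => //; apply: mulr_gt0 => //; apply: ltr_pwDl => //; exact: mulr_ge0.
- by rewrite lerDl sqr_ge0.
move=> L hL; set s := Num.sqrt L.
have L0 : 0 <= L by apply: le_trans hL; rewrite addr_ge0 ?sqr_ge0.
have sL : s ^+ 2 = L by exact: sqr_sqrtr.
have s1 : 1 <= s.
  by rewrite -sqrtr1; apply: ler_wsqrtr; apply: le_trans hL; rewrite lerDl sqr_ge0.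
have s0 : 0 < s by lra.
have s2l : 2 / l0 <= s.
  have -> : 2 / l0 = Num.sqrt ((2 / l0) ^+ 2).
    by rewrite sqrtr_sqr ger0_norm // divr_ge0 // ltW.
  by apply: ler_wsqrtr; apply: le_trans hL; rewrite lerDr.
(* With [2 ^ K] cells per side, a cell has side between 1 and 2 in the original scale of the
   process. *)
have [K [K1 K2]] : exists K : nat, (2 ^ K)%:R <= S * s /\ S * s <= 2 * (2 ^ K)%:R.
  by apply: dyadic_scale; rewrite -[leLHS]mulr1; apply: ler_pM.
have n0 : 0 < (2 ^ K)%:R :> R by rewrite ltr0n expn_gt0.
pose l := S / (2 ^ K)%:R.
have l_gt0 : 0 < l by rewrite divr_gt0.
have Kl : (2 ^ K)%:R * l = S by rewrite /l mulrCA divff ?mulr1 // gt_eqF.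
have sl1 : 1 <= s * l by rewrite /l mulrA ler_pdivlMr // mul1r (mulrC s).
have sl2 : s * l <= 2 by rewrite /l mulrA ler_pdivrMr // (mulrC s).
have ll0 : l <= l0.
  rewrite -(ler_pM2l s0); apply: (le_trans sl2).
  by rewrite -ler_pdivrMr.
have OmQ : Om `<=` square (- Mb) (- Mb) ((2 ^ K)%:R * l) by rewrite Kl.
have KS : (2 ^ K)%:R * l <= S by rewrite Kl.
have [a [aa aOm a_lip a_near aM]] := retr (2 ^ K)%N l l_gt0 ll0 OmQ KS.
pose Y := energy Xi Om s (- Mb) (- Mb) l rho K.
have mY : mean_le P Y (A1 * s ^+ 2).
  apply: mean_leW (mean_energy P Xi Om c1 V Cq q s ppXi mOm Om_bounded area0 V0 (ltW Cq0)
    (ltW q0) s0 varV varS (- Mb) (- Mb) l Cb S rho K l_gt0 S0 Kl sl1 sl2 OmS Cb0 layers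
    rho0 rho1 rhoq rho2).
  by rewrite /A1 mulrAC.
have mZ := mean_dev P Xi c1 V s ppXi s0 varV Om mOm Om_bounded.
set mu := c1 * (s ^+ 2 * fine (leb2 Om)).
have mu0 : 0 < mu by rewrite mulr_gt0 // mulr_gt0 // exprn_gt0.
pose A4' := D * (4 / mu ^+ 2).
have A4'0 : 0 <= A4' by apply: mulr_ge0 => //; apply: divr_ge0; rewrite ?sqr_ge0.
have A2s : 0 <= A2 / s ^+ 2 by apply: divr_ge0 => //; exact: sqr_ge0.
have Bs : 0 <= B / s by apply: divr_ge0; exact: ltW.
(* The sum of the bounds for many and for few points dominates the distance in both cases. The
   second term has mean of order [s ^- 2], within the rate since [1 <= s]. *)
pose g t := B / s * (1 + A2 / s ^+ 2 * Y t) + A4' * dev Xi c1 s Om t ^+ 2.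
have mg : mean_le P g ((B * (1 + A2 * A1) + A4) / s).
  apply: mean_leW (mean_leD P _ _ _ _ (mean_leZ P _ _ _ Bs (mean_leD P _ _ _ _
    (mean_le_cst P 1 ler01) (mean_leZ P _ _ _ A2s mY))) (mean_leZ P _ _ _ A4'0 mZ)).
  have -> : A2 / s ^+ 2 * (A1 * s ^+ 2) = A2 * A1 by field; rewrite gt_eqF.
  have -> : A4' * (V * (s ^+ 2 * fine (leb2 Om))) = A4 / s ^+ 2.
    by rewrite /A4' /A4 /mu; field; rewrite !gt_eqF.
  rewrite mulrDl mulrAC; apply: lerD => //; apply: ler_wpM2l => //.
  by rewrite lef_pV2 ?posrE ?exprn_gt0 // expr2 ler_peMr // ltW.
have [_ g0 intg] := mg.
(* The distance itself is not shown to be measurable in t; a pointwise majorant with controlled mean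
   is enough for its integral. *)
apply: (le_trans _ intg); apply: ge0_le_integral_any => t _; first exact: W2_to_uniform_ge0.
have Y0 : 0 <= Y t := energy_ge0 Xi Om s (- Mb) (- Mb) l rho K rho0 t.
have [Nmu|Nmu] := leP (mu / 2) (cnt Xi (up s Om) t).
  have := W2_energy_le Xi Om c1 s ppXi mOm Om_bounded area0 c10 s0 (- Mb) (- Mb) l S rho C K M
    C0 l_gt0 Kl sl1 sl2 OmS rho0 rho1 a aa aOm a_lip a_near aM t Nmu.
  rewrite -BE -A2E -/Y => /le_trans; apply; rewrite lee_fin /g.
  have -> : A2 * (Y t / s ^+ 2) = A2 / s ^+ 2 * Y t by ring.
  by rewrite lerDl; apply: mulr_ge0 => //; exact: sqr_ge0.
have := W2_deviation_le Xi Om c1 s ppXi mOm Om_bounded area0 c10 s0 t p0 R0 R00 Om_bound Nmu.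
move=> /le_trans; apply; rewrite lee_fin /g -/mu -/D -/A4' lerDr.
by apply: mulr_ge0 => //; apply: addr_ge0 => //; exact: mulr_ge0.
Qed.
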